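(* The category $\mathcal{E}\mathrm{lst}$ of elastic diffeological spaces (a full subcategory of the category of diffeological spaces) has a tangent structure given by: the Kan extended tangent functor $T=\mathbb{L}\hat T$; the bundle projection $\pi_X:=(\mathbb{L}\hat\pi)_X:TX\to X$; the zero section $0_X:=(\mathbb{L}\hat 0)_X:X\to TX$; the addition $+_X:=(\mathbb{L}\hat +)_X\circ\theta_{2,X}^{-1}:T_2X\to TX$; the symmetric structure $\tau_X:T^2X\to T^2X$ of Axiom (E2); and the vertical lift $\lambda_X:TX\to T^2X$ of Axiom (E3). Moreover, the Kan extension of the scalar $\mathbb{R}$-multiplication $\hat\kappa_U:\mathbb{R}\times\hat TU\to\hat TU$, i.e. $\kappa_X:\mathbb{R}\times TX\cong(\mathbb{L}(\mathbb{R}\times\hat T))X\xrightarrow{(\mathbb{L}\hat\kappa)_X}TX$, is a scalar multiplication by the ring object $\mathbb{R}$ for this tangent structure.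
   Context: DIFFEOLOGICAL SPACES. $\mathcal{E}\mathrm{ucl}$ is the category of open subsets $U\subset\mathbb{R}^n$, $n\ge 0$, and smooth maps. A diffeological space is a set $X$ with, for each $U\in\mathcal{E}\mathrm{ucl}$, a set of maps $U\to X$ called plots, such that constant maps are plots, precomposition of a plot with a smooth map is a plot, and a map that restricts to a plot on each member of an open cover of its domain is a plot. Morphisms are maps whose composition with every plot is a plot. The resulting category $\mathcal{D}\mathrm{flg}$ is complete, cocomplete and cartesian closed. $y:\mathcal{E}\mathrm{ucl}\to\mathcal{D}\mathrm{flg}$ is the full embedding equipping $U$ with all smooth maps as plots. An induction (strong monomorphism) is an injective morphism $f:X\to Y$ such that a map $p:U\to X$ is a plot whenever $f\circ p$ is a plot. KAN EXTENSION. For an endofunctor $\hat F$ of $\mathcal{E}\mathrm{ucl}$ let $\mathbb{L}\hat F:\mathcal{D}\mathrm{flg}\to\mathcal{D}\mathrm{flg}$ be the left Kan extension of $y\hat F$ along $y$: $(\mathbb{L}\hat F)X=\operatorname{colim}_{yU\to X}y\hat FU$ (colimit over the category of plots $y\downarrow X$). $\mathbb{L}$ is functorial in natural transformations, and $(\mathbb{L}\hat F)yU\cong y\hat FU$. There is a natural morphism $\mu_{\hat F,\hat G}:\mathbb{L}(\hat F\hat G)X\cong\operatorname{colim}_{yU\to X}(\mathbb{L}\hat F)y\hat GU\to(\mathbb{L}\hat F)\operatorname{colim}_{yU\to X}y\hat GU\cong(\mathbb{L}\hat F)(\mathbb{L}\hat G)X$. EUCLIDEAN STRUCTURE. For $U\subset\mathbb{R}^n$: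 $\hat TU=U\times\mathbb{R}^n$ (usual tangent functor), $\hat T_kU=U\times(\mathbb{R}^n)^k$ ($k$-fold fiber product of $\hat TU$ over $U$), $\hat T^2U=\hat T\hat TU=U\times(\mathbb{R}^n)^3$, and $\hat\pi_U(u,u_0)=u$, $\hat 0_U(u)=(u,0)$, $\hat +_U(u,u_0,v_0)=(u,u_0+v_0)$, $\hat\lambda_U(u,u_0)=(u,0,0,u_0)$, $\hat\tau_U(u,u_0,u_1,u_{01})=(u,u_1,u_0,u_{01})$, $\hat\kappa_U(r,(u,u_0))=(u,ru_0)$. TANGENT FUNCTOR. $T:=\mathbb{L}\hat T$, $\pi:=\mathbb{L}\hat\pi:T\to 1$, $T_kX:=TX\times_X\cdots\times_XTX$ ($k$ factors, fiber product along $\pi_X$ in $\mathcal{D}\mathrm{flg}$). ELASTIC SPACES. A diffeological space $X$ is elastic if: (E1) for all $k>1$ the natural morphism $\theta_{k,X}:(\mathbb{L}\hat T_k)X\to T_kX$, whose components are induced by the projections $\hat T_k\to\hat T$, is an isomorphism; (E2) with $\theta^2_X:=\mu_{\hat T,\hat T}:(\mathbb{L}\hat T^2)X\to T^2X$, there is a morphism $\tau_X:T^2X\to T^2X$ with $\tau_X\circ\theta^2_X=\theta^2_X\circ(\mathbb{L}\hat\tau)_X$ (unique since $\theta^2_X$ is surjective); (E3) $\lambda_X:=\theta^2_X\circ(\mathbb{L}\hat\lambda)_X:TX\to T^2X$ is an induction; (E4) for all $k>1$ the natural morphism $\nu_{k,X}=(T\mathrm{pr}_1,\dots,T\mathrm{pr}_k):TT_kX\to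 T^2X\times_{TX}^{T\pi_X,T\pi_X}\cdots\times_{TX}^{T\pi_X,T\pi_X}T^2X$ ($k$ factors) is injective; (E5) for all positive integers $k_1,\dots,k_n$ the space $T_{k_1}\cdots T_{k_n}X$ satisfies (E1)–(E4). TANGENT STRUCTURE. Notation: composition of functors is juxtaposition; for a natural transformation $\beta$, $(F\beta)_A=F(\beta_A)$ and $(\beta G)_A=\beta_{G(A)}$. A tangent structure on a category $\mathcal{C}$ is a functor $T:\mathcal{C}\to\mathcal{C}$ with natural transformations $\pi:T\to 1$, $0:1\to T$, $+:T_2\to T$, $\lambda:T\to T^2$, $\tau:T^2\to T^2$ such that: (1) the $k$-fold pullbacks $T_k=T\times_1\cdots\times_1T$ over $\pi$ exist for all $k\ge 1$, are pointwise, and are preserved by $T$ (i.e. $\nu_k:TT_k\to T^2\times_T^{T\pi,T\pi}\cdots\times_T^{T\pi,T\pi}T^2$ is an isomorphism); (2) $\pi:T\to 1$ with $0$ and $+$ is an abelian group object over $1$ in the category of endofunctors; (3) $\tau\circ\tau=\mathrm{id}$ and $(\tau T)(T\tau)(\tau T)=(T\tau)(\tau T)(T\tau)$; moreover $\pi T\circ\tau=T\pi$ and $\tau\circ T{+}=({+}T)\circ(\tau\times_T\tau)\circ\nu_2$ as morphisms $TT_2\to T^2$; (4) $\pi T\circ\lambda=0\circ\pi$, $\lambda T\circ\lambda=T\lambda\circ\lambda$, and $({+}T)\circ(\lambda\times_0\lambda)=\lambda\circ{+}$; (5) $\tau\circ\lambda=\lambda$ and $T\tau\circ\tau T\circ T\lambda=\lambda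 T\circ\tau$; (6) the square with top $\lambda:T\to T^2$, left $\pi:T\to 1$, right $(\pi T,T\pi):T^2\to T_2$, bottom $0\times_10:1\to T_2$ is a pointwise pullback. SCALAR MULTIPLICATION. Let $R$ be a ring object in $\mathcal{C}$. A scalar multiplication is a natural transformation $\kappa_X:R\times TX\to TX$ such that (written in elements) $\pi_X\kappa_X(r,v)=\pi_X(v)$; $\kappa(r,\kappa(s,v))=\kappa(rs,v)$; $\kappa(1,v)=v$; $\kappa(r+s,v)=\kappa(r,v)+\kappa(s,v)$; $\kappa(r,v+w)=\kappa(r,v)+\kappa(r,w)$; (compatibility with symmetric structure) $\tau_X\circ\kappa_{TX}=T\kappa_X\circ(0_R\times\tau_X):R\times T^2X\to T^2X$, where $0_R:R\to TR$ and $T(R\times TX)\cong TR\times T^2X$; (compatibility with vertical lift) $\lambda_X\circ\kappa_X=\kappa_{TX}\circ(\mathrm{id}_R\times\lambda_X)$. *)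

(* Defs.v *)
From HB Require Import structures.
From mathcomp Require Import all_boot all_order all_algebra.
From mathcomp Require Import all_classical all_reals topology normedtype landau derive.
From mathcomp Require Import ring lra.
Set Implicit Arguments.
Unset Strict Implicit.
Unset Printing Implicit Defensive.
Import Order.TTheory GRing.Theory Num.Theory.
Import numFieldNormedType.Exports.
Local Open Scope classical_set_scope.
Local Open Scope ring_scope.

Section Smooth.
Context {R : realType}.

(* C^infinity on the open set U: all iterated directional derivatives exist and are
   Frechet differentiable, hence continuous. *)
Definition smooth_on {W : normedModType R} n (U : set 'rV[R]_n) (f : 'rV[R]_n -> W) : Prop :=
  forall (vs : seq 'rV[R]_n) (x : 'rV[R]_n), U x ->
    differentiable (foldr (fun v g => 'D_v g) f vs) x.

Fixpoint diffk (k : nat) {W : normedModType R} n (U : set 'rV[R]_n) (f : 'rV[R]_n -> W) : Prop :=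
  if k is k'.+1 then
    (forall x, U x -> differentiable f x) /\ forall v, diffk k' U ('D_v f)
  else True.

Lemma smooth_onP {W : normedModType R} n (U : set 'rV[R]_n) (f : 'rV[R]_n -> W) :
  smooth_on U f <-> forall k, diffk k U f.
Proof.
split=> [sf k|df vs].
  elim: k f sf => [//|k IH] f sf; split; first exact: (sf [::]).
  move=> v; apply: IH => vs; have := sf (rcons vs v).
  by rewrite -cats1 foldr_cat.
elim/last_ind: vs f df => [|vs v IH] f df; first exact: (df 1%N).1.
rewrite -cats1 foldr_cat /=; apply: IH => k; exact: (df k.+1).2.
Qed.

Lemma near_differentiable {V W : normedModType R} (f g : V -> W) x :
  {near x, f =1 g} -> differentiable f x -> differentiable g x.
Proof.
move=> fg df; have cd := diff_continuous df.
have E : g \o shift x = cst (g x) + 'd f x +o_ (0 : V) id.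
  apply/eqaddoP => e e0; have /eqaddoP H := diff_locally df; have {}H := H e e0.
  have fgx : f x = g x by exact: (nbhs_singleton fg).
  have fg0 : \forall y \near (0 : V), f (y + x) = g (y + x).
    have : \forall y \near x, f y = g y by [].
    by rewrite (near_shift 0); apply: filterS => z; rewrite /= subr0.
  by apply: filterS2 H fg0 => z; rewrite !fctE /= fgx => + <-.
by apply/diff_locallyP; rewrite (diff_unique cd E).
Qed.

Lemma diffk_eq {W : normedModType R} k n (U : set 'rV[R]_n) (f g : 'rV[R]_n -> W) :
  open U -> {in U, f =1 g} -> diffk k U f -> diffk k U g.
Proof.
move=> oU; elim: k f g => [//|k IH] f g fg [df dDf].
have nfg x : U x -> {near x, f =1 g}.
  by move=> Ux; near=> y; apply/fg/mem_set; near: y; exact: open_nbhs_nbhs.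
split=> [x Ux|v]; first exact: near_differentiable (nfg _ Ux) (df _ Ux).
apply: IH (dDf v) => x /set_mem Ux; apply: near_eq_derive; exact: nfg.
Unshelve. all: by end_near. Qed.

Lemma diffkS {W : normedModType R} k n (U : set 'rV[R]_n) (f : 'rV[R]_n -> W) :
  diffk k.+1 U f -> diffk k U f.
Proof. by elim: k f => // k IH f [df dDf]; split=> // v; exact: IH. Qed.

Lemma diffk_cst {W : normedModType R} k n (U : set 'rV[R]_n) (c : W) : diffk k U (fun=> c).
Proof.
elim: k c => // k IH c; split=> [x _|v]; first exact: differentiable_cst.
rewrite (_ : 'D_v _ = fun=> 0); first exact: IH.
by apply/funext => x; rewrite derive_cst.
Qed.

Lemma diffkD {W : normedModType R} k n (U : set 'rV[R]_n) (f g : 'rV[R]_n -> W) :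
  open U -> diffk k U f -> diffk k U g -> diffk k U (fun x => f x + g x).
Proof.
move=> oU; elim: k f g => // k IH f g [df dDf] [dg dDg]; split=> [x Ux|v].
  by apply: differentiableD; [exact: df|exact: dg].
apply: (diffk_eq oU _ (IH _ _ (dDf v) (dDg v))) => x /set_mem Ux.
by rewrite -deriveD//; apply: diff_derivable; [exact: df|exact: dg].
Qed.

Lemma diffk_sum {W : normedModType R} k n p (U : set 'rV[R]_n) (f : 'I_p -> 'rV[R]_n -> W) :
  open U -> (forall i, diffk k U (f i)) -> diffk k U (fun x => \sum_(i < p) f i x).
Proof.
move=> oU df; elim: p f df => [|p IH] f df.
  rewrite (_ : (fun x => _) = fun=> 0); first exact: diffk_cst.
  by apply/funext => x; rewrite big_ord0.
rewrite (_ : (fun x => _) = fun x => f ord0 x + \sum_(i < p) f (lift ord0 i) x).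
  by apply: diffkD => //; apply: IH.
by apply/funext => x; rewrite big_ord_recl.
Qed.

Lemma diffkM k n (U : set 'rV[R]_n) (f g : 'rV[R]_n -> R) :
  open U -> diffk k U f -> diffk k U g -> diffk k U (fun x => f x * g x).
Proof.
move=> oU; elim: k f g => // k IH f g hf hg; have [[df dDf] [dg dDg]] := (hf, hg).
split=> [x Ux|v]; first by apply: differentiableM; [exact: df|exact: dg].
apply: (diffk_eq oU _ (diffkD oU (IH _ _ (diffkS hf) (dDg v)) (IH _ _ (diffkS hg) (dDf v)))).
move=> x /set_mem Ux.
by rewrite -[RHS]/('D_v (f * g) x) deriveM//; apply: diff_derivable; [exact: df|exact: dg].
Qed.

Lemma row_basisE n (x : 'rV[R]_n) : x = \sum_j x 0 j *: delta_mx 0 j.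
Proof. exact: row_sum_delta. Qed.

Lemma differentiable_row (V : normedModType R) m (f : V -> 'rV[R]_m) x :
  differentiable f x <-> forall j, differentiable (fun y => f y 0 j : R) x.
Proof.
split=> [df j|df].
  apply: (@differentiable_comp _ _ _ _ f (fun N : 'rV[R]_m => N 0 j : R)) => //.
  exact: differentiable_coord.
rewrite (_ : f = \sum_j (fun y => f y 0 j *: delta_mx 0 j)).
  by apply: differentiable_sum => j; apply: differentiableZl.
by apply/funext => y; rewrite fct_sumE -row_basisE.
Qed.

Lemma derive_coord (V : normedModType R) m (f : V -> 'rV[R]_m) x v j :
  differentiable f x -> ('D_v f x) 0 j = 'D_v (fun y => f y 0 j : R) x.
Proof. by move=> df; rewrite derive_mx ?mxE//; exact: diff_derivable. Qed.

Lemma diffk_row k n m (U : set 'rV[R]_n) (f : 'rV[R]_n -> 'rV[R]_m) : open U ->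
  diffk k U f <-> forall j, diffk k U (fun x => f x 0 j : R).
Proof.
move=> oU; elim: k f => // k IH f; split=> [[df dDf] j|df].
  split=> [x Ux|v]; first by move/differentiable_row : (df x Ux); exact.
  apply: diffk_eq ((IH _).1 (dDf v) j) => // x /set_mem Ux.
  by apply: derive_coord; exact: df.
have df0 x : U x -> differentiable f x.
  by move=> Ux; apply/differentiable_row => j; exact: (df j).1.
split=> // v; apply/IH => j; apply: diffk_eq ((df j).2 v) => // x /set_mem Ux.
by rewrite derive_coord//; exact: df0.
Qed.

Lemma derive_sumE (V W : normedModType R) n (f : V -> W) (v : 'rV[R]_n) (b : 'I_n -> V) x :
  differentiable f x ->
  'D_(\sum_j v 0 j *: b j) f x = \sum_j v 0 j *: 'D_(b j) f x.
Proof.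
move=> df; rewrite deriveE// linear_sum; apply: eq_bigr => j _.
by rewrite linearZ/= -deriveE.
Qed.

Lemma derive_compE (U V W : normedModType R) (f : U -> V) (g : V -> W) x v :
  differentiable f x -> differentiable g (f x) ->
  'D_v (fun y => g (f y)) x = 'D_('D_v f x) g (f x).
Proof.
move=> df dg; rewrite -[LHS]/('D_v (g \o f) x) deriveE; last exact: differentiable_comp.
by rewrite diff_comp//= -!deriveE.
Qed.

Lemma diffk_comp1 k n m (U : set 'rV[R]_n) (V : set 'rV[R]_m) (f : 'rV[R]_n -> 'rV[R]_m)
    (g : 'rV[R]_m -> R) : open U -> open V -> (forall x, U x -> V (f x)) ->
  diffk k U f -> diffk k V g -> diffk k U (fun x => g (f x)).
Proof.
move=> oU oV UV; elim: k f g UV => // k IH f g UV hf hg.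
have [[df dDf] [dg dDg]] := (hf, hg).
split=> [x Ux|v]; first by apply: differentiable_comp; [exact: df|exact/dg/UV].
have H j : diffk k U (fun x => ('D_v f x) 0 j * 'D_(delta_mx 0 j) g (f x)).
  apply: diffkM => //; first by move: (dDf v) => /(diffk_row k _ oU); exact.
  exact: (IH f ('D_(delta_mx 0 j) g) UV (diffkS hf) (dDg _)).
apply: diffk_eq (diffk_sum oU H) => // x /set_mem Ux /=.
have dgx := dg _ (UV _ Ux); have dfx := df _ Ux.
by rewrite (derive_compE v dfx dgx) [in RHS](row_basisE ('D_v f x)) derive_sumE.
Qed.

Lemma smooth_on_eq {W : normedModType R} n (U : set 'rV[R]_n) (f g : 'rV[R]_n -> W) :
  open U -> {in U, f =1 g} -> smooth_on U f -> smooth_on U g.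
Proof.
by move=> oU fg /smooth_onP sf; apply/smooth_onP => k; apply: diffk_eq (sf k).
Qed.

Lemma smooth_on_comp n m p (U : set 'rV[R]_n) (V : set 'rV[R]_m) (f : 'rV[R]_n -> 'rV[R]_m)
    (g : 'rV[R]_m -> 'rV[R]_p) : open U -> open V -> (forall x, U x -> V (f x)) ->
  smooth_on U f -> smooth_on V g -> smooth_on U (fun x => g (f x)).
Proof.
move=> oU oV UV /smooth_onP sf /smooth_onP sg; apply/smooth_onP => k.
apply/diffk_row => // j.
apply: (@diffk_comp1 _ _ _ _ _ _ (fun y => g y 0 j) oU oV UV (sf k)).
exact: ((diffk_row k _ oV).1 (sg k) j).
Qed.

Lemma mulmx_differentiable n m (M : 'M[R]_(n, m)) (x : 'rV[R]_n) :
  differentiable (fun y => y *m M) x.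
Proof.
rewrite (_ : (fun y => _) = \sum_j (fun y : 'rV[R]_n => y 0 j *: row j M)).
  by apply: differentiable_sum => j; apply/differentiableZl/differentiable_coord.
by apply/funext => y; rewrite fct_sumE mulmx_sum_row.
Qed.

Lemma linear_row_differentiable n m (f : 'rV[R]_n -> 'rV[R]_m) :
  linear f -> forall x, differentiable f x.
Proof.
move=> lf x; pose gf := GRing.isLinear.Build _ _ _ _ f lf.
pose g : {linear _ -> _} := HB.pack f gf.
rewrite (_ : f = fun y => y *m lin1_mx g); first exact: mulmx_differentiable.
by apply/funext => y; rewrite mul_rV_lin1.
Qed.

Lemma derive_linear n m (f : 'rV[R]_n -> 'rV[R]_m) x v : linear f -> 'D_v f x = f v.
Proof.
move=> lf; have df := linear_row_differentiable lf.
pose gf := GRing.isLinear.Build _ _ _ _ f lf.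
pose g : {linear _ -> _} := HB.pack f gf.
rewrite deriveE// -[f]/(g : _ -> _) diff_lin// => y.
exact/differentiable_continuous/df.
Qed.

Lemma smooth_on_linear n m (U : set 'rV[R]_n) (f : 'rV[R]_n -> 'rV[R]_m) :
  linear f -> smooth_on U f.
Proof.
move=> lf; apply/smooth_onP => -[//|k]; split=> [x _|v].
  exact: linear_row_differentiable.
rewrite (_ : 'D_v f = fun=> f v); first exact: diffk_cst.
by apply/funext => x; exact: derive_linear.
Qed.

Lemma smooth_on_cst {W : normedModType R} n (U : set 'rV[R]_n) (c : W) : smooth_on U (fun=> c).
Proof. by apply/smooth_onP => k; exact: diffk_cst. Qed.

Lemma smooth_on_row n m (U : set 'rV[R]_n) (f : 'rV[R]_n -> 'rV[R]_m) : open U ->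
  smooth_on U f <-> forall j, smooth_on U (fun x => f x 0 j : R).
Proof.
move=> oU; split=> [/smooth_onP sf j|sf]; apply/smooth_onP => k.
  exact: ((diffk_row k _ oU).1 (sf k)).
by apply/(diffk_row _ _ oU) => j; have /smooth_onP := sf j; exact.
Qed.

Lemma smooth_on_row_mx n m p (U : set 'rV[R]_n) (f : 'rV[R]_n -> 'rV[R]_m)
    (g : 'rV[R]_n -> 'rV[R]_p) : open U ->
  smooth_on U f -> smooth_on U g -> smooth_on U (fun x => row_mx (f x) (g x)).
Proof.
move=> oU /(smooth_on_row _ oU) sf /(smooth_on_row _ oU) sg; apply/smooth_on_row => // j.
case: (fintype.splitP j) => i ji.
  have -> : j = lshift p i by exact: val_inj.
  rewrite (_ : (fun x => _) = fun x => f x 0 i)//.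
  by apply/funext => x; rewrite row_mxEl.
have -> : j = rshift m i by exact: val_inj.
rewrite (_ : (fun x => _) = fun x => g x 0 i)//.
by apply/funext => x; rewrite row_mxEr.
Qed.

Lemma smooth_onZ n m (U : set 'rV[R]_n) (s : 'rV[R]_n -> R) (f : 'rV[R]_n -> 'rV[R]_m) :
  open U -> smooth_on U s -> smooth_on U f -> smooth_on U (fun x => s x *: f x).
Proof.
move=> oU /smooth_onP ss /(smooth_on_row _ oU) sf; apply/smooth_on_row => // j.
rewrite (_ : (fun x => _) = fun x => s x * f x 0 j).
  by apply/smooth_onP => k; apply: diffkM => //; have /smooth_onP := sf j; exact.
by apply/funext => x; rewrite mxE.
Qed.

Lemma smooth_onD n m (U : set 'rV[R]_n) (f g : 'rV[R]_n -> 'rV[R]_m) :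
  open U -> smooth_on U f -> smooth_on U g -> smooth_on U (fun x => f x + g x).
Proof.
by move=> oU /smooth_onP sf /smooth_onP sg; apply/smooth_onP => k; exact: diffkD.
Qed.

Lemma smooth_on_derive {W : normedModType R} n (U : set 'rV[R]_n) (f : 'rV[R]_n -> W) v :
  smooth_on U f -> smooth_on U ('D_v f).
Proof. by move=> /smooth_onP sf; apply/smooth_onP => k; exact: (sf k.+1).2. Qed.

Lemma smooth_on_diff {W : normedModType R} n (U : set 'rV[R]_n) (f : 'rV[R]_n -> W) x :
  smooth_on U f -> U x -> differentiable f x.
Proof. by move=> sf; exact: (sf [::]). Qed.

Lemma second_difference n (f : 'rV[R]_n -> R) (U : set 'rV[R]_n) x u v e :
  open U -> U x -> (forall y, U y -> differentiable f y) -> differentiable ('D_u f) x -> 0 < e ->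
  exists2 d, 0 < d & forall h, 0 < h < d ->
   `|f (x + h *: u + h *: v) - f (x + h *: u) - f (x + h *: v) + f x - h ^+ 2 * 'D_v ('D_u f) x|
     <= e * h ^+ 2.
Proof.
move=> oU Ux df ddf e0.
pose L := 'd ('D_u f) x.
pose C := `|u| + `|v| + 1.
have C0 : 0 < C by rewrite /C ltr_wpDl// addr_ge0.
have e'0 : 0 < e / (C *+ 2) by rewrite divr_gt0// pmulrn_lgt0.
have [d d0 Hd] : exists2 d, 0 < d & forall w, `|w| < d -> U (x + w) /\
   `|'D_u f (x + w) - 'D_u f x - L w| <= e / (C *+ 2) * `|w|.
  have /eqaddoP /(_ _ e'0) H := diff_locally ddf.
  have HU : \forall w \near (0 : 'rV[R]_n), U (x + w).
    have : \forall y \near x, U y by exact: open_nbhs_nbhs.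
    by rewrite (near_shift 0); apply: filterS => z; rewrite /= subr0 addrC.
  have : \forall w \near (0 : 'rV[R]_n), U (x + w) /\
   `|'D_u f (x + w) - 'D_u f x - L w| <= e / (C *+ 2) * `|w|.
    by apply: filterS2 HU H => w Uw; rewrite !fctE /= opprD addrA [w + x]addrC.
  move=> /nbhs_ballP[d /= d0 Hd]; exists d => // w wd; apply: Hd.
  by rewrite -ball_normE /= sub0r normrN.
exists (d / C); first by rewrite divr_gt0.
move=> h /andP[h0 hd].
have hC s : 0 <= s <= h -> `|s *: u + h *: v| < d /\ `|s *: u| < d
    /\ `|s *: u + h *: v| <= C * h /\ `|s *: u| <= C * h.
  move=> /andP[s0 sh].
  have A1 : `|s *: u| <= `|u| * h by rewrite normrZ ger0_norm// mulrC ler_wpM2l.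
  have A2 : `|h *: v| <= `|v| * h by rewrite normrZ gtr0_norm// mulrC.
  have A3 : C * h < d by rewrite mulrC -ltr_pdivlMr.
  have A4 : `|s *: u| <= C * h.
    by apply: (le_trans A1); rewrite ler_pM2r// /C -addrA lerDl addr_ge0.
  have A5 : `|s *: u + h *: v| <= C * h.
    apply: (le_trans (ler_normD _ _)); apply: (le_trans (lerD A1 A2)).
    by rewrite -mulrDl ler_pM2r// /C lerDl.
  by split; [exact: le_lt_trans A3|split; [exact: le_lt_trans A3|]].
pose phi s := f (x + (s *: u + h *: v)) - f (x + s *: u).
pose dphi s := 'D_u f (x + (s *: u + h *: v)) - 'D_u f (x + s *: u).
have dsc s : differentiable ( *:%R^~ u : R -> 'rV[R]_n) s.
  exact: (@ex_diff _ _ _ _ _ _ _ (is_diff_scalel s u)).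
have lE (w : 'rV[R]_n) : (fun s => x + (s *: u + w)) = (fun s : R => s *: u) + cst (x + w).
  by apply/funext => t; rewrite !fctE addrCA.
have dlin w s : differentiable (fun s : R => x + (s *: u + w)) s.
  by rewrite lE; apply: differentiableD => //; exact: differentiable_cst.
have Dlin w s : 'D_1 (fun s : R => x + (s *: u + w)) s = u.
  rewrite lE deriveD; [|exact: diff_derivable (dsc s)|exact: derivable_cst].
  by rewrite derive_cst addr0 deriveE// (diff_val (is_diff_def := is_diff_scalel s u)) scale1r.
have is1 w s : U (x + (s *: u + w)) ->
    is_derive s 1 (fun s => f (x + (s *: u + w))) ('D_u f (x + (s *: u + w))).
  move=> Uw; have dd := dlin w s; have ddg := df _ Uw.
  apply: DeriveDef.
    apply/derivable1_diffP; exact: (differentiable_comp dd ddg).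
  by rewrite (derive_compE (1 : numFieldNormedType.Real_sort__canonical__normed_module_NormedModule R) dd ddg) Dlin.
have dphiP s : 0 <= s <= h -> is_derive s 1 phi (dphi s).
  move=> sh; have [B1 [B2 _]] := hC _ sh.
  have U1 := (Hd _ B1).1; have U2 := (Hd _ B2).1.
  have E0 : phi = (fun s => f (x + (s *: u + h *: v))) - (fun s => f (x + (s *: u + 0))).
    by apply/funext => t; rewrite /phi !fctE addr0.
  have U2' : U (x + (s *: u + 0)) by rewrite addr0.
  have -> : dphi s = 'D_u f (x + (s *: u + h *: v)) - 'D_u f (x + (s *: u + 0)).
    by rewrite /dphi addr0.
  by rewrite E0; exact: is_deriveB (is1 _ _ U1) (is1 _ _ U2').
have [||c ch] := @MVT R phi dphi 0 h h0.
- by move=> s /andP[]; rewrite !bnd_simp => s0 sh; apply: dphiP; rewrite !ltW.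
- apply: derivable_within_continuous => s; rewrite in_itv /= => sh.
  by have [] := dphiP s sh.
rewrite subr0 => E.
have ch' : 0 <= c <= h by move: ch; rewrite in_itv/= => /andP[/ltW -> /ltW ->].
have [B1 [B2 [B3 B4]]] := hC _ ch'.
have [_ H1] := Hd _ B1; have [_ H2] := Hd _ B2.
have -> : f (x + h *: u + h *: v) - f (x + h *: u) - f (x + h *: v) + f x = dphi c * h.
  rewrite -E /phi scale0r add0r addr0 !addrA opprB.
  by rewrite [RHS]addrA addrAC.
have LE : L (c *: u + h *: v) - L (c *: u) = h * 'D_v ('D_u f) x.
  by rewrite linearD addrC addKr linearZ/= deriveE.
set D := 'D_v _ x in LE *; set r1 := _ - L _ in H1; set r2 := _ - L _ in H2.
have -> : dphi c * h - h ^+ 2 * D = h * (r1 - r2).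
  by rewrite /r1 /r2 expr2 -mulrA -LE /dphi; ring.
rewrite normrM gtr0_norm// expr2 mulrCA ler_pM2l//.
have e'C (w : 'rV[R]_n) : `|w| <= C * h -> e / (C *+ 2) * `|w| <= e / 2 * h.
  move=> wC; apply: le_trans (ler_wpM2l (ltW e'0) wC) _.
  rewrite le_eqVlt -mulr_natr; apply/orP; left; apply/eqP; field.
  by rewrite gt_eqF.
apply: (le_trans (ler_normB _ _)).
apply: (le_trans (lerD (le_trans H1 (e'C _ B3)) (le_trans H2 (e'C _ B4)))).
by rewrite -mulrDl -splitr.
Unshelve. all: by end_near. Qed.

Lemma derive_sym n (f : 'rV[R]_n -> R) (U : set 'rV[R]_n) x u v :
  open U -> U x -> smooth_on U f -> 'D_v ('D_u f) x = 'D_u ('D_v f) x.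
Proof.
move=> oU Ux sf; apply/eqP; rewrite -subr_eq0 -normr_eq0; apply/eqP/le_anti.
rewrite normr_ge0 andbT; apply/ler_addgt0Pr => e e0; rewrite add0r.
have df y : U y -> differentiable f y by exact: smooth_on_diff.
have dd w : differentiable ('D_w f) x.
  exact: smooth_on_diff (smooth_on_derive _ sf) Ux.
have e20 : 0 < e / 2 by rewrite divr_gt0.
have [d d0 Hd] := second_difference v oU Ux df (dd u) e20.
have [d' d'0 Hd'] := second_difference u oU Ux df (dd v) e20.
pose h := Num.min d d' / 2.
have m0 : 0 < Num.min d d' by rewrite lt_min d0.
have h0 : 0 < h by rewrite divr_gt0.
have hm : h < Num.min d d' by rewrite /h ltr_pdivrMr// ltr_pMr// ltr1n.
move: hm; rewrite lt_min => /andP[hd hd'].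
have := Hd h; rewrite h0 hd => /(_ isT) A.
have := Hd' h; rewrite h0 hd' => /(_ isT).
rewrite (addrAC x (h *: v)) => B.
have h20 : 0 < h ^+ 2 by rewrite exprn_gt0.
rewrite -(ler_pM2r h20) -[X in _ * X](gtr0_norm h20) -normrM.
set a := 'D_v _ x in A *; set b := 'D_u _ x in B *.
set p := f (_ + _ + _) in A B; set q := f (x + h *: u) in A B; set r := f (x + h *: v) in A B.
have -> : (a - b) * h ^+ 2 = (p - r - q + f x - h ^+ 2 * b) - (p - q - r + f x - h ^+ 2 * a) by ring.
apply: (le_trans (ler_normB _ _)); apply: (le_trans (lerD B A)).
by rewrite -mulrDl -splitr.
Qed.

Lemma derive_sym_row n m (f : 'rV[R]_n -> 'rV[R]_m) (U : set 'rV[R]_n) x u v :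
  open U -> U x -> smooth_on U f -> 'D_v ('D_u f) x = 'D_u ('D_v f) x.
Proof.
move=> oU Ux sf; have sfj := (smooth_on_row _ oU).1 sf.
have H w w' : U x -> forall j, ('D_w ('D_w' f) x) 0 j = 'D_w ('D_w' (fun y => f y 0 j : R)) x.
  move=> _ j; rewrite derive_coord; last exact: smooth_on_diff (smooth_on_derive _ sf) Ux.
  apply: near_eq_derive; near=> y; apply: derive_coord.
  by apply: smooth_on_diff sf _; near: y; exact: open_nbhs_nbhs.
apply/rowP => j.
have E1 := H v u Ux j.
have E2 := H u v Ux j.
exact: etrans E1 (etrans (@derive_sym _ (fun y => f y 0 j : R) U x u v oU Ux (sfj j)) (esym E2)).
Unshelve. all: by end_near. Qed.

End Smooth.

Record category := Category {
  ob :> Type;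
  hom : ob -> ob -> Type;
  idm : forall X, hom X X;
  comp : forall X Y Z, hom Y Z -> hom X Y -> hom X Z;
  comp_idl : forall X Y (f : hom X Y), comp (idm Y) f = f;
  comp_idr : forall X Y (f : hom X Y), comp f (idm X) = f;
  comp_assoc : forall X Y Z W (h : hom Z W) (g : hom Y Z) (f : hom X Y),
    comp h (comp g f) = comp (comp h g) f }.
Arguments hom {_} _ _.
Arguments idm {_} _.
Arguments comp {_ _ _ _} _ _.
Notation "g \oc f" := (comp g f) (at level 50, left associativity).

Record functor (C D : category) := Functor {
  fob :> C -> D;
  fmap : forall X Y, hom X Y -> hom (fob X) (fob Y);
  fmap_id : forall X, fmap (idm X) = idm (fob X);
  fmap_comp : forall X Y Z (g : hom Y Z) (f : hom X Y),
    fmap (g \oc f) = fmap g \oc fmap f }.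
Arguments fmap {_ _} _ {_ _} _.

Section Functors.
Variables C D E : category.

Definition functor_id : functor C C :=
  @Functor C C id (fun _ _ f => f) (fun _ => erefl) (fun _ _ _ _ _ => erefl).

Variables (G : functor D E) (F : functor C D).
Lemma functor_comp_id X : fmap G (fmap F (idm X)) = idm (G (F X)).
Proof. by rewrite !fmap_id. Qed.
Lemma functor_comp_comp X Y Z (g : hom Y Z) (f : hom X Y) :
  fmap G (fmap F (g \oc f)) = fmap G (fmap F g) \oc fmap G (fmap F f).
Proof. by rewrite !fmap_comp. Qed.
Definition functor_comp : functor C E :=
  @Functor C E (fun X => G (F X)) (fun _ _ f => fmap G (fmap F f))
    functor_comp_id functor_comp_comp.
End Functors.

Definition natural C D (F G : functor C D) (a : forall X, hom (F X) (G X)) : Prop :=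
  forall X Y (f : hom X Y), a Y \oc fmap F f = fmap G f \oc a X.

Record nat_trans C D (F G : functor C D) := NatTrans {
  nt_fun :> forall X, hom (F X) (G X);
  nt_natural : natural nt_fun }.

Section FullSubcategory.
Variables (C : category) (P : C -> Prop).

Definition full_sub : category :=
  @Category {X : C | P X} (fun X Y => hom (sval X) (sval Y)) (fun X => idm (sval X))
    (fun X Y Z g f => g \oc f) (fun X Y => @comp_idl C (sval X) (sval Y))
    (fun X Y => @comp_idr C (sval X) (sval Y))
    (fun X Y Z W => @comp_assoc C (sval X) (sval Y) (sval Z) (sval W)).

Variables (F : functor C C) (PF : forall X, P X -> P (F X)).

Definition full_sub_functor : functor full_sub full_sub :=
  @Functor full_sub full_sub (fun X => exist P (F (sval X)) (PF (svalP X)))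
    (fun X Y f => fmap F f) (fun X => fmap_id F (sval X))
    (fun X Y Z => @fmap_comp _ _ F (sval X) (sval Y) (sval Z)).
End FullSubcategory.

Section Limits.
Variable C : category.

Definition is_iso (X Y : C) (f : hom X Y) : Prop :=
  exists g : hom Y X, g \oc f = idm X /\ f \oc g = idm Y.

Definition iso_inv (X Y : C) (f : hom X Y) (f_iso : is_iso f) : hom Y X :=
  sval (cid f_iso).

Definition is_terminal (Z : C) : Prop :=
  forall A : C, exists f : hom A Z, forall g : hom A Z, g = f.

Definition is_product (A B P : C) (p1 : hom P A) (p2 : hom P B) : Prop :=
  forall (Q : C) (q1 : hom Q A) (q2 : hom Q B),
    exists! h : hom Q P, p1 \oc h = q1 /\ p2 \oc h = q2.

Definition is_pullback (A B X P : C) (f : hom A X) (g : hom B X)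
    (p1 : hom P A) (p2 : hom P B) : Prop :=
  f \oc p1 = g \oc p2 /\
  forall (Q : C) (q1 : hom Q A) (q2 : hom Q B), f \oc q1 = g \oc q2 ->
    exists! h : hom Q P, p1 \oc h = q1 /\ p2 \oc h = q2.

(* Fiber product of k > 0 copies of f; the common value f \oc p i is the
   projection to the base. *)
Definition is_fiber_power (A X P : C) (f : hom A X) (k : nat)
    (p : 'I_k -> hom P A) : Prop :=
  (forall i j, f \oc p i = f \oc p j) /\
  forall (Q : C) (q : 'I_k -> hom Q A), (forall i j, f \oc q i = f \oc q j) ->
    exists! h : hom Q P, forall i, p i \oc h = q i.

(* For a product (or pullback) P of B1 and B2 and an operation m : P -> Z, this
   says that c = m(a, b), where a, b, c are generalized elements at stage A. *)
Definition op_eq (A B1 B2 P Z : C) (p1 : hom P B1) (p2 : hom P B2) (m : hom P Z)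
    (a : hom A B1) (b : hom A B2) (c : hom A Z) : Prop :=
  exists h : hom A P, [/\ p1 \oc h = a, p2 \oc h = b & m \oc h = c].
End Limits.

Record tangent_data (C : category) := TangentData {
  tT : functor C C;
  tTk : forall k, (0 < k)%N -> functor C C;
  tpr : forall k (k0 : (0 < k)%N) (i : 'I_k) X, hom (tTk k0 X) (tT X);
  tpi : forall X, hom (tT X) X;
  tzero : forall X, hom X (tT X);
  tplus : forall X, hom (tTk (isT : (0 < 2)%N) X) (tT X);
  tlam : forall X, hom (tT X) (tT (tT X));
  ttau : forall X, hom (tT (tT X)) (tT (tT X)) }.

Section TangentStructure.
Variables (C : category) (D : tangent_data C).
Local Notation T := (tT D).
Local Notation T2 := (tTk D (isT : (0 < 2)%N)).
Local Notation pr0 X := (tpr D (isT : (0 < 2)%N) ord0 X).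
Local Notation pr1 X := (tpr D (isT : (0 < 2)%N) ord_max X).
Local Notation pi := (tpi D).
Local Notation zero := (tzero D).
Local Notation plus := (tplus D).
Local Notation lam := (tlam D).
Local Notation tau := (ttau D).

(* c = a + b for a, b, c : A -> TX *)
Definition is_sum (A X : C) (a b c : hom A (T X)) : Prop :=
  op_eq (pr0 X) (pr1 X) (plus X) a b c.

Record is_tangent_structure : Prop := IsTangentStructure {
  ts_pr_natural : forall k (k0 : (0 < k)%N) i, natural (tpr D k0 i);
  ts_pi_natural : @natural C C T (functor_id C) pi;
  ts_zero_natural : @natural C C (functor_id C) T zero;
  ts_plus_natural : @natural C C T2 T plus;
  ts_lam_natural : @natural C C T (functor_comp T T) lam;
  ts_tau_natural : @natural C C (functor_comp T T) (functor_comp T T) tau;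
  ts_pullback : forall k (k0 : (0 < k)%N) X,
    is_fiber_power (pi X) (fun i => tpr D k0 i X);
  ts_pullback_preserved : forall k (k0 : (0 < k)%N) X,
    is_fiber_power (fmap T (pi X)) (fun i => fmap T (tpr D k0 i X));
  ts_pi_plus : forall X, pi X \oc plus X = pi X \oc pr0 X;
  ts_pi_zero : forall X, pi X \oc zero X = idm X;
  ts_plus_assoc : forall A X (a b c ab bc s : hom A (T X)),
    is_sum a b ab -> is_sum b c bc -> is_sum ab c s -> is_sum a bc s;
  ts_plus_comm : forall A X (a b s : hom A (T X)), is_sum a b s -> is_sum b a s;
  ts_plus_zero : forall A X (a : hom A (T X)), is_sum (zero X \oc pi X \oc a) a a;
  ts_plus_opp : exists opp : forall X, hom (T X) (T X),
    [/\ natural opp, forall X, pi X \oc opp X = pi X &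
        forall A X (a : hom A (T X)), is_sum (opp X \oc a) a (zero X \oc pi X \oc a)];
  ts_tau_tau : forall X, tau X \oc tau X = idm (T (T X));
  ts_tau_braid : forall X,
    tau (T X) \oc fmap T (tau X) \oc tau (T X) =
    fmap T (tau X) \oc tau (T X) \oc fmap T (tau X);
  ts_pi_tau : forall X, pi (T X) \oc tau X = fmap T (pi X);
  ts_tau_plus : forall X,
    is_sum (tau X \oc fmap T (pr0 X)) (tau X \oc fmap T (pr1 X))
      (tau X \oc fmap T (plus X));
  ts_pi_lam : forall X, pi (T X) \oc lam X = zero X \oc pi X;
  ts_lam_lam : forall X, lam (T X) \oc lam X = fmap T (lam X) \oc lam X;
  ts_lam_plus : forall X,
    is_sum (lam X \oc pr0 X) (lam X \oc pr1 X) (lam X \oc plus X);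
  ts_tau_lam : forall X, tau X \oc lam X = lam X;
  ts_tau_Tlam : forall X,
    fmap T (tau X) \oc tau (T X) \oc fmap T (lam X) = lam (T X) \oc tau X;
  ts_lam_pullback : forall X, exists (u : hom (T (T X)) (T2 X)) (z : hom X (T2 X)),
    [/\ pr0 X \oc u = pi (T X), pr1 X \oc u = fmap T (pi X),
        pr0 X \oc z = zero X, pr1 X \oc z = zero X &
        is_pullback u z (lam X) (pi X)] }.
End TangentStructure.

Record ring_data (C : category) := RingData {
  r_ob : C;
  r_pt : C;
  r_sq : C;
  r_p1 : hom r_sq r_ob;
  r_p2 : hom r_sq r_ob;
  r_add : hom r_sq r_ob;
  r_mul : hom r_sq r_ob;
  r_zero : hom r_pt r_ob;
  r_one : hom r_pt r_ob;
  r_opp : hom r_ob r_ob }.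

Section RingObject.
Variables (C : category) (S : ring_data C).
Local Notation elt A := (hom A (r_ob S)).

Definition is_radd (A : C) (a b c : elt A) : Prop :=
  op_eq (r_p1 S) (r_p2 S) (r_add S) a b c.
Definition is_rmul (A : C) (a b c : elt A) : Prop :=
  op_eq (r_p1 S) (r_p2 S) (r_mul S) a b c.

Record is_ring_object : Prop := IsRingObject {
  ro_terminal : is_terminal (r_pt S);
  ro_product : is_product (r_p1 S) (r_p2 S);
  ro_addA : forall A (a b c ab bc s : elt A),
    is_radd a b ab -> is_radd b c bc -> is_radd ab c s -> is_radd a bc s;
  ro_addC : forall A (a b s : elt A), is_radd a b s -> is_radd b a s;
  ro_add0 : forall A (t : hom A (r_pt S)) (a : elt A), is_radd (r_zero S \oc t) a a;
  ro_addN : forall A (t : hom A (r_pt S)) (a : elt A),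
    is_radd (r_opp S \oc a) a (r_zero S \oc t);
  ro_mulA : forall A (a b c ab bc s : elt A),
    is_rmul a b ab -> is_rmul b c bc -> is_rmul ab c s -> is_rmul a bc s;
  ro_mul1l : forall A (t : hom A (r_pt S)) (a : elt A), is_rmul (r_one S \oc t) a a;
  ro_mul1r : forall A (t : hom A (r_pt S)) (a : elt A), is_rmul a (r_one S \oc t) a;
  ro_mulDl : forall A (a b c ab ac bc s : elt A),
    is_radd a b ab -> is_rmul a c ac -> is_rmul b c bc -> is_rmul ab c s ->
    is_radd ac bc s;
  ro_mulDr : forall A (a b c ab ac bc s : elt A),
    is_radd a b ab -> is_rmul c a ac -> is_rmul c b bc -> is_rmul c ab s ->
    is_radd ac bc s }.
End RingObject.

Section ScalarMultiplication.
Variables (C : category) (D : tangent_data C) (S : ring_data C).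
Local Notation T := (tT D).
Local Notation Rg := (r_ob S).
(* PX stands for the product of the ring object with TX. *)
Variables (P : C -> C) (p1 : forall X, hom (P X) Rg) (p2 : forall X, hom (P X) (T X)).
Variable kappa : forall X, hom (P X) (T X).

Definition is_scaled (A X : C) (r : hom A Rg) (v w : hom A (T X)) : Prop :=
  op_eq (p1 X) (p2 X) (kappa X) r v w.

Record is_scalar_mult : Prop := IsScalarMult {
  sm_product : forall X, is_product (p1 X) (p2 X);
  sm_product_preserved : forall X, is_product (fmap T (p1 X)) (fmap T (p2 X));
  sm_natural : forall X Y (f : hom X Y),
    is_scaled (p1 X) (fmap T f \oc p2 X) (fmap T f \oc kappa X);
  sm_pi : forall X, tpi D X \oc kappa X = tpi D X \oc p2 X;
  sm_mul : forall A X (r s rs : hom A Rg) (v sv w : hom A (T X)),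
    is_rmul r s rs -> is_scaled s v sv -> is_scaled r sv w -> is_scaled rs v w;
  sm_one : forall A X (t : hom A (r_pt S)) (v : hom A (T X)),
    is_scaled (r_one S \oc t) v v;
  sm_addl : forall A X (r s rs : hom A Rg) (v rv sv w : hom A (T X)),
    is_radd r s rs -> is_scaled r v rv -> is_scaled s v sv -> is_scaled rs v w ->
    is_sum rv sv w;
  sm_addr : forall A X (r : hom A Rg) (v w vw rv rw u : hom A (T X)),
    is_sum v w vw -> is_scaled r v rv -> is_scaled r w rw -> is_scaled r vw u ->
    is_sum rv rw u;
  sm_tau : forall X (h : hom (P (T X)) (T (P X))),
    fmap T (p1 X) \oc h = tzero D Rg \oc p1 (T X) ->
    fmap T (p2 X) \oc h = ttau D X \oc p2 (T X) ->
    ttau D X \oc kappa (T X) = fmap T (kappa X) \oc h;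
  sm_lam : forall X, is_scaled (p1 X) (tlam D X \oc p2 X) (tlam D X \oc kappa X) }.
End ScalarMultiplication.
Arguments is_scalar_mult {C} D S {P} p1 p2 kappa.

Section Euclidean.
Variable R : realType.

Record eucl := Eucl {
  edim : nat;
  edom : set 'rV[R]_edim;
  edom_open : open edom }.

Arguments edom : clear implicits.
Arguments edom_open : clear implicits.

Definition epoint (U : eucl) : Type := {x : 'rV[R]_(edim U) | edom U x}.
Coercion epoint : eucl >-> Sortclass.

Lemma epoint_eq (U : eucl) (x y : U) : sval x = sval y -> x = y.
Proof.
case: x y => [x Ux] [y Uy] /= E; case: _ / E in Uy *.
by congr exist; exact: Prop_irrelevance.
Qed.

(* Extension by 0 outside of the domain: smoothness and derivatives on the open
   set edom U do not depend on it. *)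
Definition ext (U V : eucl) (f : U -> V) (x : 'rV[R]_(edim U)) : 'rV[R]_(edim V) :=
  if pselect (edom U x) is left Ux then sval (f (exist _ x Ux)) else 0.

Lemma ext_val (U V : eucl) (f : U -> V) (x : U) : ext f (sval x) = sval (f x).
Proof.
rewrite /ext; case: pselect => [Ux|]; last by case: x.
by congr (sval (f _)); exact: epoint_eq.
Qed.

Lemma ext_mem (U V : eucl) (f : U -> V) x : edom U x -> edom V (ext f x).
Proof. by move=> Ux; rewrite (ext_val f (exist _ x Ux)); case: (f _). Qed.

Record smap (U V : eucl) := SMap {
  smap_fun :> U -> V;
  smap_smooth : smooth_on (edom U) (ext smap_fun) }.

Lemma smap_eq (U V : eucl) (f g : smap U V) :
  (forall x, sval (f x) = sval (g x)) -> f = g.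
Proof.
case: f g => [f sf] [g sg] /= E.
have fg : f = g by apply/funext => x; exact: epoint_eq.
by rewrite fg in sf *; congr SMap; exact: Prop_irrelevance.
Qed.

Section MkSmap.
Variables (U V : eucl) (F : 'rV[R]_(edim U) -> 'rV[R]_(edim V)).
Hypothesis UV : forall x, edom U x -> edom V (F x).

Definition mk_fun (x : U) : V := exist _ (F (sval x)) (UV (svalP x)).

Lemma ext_mk_fun x : edom U x -> ext mk_fun x = F x.
Proof. by move=> Ux; rewrite (ext_val mk_fun (exist _ x Ux)). Qed.

Hypothesis sF : smooth_on (edom U) F.

Lemma mk_fun_smooth : smooth_on (edom U) (ext mk_fun).
Proof.
apply: smooth_on_eq sF; first exact: edom_open.
by move=> x /set_mem Ux; rewrite ext_mk_fun.
Qed.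

Definition mk_smap : smap U V := SMap mk_fun_smooth.
End MkSmap.

Lemma smap_id_smooth (U : eucl) : smooth_on (edom U) (ext (@id U)).
Proof.
apply: (@smooth_on_eq _ _ _ _ idfun); first exact: edom_open.
  by move=> x /set_mem Ux; rewrite (ext_val id (exist _ x Ux)).
by apply: smooth_on_linear => a x y.
Qed.
Definition smap_id (U : eucl) : smap U U := SMap (@smap_id_smooth U).

Lemma ext_comp (U V W : eucl) (g : V -> W) (f : U -> V) x : edom U x ->
  ext (g \o f) x = ext g (ext f x).
Proof.
by move=> Ux; rewrite (ext_val _ (exist _ x Ux)) (ext_val f (exist _ x Ux)) ext_val.
Qed.

Lemma ext_comp_smooth (U V W : eucl) (g : V -> W) (f : U -> V) :
  smooth_on (edom V) (ext g) -> smooth_on (edom U) (ext f) ->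
  smooth_on (edom U) (ext (g \o f)).
Proof.
move=> sg sf.
have := smooth_on_comp (edom_open U) (edom_open V) (@ext_mem _ _ f) sf sg.
apply: smooth_on_eq; first exact: edom_open.
by move=> x /set_mem Ux; rewrite ext_comp.
Qed.

Definition smap_comp (U V W : eucl) (g : smap V W) (f : smap U V) : smap U W :=
  SMap (ext_comp_smooth (smap_smooth g) (smap_smooth f)).

Lemma smap_idl (U V : eucl) (f : smap U V) : smap_comp (smap_id V) f = f.
Proof. exact: smap_eq. Qed.
Lemma smap_idr (U V : eucl) (f : smap U V) : smap_comp f (smap_id U) = f.
Proof. exact: smap_eq. Qed.
Lemma smap_assoc (U V W Z : eucl) (h : smap W Z) (g : smap V W) (f : smap U V) :
  smap_comp h (smap_comp g f) = smap_comp (smap_comp h g) f.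
Proof. exact: smap_eq. Qed.

Definition EUCL : category := Category smap_idl smap_idr smap_assoc.

Definition restr (U : eucl) (W : set 'rV[R]_(edim U)) (W_open : open W) : eucl :=
  Eucl W_open.

Definition incl (U : eucl) (W : set 'rV[R]_(edim U)) (W_open : open W)
    (WU : W `<=` edom U) : smap (restr W_open) U :=
  @mk_smap (restr W_open) U id WU
    (smooth_on_linear (f := id) (fun a x y => erefl)).

Lemma smap_preimage_open (U V : eucl) (f : smap U V) (A : set 'rV[R]_(edim V)) :
  open A -> open (edom U `&` ext f @^-1` A).
Proof.
move=> oA; rewrite openE => x [Ux Ax]; apply: filterI.
  exact: open_nbhs_nbhs (conj (edom_open U) Ux).
have cf : {for x, continuous (ext f)}.
  exact/differentiable_continuous/(smooth_on_diff (smap_smooth f) Ux).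
exact/cf/(open_nbhs_nbhs (conj oA Ax)).
Qed.

Arguments smap_preimage_open {U V} f {A} oA.

Lemma smap_restr_mem (U V : eucl) (f : smap U V) (A : set 'rV[R]_(edim V)) x :
  (edom U `&` ext f @^-1` A) x -> A (ext f x).
Proof. by case. Qed.

Lemma smooth_on_sub {W : normedModType R} n (A B : set 'rV[R]_n) (f : 'rV[R]_n -> W) :
  A `<=` B -> smooth_on B f -> smooth_on A f.
Proof. by move=> AB sf vs x /AB; exact: sf. Qed.

Definition smap_restr (U V : eucl) (f : smap U V) (A : set 'rV[R]_(edim V))
    (oA : open A) : smap (restr (smap_preimage_open f oA)) (restr oA) :=
  @mk_smap (restr (smap_preimage_open f oA)) (restr oA) (ext f)
    (@smap_restr_mem U V f A) (smooth_on_sub (@subIsetl _ _ _) (smap_smooth f)).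

Definition efull (n : nat) : eucl := Eucl (@openT 'rV[R]_n).

Definition eprod_dom (U V : eucl) : set 'rV[R]_(edim U + edim V) :=
  [set w | edom U (lsubmx w) /\ edom V (rsubmx w)].

Lemma eprod_open (U V : eucl) : open (@eprod_dom U V).
Proof.
rewrite (_ : @eprod_dom U V = lsubmx @^-1` edom U `&` rsubmx @^-1` edom V)//.
apply: openI; apply: open_comp; try exact: edom_open.
- by move=> x _; exact: continuous_lsubmx.
- by move=> x _; exact: continuous_rsubmx.
Qed.

Definition eprod (U V : eucl) : eucl := Eucl (@eprod_open U V).

(* Pairs are encoded by row_mx: TU = U x R^n, Tf (u, v) = (f u, D_v f (u)). *)
Definition That_ob (U : eucl) : eucl := eprod U (efull (edim U)).

Definition That_fun (U V : eucl) (f : U -> V) (w : 'rV[R]_(edim U + edim U)) :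
    'rV[R]_(edim V + edim V) :=
  row_mx (ext f (lsubmx w)) ('D_(rsubmx w) (ext f) (lsubmx w)).

Lemma That_fun_mem (U V : eucl) (f : U -> V) w :
  edom (That_ob U) w -> edom (That_ob V) (That_fun f w).
Proof. by move=> [Uw _]; split=> //=; rewrite row_mxKl; exact: ext_mem. Qed.

Lemma lsubmx_linear n m : linear (lsubmx : 'rV[R]_(n + m) -> 'rV[R]_n).
Proof. by move=> a x y; rewrite linearP. Qed.
Lemma rsubmx_linear n m : linear (rsubmx : 'rV[R]_(n + m) -> 'rV[R]_m).
Proof. by move=> a x y; rewrite linearP. Qed.

Lemma smooth_on_D (U V : eucl) (f : smap U V) m (A : set 'rV[R]_m)
    (p v : 'rV[R]_m -> 'rV[R]_(edim U)) : open A ->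
  (forall x, A x -> edom U (p x)) -> smooth_on A p -> smooth_on A v ->
  smooth_on A (fun x => 'D_(v x) (ext f) (p x)).
Proof.
move=> oA pU sp sv.
have H : smooth_on A (fun x => \sum_j (v x) 0 j *: 'D_(delta_mx 0 j) (ext f) (p x)).
  apply/smooth_onP => k; apply: diffk_sum => // j; move: k; apply/smooth_onP.
  apply: smooth_onZ => //; first exact: ((smooth_on_row _ oA).1 sv).
  apply: (@smooth_on_comp R m _ _ A (edom U) p ('D_(delta_mx 0 j) (ext f)) oA
    (edom_open U) pU sp).
  exact/smooth_on_derive/smap_smooth.
apply: smooth_on_eq H => // x /set_mem Ax /=.
rewrite [in RHS](row_basisE (v x)) derive_sumE//.
exact: smooth_on_diff (smap_smooth f) (pU _ Ax).
Qed.

Lemma That_fun_smooth (U V : eucl) (f : smap U V) :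
  smooth_on (edom (That_ob U)) (That_fun f).
Proof.
have oT := edom_open (That_ob U).
have sl : smooth_on (edom (That_ob U)) (lsubmx : _ -> 'rV[R]_(edim U)).
  exact/smooth_on_linear/lsubmx_linear.
apply: smooth_on_row_mx => //.
  by apply: (smooth_on_comp oT (edom_open U) _ sl (smap_smooth f)) => x [].
apply: smooth_on_D => //; first by move=> x [].
exact/smooth_on_linear/rsubmx_linear.
Qed.

Definition That_map (U V : eucl) (f : smap U V) : smap (That_ob U) (That_ob V) :=
  mk_smap (@That_fun_mem U V f) (That_fun_smooth f).

Lemma derive_ext_near (U V : eucl) (f g : 'rV[R]_(edim U) -> 'rV[R]_(edim V)) x v :
  edom U x -> (forall y, edom U y -> f y = g y) -> 'D_v f x = 'D_v g x.
Proof.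
move=> Ux fg; apply: near_eq_derive; near=> y; apply: fg.
near: y; exact: open_nbhs_nbhs (conj (edom_open U) Ux).
Unshelve. all: by end_near. Qed.

Lemma derive_ext_id (U : eucl) x v : edom U x -> 'D_v (ext (@id U)) x = v.
Proof.
move=> Ux; rewrite (@derive_ext_near U U _ id) ?derive_id// => y Uy.
by rewrite (ext_val id (exist _ y Uy)).
Qed.

Lemma derive_ext_comp (U V W : eucl) (g : smap V W) (f : smap U V) x v :
  edom U x ->
  'D_v (ext (g \o f)) x = 'D_('D_v (ext f) x) (ext g) (ext f x).
Proof.
move=> Ux; have df := smooth_on_diff (smap_smooth f) Ux.
have dg := smooth_on_diff (smap_smooth g) (ext_mem f Ux).
apply: etrans (derive_compE v df dg).
by apply: derive_ext_near => // y Uy; exact: ext_comp.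
Qed.

Lemma That_map_id (U : eucl) : That_map (smap_id U) = smap_id (That_ob U).
Proof.
apply: smap_eq => -[w [Uw Tw]] /=.
rewrite /That_fun derive_ext_id// (ext_val id (exist _ _ Uw)) /=.
by rewrite hsubmxK.
Qed.

Lemma That_map_comp (U V W : eucl) (g : smap V W) (f : smap U V) :
  That_map (smap_comp g f) = smap_comp (That_map g) (That_map f).
Proof.
apply: smap_eq => -[w [Uw Tw]] /=.
rewrite /That_fun row_mxKl row_mxKr.
exact: congr2 (ext_comp _ _ Uw) (derive_ext_comp _ _ _ Uw).
Qed.

Definition That : functor EUCL EUCL :=
  @Functor EUCL EUCL That_ob That_map That_map_id That_map_comp.

(* k-fold fiber product of TU over U; the i-th tangent vector is row i of the
   k x n matrix encoded by the second component. *)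
Definition That_k_ob (k : nat) (U : eucl) : eucl := eprod U (efull (k * edim U)).

Definition tvec k n m (w : 'rV[R]_(n + k * m)) (i : 'I_k) : 'rV[R]_m :=
  row i (vec_mx (rsubmx w)).

Definition That_k_fun k (U V : eucl) (f : U -> V) (w : 'rV[R]_(edim U + k * edim U)) :
    'rV[R]_(edim V + k * edim V) :=
  row_mx (ext f (lsubmx w))
    (mxvec (\matrix_(i < k) 'D_(tvec w i) (ext f) (lsubmx w))).

Lemma That_k_fun_mem k (U V : eucl) (f : U -> V) w :
  edom (That_k_ob k U) w -> edom (That_k_ob k V) (That_k_fun f w).
Proof. by move=> [Uw _]; split=> //=; rewrite row_mxKl; exact: ext_mem. Qed.

Lemma tvec_linear k n m i : linear (fun w : 'rV[R]_(n + k * m) => tvec w i).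
Proof. by move=> a x y; rewrite /tvec !linearP. Qed.

Lemma tvec_row_mx k n m (x : 'rV[R]_n) (A : 'M[R]_(k, m)) i :
  tvec (row_mx x (mxvec A)) i = row i A.
Proof. by rewrite /tvec row_mxKr mxvecK. Qed.

Lemma That_k_fun_smooth k (U V : eucl) (f : smap U V) :
  smooth_on (edom (That_k_ob k U)) (@That_k_fun k U V f).
Proof.
have oT := edom_open (That_k_ob k U).
have sl : smooth_on (edom (That_k_ob k U)) (lsubmx : _ -> 'rV[R]_(edim U)).
  exact/smooth_on_linear/lsubmx_linear.
apply: smooth_on_row_mx => //.
  by apply: (smooth_on_comp oT (edom_open U) _ sl (smap_smooth f)) => x [].
apply/smooth_on_row => // c; case/mxvec_indexP: c => i j.
rewrite (_ : (fun x => _) = fun w => ('D_(tvec w i) (ext f) (lsubmx w)) 0 j).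
  apply: ((smooth_on_row _ oT).1 _ j); apply: smooth_on_D => //; first by move=> x [].
  exact/smooth_on_linear/tvec_linear.
by apply/funext => w; rewrite mxvecE mxE.
Qed.

Definition That_k_map k (U V : eucl) (f : smap U V) :
    smap (That_k_ob k U) (That_k_ob k V) :=
  mk_smap (@That_k_fun_mem k U V f) (That_k_fun_smooth f).

Lemma That_k_map_id (k : nat) (U : eucl) : That_k_map k (smap_id U) = smap_id (That_k_ob k U).
Proof.
apply: smap_eq => -[w [Uw Tw]] /=.
rewrite /That_k_fun (ext_val id (exist _ _ Uw)) /= -[RHS]hsubmxK; congr row_mx.
rewrite -[RHS]vec_mxK; congr mxvec; apply/row_matrixP => i.
by rewrite rowK derive_ext_id.
Qed.

Lemma That_k_map_comp (k : nat) (U V W : eucl) (g : smap V W) (f : smap U V) :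
  That_k_map k (smap_comp g f) = smap_comp (That_k_map k g) (That_k_map k f).
Proof.
apply: smap_eq => -[w [Uw Tw]] /=.
rewrite /That_k_fun row_mxKl; apply: congr2; first exact: ext_comp.
apply: (congr1 mxvec); apply/row_matrixP => i.
rewrite (rowK _ i) [RHS](rowK _ i).
rewrite (tvec_row_mx _ _ i) (rowK _ i); exact: derive_ext_comp.
Qed.

Definition That_k (k : nat) : functor EUCL EUCL :=
  @Functor EUCL EUCL (That_k_ob k) (@That_k_map k) (@That_k_map_id k) (@That_k_map_comp k).

Definition RThat_ob (U : eucl) : eucl := eprod (efull 1) (That_ob U).

Definition RThat_fun (U V : eucl) (f : smap U V) (w : 'rV[R]_(1 + (edim U + edim U))) :
    'rV[R]_(1 + (edim V + edim V)) :=
  row_mx (lsubmx w) (That_fun f (rsubmx w)).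

Lemma RThat_fun_mem (U V : eucl) (f : smap U V) w :
  edom (RThat_ob U) w -> edom (RThat_ob V) (RThat_fun f w).
Proof.
move=> [_ Uw]; split=> //.
by rewrite /RThat_fun row_mxKr; exact: (@That_fun_mem U V f (rsubmx w) Uw).
Qed.

Lemma RThat_fun_smooth (U V : eucl) (f : smap U V) :
  smooth_on (edom (RThat_ob U)) (RThat_fun f).
Proof.
have oT := edom_open (RThat_ob U).
apply: smooth_on_row_mx => //; first exact/smooth_on_linear/lsubmx_linear.
apply: (smooth_on_comp oT (edom_open (That_ob U)) _ _ (That_fun_smooth f)).
  by move=> x [].
exact/smooth_on_linear/rsubmx_linear.
Qed.

Definition RThat_map (U V : eucl) (f : smap U V) : smap (RThat_ob U) (RThat_ob V) :=
  mk_smap (@RThat_fun_mem U V f) (RThat_fun_smooth f).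

Lemma RThat_map_id (U : eucl) : RThat_map (smap_id U) = smap_id (RThat_ob U).
Proof.
apply: smap_eq => -[w [Rw [Uw Tw]]] /=.
rewrite /RThat_fun /That_fun derive_ext_id// (ext_val id (exist _ _ Uw)) /=.
by rewrite !hsubmxK.
Qed.

Lemma RThat_map_comp (U V W : eucl) (g : smap V W) (f : smap U V) :
  RThat_map (smap_comp g f) = smap_comp (RThat_map g) (RThat_map f).
Proof.
apply: smap_eq => -[w [Rw [Uw Tw]]] /=.
rewrite /RThat_fun row_mxKl row_mxKr; apply: (congr1 (row_mx _)).
rewrite /That_fun row_mxKl row_mxKr.
exact: congr2 (ext_comp _ _ Uw) (derive_ext_comp _ _ _ Uw).
Qed.

Definition RThat : functor EUCL EUCL :=
  @Functor EUCL EUCL RThat_ob RThat_map RThat_map_id RThat_map_comp.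

Lemma row_mx_linear n m1 m2 (f : 'rV[R]_n -> 'rV[R]_m1) (g : 'rV[R]_n -> 'rV[R]_m2) :
  linear f -> linear g -> linear (fun w => row_mx (f w) (g w)).
Proof. by move=> lf lg a x y; rewrite lf lg scale_row_mx add_row_mx. Qed.

Lemma zero_linear n m : linear (fun _ : 'rV[R]_n => 0 : 'rV[R]_m).
Proof. by move=> a x y; rewrite scaler0 addr0. Qed.

Lemma id_linear n : linear (fun x : 'rV[R]_n => x).
Proof. by []. Qed.

Lemma derive_addE n m (f : 'rV[R]_n -> 'rV[R]_m) x u v : differentiable f x ->
  'D_(u + v) f x = 'D_u f x + 'D_v f x.
Proof. by move=> df; rewrite deriveE// linearD/= (deriveE u df) (deriveE v df). Qed.

Lemma derive_scaleE n m (f : 'rV[R]_n -> 'rV[R]_m) x a v : differentiable f x ->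
  'D_(a *: v) f x = a *: 'D_v f x.
Proof. by move=> df; rewrite deriveE// linearZ/= (deriveE v df). Qed.

(* pi (u, u0) = u *)
Definition pihat_map (U : eucl) : smap (That_ob U) U :=
  @mk_smap (That_ob U) U lsubmx (fun w Uw => Uw.1) (smooth_on_linear (@lsubmx_linear _ _)).

Lemma pihat_natural : @natural EUCL EUCL That (functor_id EUCL) pihat_map.
Proof. by move=> U V f; apply: smap_eq => w /=; rewrite row_mxKl (ext_val f (pihat_map U w)). Qed.

Definition pihat : nat_trans That (functor_id EUCL) := NatTrans pihat_natural.

(* 0 (u) = (u, 0) *)
Definition zerohat_fun n (u : 'rV[R]_n) : 'rV[R]_(n + n) := row_mx u 0.

Lemma zerohat_mem (U : eucl) u : edom U u -> edom (That_ob U) (zerohat_fun u).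
Proof. by move=> Uu; split=> //=; rewrite row_mxKl. Qed.

Lemma zerohat_linear n : linear (@zerohat_fun n).
Proof. exact: row_mx_linear (@id_linear _) (@zero_linear _ _). Qed.

Definition zerohat_map (U : eucl) : smap U (That_ob U) :=
  mk_smap (@zerohat_mem U) (smooth_on_linear (@zerohat_linear _)).

Lemma zerohat_natural : @natural EUCL EUCL (functor_id EUCL) That zerohat_map.
Proof.
move=> U V f; apply: smap_eq => u /=.
by rewrite /That_fun /zerohat_fun row_mxKl row_mxKr derive0 (ext_val f u).
Qed.

Definition zerohat : nat_trans (functor_id EUCL) That := NatTrans zerohat_natural.

Definition basehat_map k (U : eucl) : smap (That_k_ob k U) U :=
  @mk_smap (That_k_ob k U) U lsubmx (fun w Uw => Uw.1) (smooth_on_linear (@lsubmx_linear _ _)).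

Lemma basehat_natural k : @natural EUCL EUCL (That_k k) (functor_id EUCL) (basehat_map k).
Proof. by move=> U V f; apply: smap_eq => w /=; rewrite row_mxKl (ext_val f (basehat_map k U w)). Qed.

Definition basehat k : nat_trans (That_k k) (functor_id EUCL) := NatTrans (@basehat_natural k).

Definition prhat_fun k (i : 'I_k) n (w : 'rV[R]_(n + k * n)) : 'rV[R]_(n + n) :=
  row_mx (lsubmx w) (tvec w i).

Lemma prhat_mem k (i : 'I_k) (U : eucl) w :
  edom (That_k_ob k U) w -> edom (That_ob U) (prhat_fun i w).
Proof. by move=> [Uw _]; split=> //=; rewrite row_mxKl. Qed.

Lemma prhat_linear k (i : 'I_k) n : linear (@prhat_fun k i n).
Proof. exact: row_mx_linear (@lsubmx_linear _ _) (@tvec_linear _ _ _ _). Qed.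

Definition prhat_map k (i : 'I_k) (U : eucl) : smap (That_k_ob k U) (That_ob U) :=
  mk_smap (@prhat_mem k i U) (smooth_on_linear (@prhat_linear k i _)).

Lemma prhat_natural k (i : 'I_k) : @natural EUCL EUCL (That_k k) That (prhat_map i).
Proof.
move=> U V f; apply: smap_eq => w /=.
rewrite /That_fun /That_k_fun /prhat_fun tvec_row_mx rowK !row_mxKl.
by rewrite row_mxKr.
Qed.

Definition prhat k (i : 'I_k) : nat_trans (That_k k) That := NatTrans (@prhat_natural k i).

(* + (u, u0, v0) = (u, u0 + v0) *)
Definition plushat_fun n (w : 'rV[R]_(n + 2 * n)) : 'rV[R]_(n + n) :=
  row_mx (lsubmx w) (tvec w ord0 + tvec w ord_max).

Lemma plushat_mem (U : eucl) w :
  edom (That_k_ob 2 U) w -> edom (That_ob U) (plushat_fun w).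
Proof. by move=> [Uw _]; split=> //=; rewrite row_mxKl. Qed.

Lemma plushat_linear n : linear (@plushat_fun n).
Proof.
apply: row_mx_linear => [|a x y]; first exact: lsubmx_linear.
by rewrite !tvec_linear scalerDr addrACA.
Qed.

Definition plushat_map (U : eucl) : smap (That_k_ob 2 U) (That_ob U) :=
  mk_smap (@plushat_mem U) (smooth_on_linear (@plushat_linear _)).

Lemma plushat_natural : @natural EUCL EUCL (That_k 2) That plushat_map.
Proof.
move=> U V f; apply: smap_eq => -[w [Uw Tw]] /=.
rewrite /That_fun /That_k_fun /plushat_fun !tvec_row_mx !rowK !row_mxKl row_mxKr.
congr row_mx; have df := smooth_on_diff (smap_smooth f) Uw.
exact: esym (derive_addE _ _ df).
Qed.

Definition plushat : nat_trans (That_k 2) That := NatTrans plushat_natural.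

(* lambda (u, u0) = (u, 0, 0, u0) *)
Definition lamhat_fun n (w : 'rV[R]_(n + n)) : 'rV[R]_((n + n) + (n + n)) :=
  row_mx (row_mx (lsubmx w) 0) (row_mx 0 (rsubmx w)).

Lemma lamhat_mem (U : eucl) w :
  edom (That_ob U) w -> edom (That_ob (That_ob U)) (lamhat_fun w).
Proof. by move=> [Uw _]; split=> //=; rewrite !row_mxKl; split=> //=; rewrite row_mxKl. Qed.

Lemma lamhat_linear n : linear (@lamhat_fun n).
Proof.
apply: row_mx_linear; apply: row_mx_linear; try exact: zero_linear.
- exact: lsubmx_linear.
- exact: rsubmx_linear.
Qed.

Definition lamhat_map (U : eucl) : smap (That_ob U) (That_ob (That_ob U)) :=
  mk_smap (@lamhat_mem U) (smooth_on_linear (@lamhat_linear _)).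

Lemma derive_line n1 n2 m (G : 'rV[R]_n1 -> 'rV[R]_m) (F : 'rV[R]_n2 -> 'rV[R]_m)
    v w v' w' : (forall h, G (h *: v + w) = F (h *: v' + w')) -> 'D_v G w = 'D_v' F w'.
Proof.
move=> GF; have E0 : G w = F w' by have := GF 0; rewrite !scale0r !add0r.
rewrite /derive E0.
have E : (fun h => h^-1 *: ((G \o shift w) (h *: v) - F w')) =
         (fun h => h^-1 *: ((F \o shift w') (h *: v') - F w')).
  by apply/funext => h; rewrite /= GF.
by rewrite E.
Qed.

Lemma derive_row_mx n m p (f : 'rV[R]_n -> 'rV[R]_m) (g : 'rV[R]_n -> 'rV[R]_p) x v :
  differentiable f x -> differentiable g x ->
  'D_v (fun y => row_mx (f y) (g y)) x = row_mx ('D_v f x) ('D_v g x).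
Proof.
move=> df dg.
have dfg : differentiable (fun y => row_mx (f y) (g y)) x.
  apply/differentiable_row => j; case: (fintype.splitP j) => i ji.
    have -> : j = lshift p i by exact: val_inj.
    rewrite (_ : (fun y => _) = fun y => f y 0 i); last by apply/funext => y; rewrite row_mxEl.
    by move/differentiable_row : df; exact.
  have -> : j = rshift m i by exact: val_inj.
  rewrite (_ : (fun y => _) = fun y => g y 0 i); last by apply/funext => y; rewrite row_mxEr.
  by move/differentiable_row : dg; exact.
apply/rowP => j; rewrite (derive_coord _ _ dfg); case: (fintype.splitP j) => i ji.
  have -> : j = lshift p i by exact: val_inj.
  rewrite row_mxEl (derive_coord _ _ df); congr ('D_v _ x).
  by apply/funext => y; rewrite row_mxEl.
have -> : j = rshift m i by exact: val_inj.
rewrite row_mxEr (derive_coord _ _ dg); congr ('D_v _ x).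
by apply/funext => y; rewrite row_mxEr.
Qed.

Lemma derive_That (U V : eucl) (f : smap U V) (w z : 'rV[R]_(edim U + edim U)) :
  edom U (lsubmx w) ->
  'D_z (ext (That_map f)) w =
  row_mx ('D_(lsubmx z) (ext f) (lsubmx w))
         ('D_(lsubmx z) ('D_(rsubmx w) (ext f)) (lsubmx w)
          + 'D_(rsubmx z) (ext f) (lsubmx w)).
Proof.
move=> Uw; have Tw : edom (That_ob U) w by [].
have df := smooth_on_diff (smap_smooth f) Uw.
pose G (y : 'rV[R]_(edim U + edim U)) := 'D_(rsubmx y) (ext f) (lsubmx y).
have sG : smooth_on (edom (That_ob U)) G.
  apply: smooth_on_D; [exact: edom_open|by move=> x []| |].
  - exact/smooth_on_linear/lsubmx_linear.
  - exact/smooth_on_linear/rsubmx_linear.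
have dG := smooth_on_diff sG Tw.
have dl : differentiable (lsubmx : _ -> 'rV[R]_(edim U)) w.
  exact/linear_row_differentiable/lsubmx_linear.
have dfl : differentiable (fun y => ext f (lsubmx y)) w.
  exact: (@differentiable_comp _ _ _ _ lsubmx (ext f)).
rewrite (@derive_ext_near (That_ob U) (That_ob V) _ (That_fun f))//; last first.
  by move=> y Ty; exact: (@ext_mk_fun (That_ob U)).
apply: (etrans (@derive_row_mx _ _ _ (fun y => ext f (lsubmx y)) G w z dfl dG)).
apply: congr2.
  apply: (etrans (derive_compE z dl df)).
  by rewrite (derive_linear w z (@lsubmx_linear _ _)).
have zE : z = row_mx (lsubmx z) 0 + row_mx 0 (rsubmx z).
  by rewrite add_row_mx addr0 add0r hsubmxK.
have E1 : 'D_(row_mx (lsubmx z) 0) G w = 'D_(lsubmx z) ('D_(rsubmx w) (ext f)) (lsubmx w).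
  apply: derive_line => h.
  by rewrite /G scale_row_mx scaler0 -[w in LHS]hsubmxK add_row_mx row_mxKl row_mxKr add0r.
have E2 : 'D_(row_mx 0 (rsubmx z)) G w = 'D_(rsubmx z) (ext f) (lsubmx w).
  have L : linear (fun v => 'D_v (ext f) (lsubmx w)).
    by move=> a x y; rewrite (derive_addE _ _ df) (derive_scaleE _ _ df).
  apply: etrans (derive_linear (rsubmx w) (rsubmx z) L).
  apply: derive_line => h.
  by rewrite /G scale_row_mx scaler0 -[w in LHS]hsubmxK add_row_mx row_mxKl row_mxKr add0r.
rewrite -E1 -E2 -(derive_addE _ _ dG); exact: (congr1 (fun y => 'D_y G w) zE).
Qed.

Lemma lamhat_natural : @natural EUCL EUCL That (functor_comp That That) lamhat_map.
Proof.
move=> U V f; apply: smap_eq => -[w [Uw Tw]] /=.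
have zU : edom (That_ob U) (row_mx (lsubmx w) 0) by split=> //=; rewrite row_mxKl.
have Uz : edom U (lsubmx (row_mx (lsubmx w) 0 : 'rV[R]_(edim U + edim U))).
  by rewrite row_mxKl.
have Lw : lsubmx (lamhat_fun w) = row_mx (lsubmx w) 0 by rewrite row_mxKl.
have Rw : rsubmx (lamhat_fun w) = row_mx 0 (rsubmx w) by rewrite row_mxKr.
have E1 : ext (That_map f) (row_mx (lsubmx w) 0) = row_mx (ext f (lsubmx w)) 0.
  apply: (etrans (ext_mk_fun _ zU)).
  by rewrite /That_fun row_mxKl row_mxKr derive0.
have E2 : 'D_(row_mx 0 (rsubmx w)) (ext (That_map f)) (row_mx (lsubmx w) 0) =
    row_mx 0 ('D_(rsubmx w) (ext f) (lsubmx w)).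
  rewrite (derive_That f _ Uz) !row_mxKl !row_mxKr.
  by apply: congr2; rewrite !derive0 ?add0r.
rewrite [RHS]/That_fun Lw Rw; apply: etrans (congr2 row_mx (esym E1) (esym E2)).
by rewrite /lamhat_fun /That_fun row_mxKl row_mxKr.
Qed.

Definition lamhat : nat_trans That (functor_comp That That) := NatTrans lamhat_natural.

(* tau (u, u0, u1, u01) = (u, u1, u0, u01) *)
Definition tauhat_fun n (w : 'rV[R]_((n + n) + (n + n))) : 'rV[R]_((n + n) + (n + n)) :=
  row_mx (row_mx (lsubmx (lsubmx w)) (lsubmx (rsubmx w)))
         (row_mx (rsubmx (lsubmx w)) (rsubmx (rsubmx w))).

Lemma tauhat_mem (U : eucl) w :
  edom (That_ob (That_ob U)) w -> edom (That_ob (That_ob U)) (tauhat_fun w).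
Proof. by move=> [[Uw _] _]; split=> //=; rewrite !row_mxKl; split=> //=; rewrite row_mxKl. Qed.

Lemma tauhat_linear n : linear (@tauhat_fun n).
Proof. by move=> a x y; rewrite /tauhat_fun !linearP !scale_row_mx !add_row_mx. Qed.

Definition tauhat_map (U : eucl) : smap (That_ob (That_ob U)) (That_ob (That_ob U)) :=
  mk_smap (@tauhat_mem U) (smooth_on_linear (@tauhat_linear _)).

Lemma tauhat_natural :
  @natural EUCL EUCL (functor_comp That That) (functor_comp That That) tauhat_map.
Proof.
move=> U V f; apply: smap_eq => -[w [[Uw U0] U1]] /=.
have TU : edom (That_ob U) (lsubmx w) by [].
set u := lsubmx (lsubmx w) in Uw; set u0 := rsubmx (lsubmx w).
set u1 := lsubmx (rsubmx w); set u01 := rsubmx (rsubmx w).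
have TU' : edom (That_ob U) (row_mx u u1) by split=> //=; rewrite row_mxKl.
have Uu : edom U (lsubmx (row_mx u u1 : 'rV[R]_(edim U + edim U))) by rewrite row_mxKl.
have Lw : lsubmx (tauhat_fun w) = row_mx u u1 by rewrite row_mxKl.
have Rw : rsubmx (tauhat_fun w) = row_mx u0 u01 by rewrite row_mxKr.
have E1 : ext (That_map f) (row_mx u u1) = row_mx (ext f u) ('D_u1 (ext f) u).
  by apply: (etrans (ext_mk_fun _ TU')); rewrite /That_fun row_mxKl row_mxKr.
have E2 : 'D_(row_mx u0 u01) (ext (That_map f)) (row_mx u u1) =
    row_mx ('D_u0 (ext f) u) ('D_u0 ('D_u1 (ext f)) u + 'D_u01 (ext f) u).
  by rewrite (derive_That f _ Uu) !row_mxKl !row_mxKr.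
have E3 : ext (That_map f) (lsubmx w) = row_mx (ext f u) ('D_u0 (ext f) u).
  exact: (ext_mk_fun _ TU).
have E4 : 'D_(rsubmx w) (ext (That_map f)) (lsubmx w) =
    row_mx ('D_u1 (ext f) u) ('D_u1 ('D_u0 (ext f)) u + 'D_u01 (ext f) u).
  exact: (derive_That f _ Uw).
rewrite [RHS]/That_fun Lw Rw; apply: etrans (congr2 row_mx (esym E1) (esym E2)).
have -> : That_fun (That_map f) w = row_mx (row_mx (ext f u) ('D_u0 (ext f) u))
    (row_mx ('D_u1 (ext f) u) ('D_u1 ('D_u0 (ext f)) u + 'D_u01 (ext f) u)).
  by rewrite [LHS]/That_fun E3 E4.
rewrite /tauhat_fun row_mxKl row_mxKr !row_mxKl !row_mxKr.
apply: (congr1 (row_mx _)); apply: (congr1 (row_mx _)); apply: (congr1 (fun y => y + _)).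
exact: derive_sym_row (edom_open U) Uw (smap_smooth f).
Qed.

Definition tauhat : nat_trans (functor_comp That That) (functor_comp That That) :=
  NatTrans tauhat_natural.

(* kappa (r, (u, u0)) = (u, r u0) *)
Definition kappahat_fun n (w : 'rV[R]_(1 + (n + n))) : 'rV[R]_(n + n) :=
  row_mx (lsubmx (rsubmx w)) ((lsubmx w) 0 0 *: rsubmx (rsubmx w)).

Lemma kappahat_mem (U : eucl) w :
  edom (RThat_ob U) w -> edom (That_ob U) (kappahat_fun w).
Proof. by move=> [_ [Uw _]]; split=> //=; rewrite row_mxKl. Qed.

Lemma kappahat_smooth (U : eucl) : smooth_on (edom (RThat_ob U)) (@kappahat_fun (edim U)).
Proof.
have oT := edom_open (RThat_ob U).
apply: smooth_on_row_mx => //.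
  by apply: smooth_on_linear => a x y; rewrite !linearP.
apply: smooth_onZ => //.
  apply: ((smooth_on_row _ oT).1 (smooth_on_linear _)).
  exact: lsubmx_linear.
by apply: smooth_on_linear => a x y; rewrite !linearP.
Qed.

Definition kappahat_map (U : eucl) : smap (RThat_ob U) (That_ob U) :=
  mk_smap (@kappahat_mem U) (@kappahat_smooth U).

Lemma kappahat_natural : @natural EUCL EUCL RThat That kappahat_map.
Proof.
move=> U V f; apply: smap_eq => -[w [Rw [Uw Tw]]] /=.
have df := smooth_on_diff (smap_smooth f) Uw.
rewrite /kappahat_fun /RThat_fun !row_mxKl !row_mxKr /That_fun !row_mxKl !row_mxKr.
by congr row_mx; rewrite (derive_scaleE _ _ df).
Qed.

Definition kappahat : nat_trans RThat That := NatTrans kappahat_natural.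

Definition sndhat_map (U : eucl) : smap (RThat_ob U) (That_ob U) :=
  @mk_smap (RThat_ob U) (That_ob U) rsubmx (fun w Uw => Uw.2)
    (smooth_on_linear (@rsubmx_linear _ _)).

Lemma sndhat_natural : @natural EUCL EUCL RThat That sndhat_map.
Proof. by move=> U V f; apply: smap_eq => w /=; rewrite /RThat_fun row_mxKr. Qed.

Definition sndhat : nat_trans RThat That := NatTrans sndhat_natural.

End Euclidean.

Arguments edom {R} e _.
Arguments edom_open {R} e.
Arguments smap_preimage_open {R U V} f {A} oA.

Section Quotient.
Variables (A : Type) (r : A -> A -> Prop).

Definition gen_eq : A -> A -> Prop := Relation_Operators.clos_refl_sym_trans A r.

Definition quot : Type := {c : set A | exists a, c = [set b | gen_eq a b]}.

Definition quot_in (a : A) : quot := exist _ [set b | gen_eq a b] (ex_intro _ a erefl).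

Lemma quot_in_eq (a b : A) : gen_eq a b -> quot_in a = quot_in b.
Proof.
move=> ab; apply: eq_exist_curried => [|?]; last exact: Prop_irrelevance.
apply/seteqP; split=> c /=; first by apply: Relation_Operators.rst_trans; exact: Relation_Operators.rst_sym.
exact: Relation_Operators.rst_trans.
Qed.

Definition quot_repr (q : quot) : A := sval (cid (svalP q)).

Lemma quot_reprK (q : quot) : quot_in (quot_repr q) = q.
Proof.
rewrite /quot_repr; case: cid => a; case: q => c Hc /= E.
by case: _ / (esym E) in Hc *; congr exist; exact: Prop_irrelevance.
Qed.

Lemma quot_ind (P : quot -> Prop) : (forall a, P (quot_in a)) -> forall q, P q.
Proof. by move=> H q; rewrite -(quot_reprK q). Qed.

Lemma quot_in_inj (a b : A) : quot_in a = quot_in b -> gen_eq a b.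
Proof.
move=> /(congr1 sval) /= E.
have : [set c | gen_eq b c] b by exact: Relation_Operators.rst_refl.
by rewrite -E.
Qed.

Variables (B : Type) (f : A -> B).
Hypothesis fr : forall a b, r a b -> f a = f b.

Definition quot_lift (q : quot) : B := f (quot_repr q).

Lemma quot_liftE (a : A) : quot_lift (quot_in a) = f a.
Proof.
have H b c : gen_eq b c -> f b = f c.
  by elim=> [x y /fr//|//|x y _ ->//|x y z _ -> _ ->].
by apply: H; apply: quot_in_inj; exact: quot_reprK.
Qed.
End Quotient.

Section Diffeology.
Variable R : realType.
Local Notation eucl := (eucl R).
Local Notation EUCL := (EUCL R).

(* In plot_local the open cover is given by an open neighborhood W of each point. *)
Record dflg := Dflg {
  carrier :> Type;
  plot : forall U : eucl, (U -> carrier) -> Prop;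
  plot_cst : forall (U : eucl) (x : carrier), @plot U (fun=> x);
  plot_comp : forall (U V : eucl) (f : smap U V) (p : V -> carrier),
    plot p -> plot (p \o f);
  plot_local : forall (U : eucl) (p : U -> carrier),
    (forall u : U, exists (W : set 'rV[R]_(edim U)) (W_open : open W)
        (WU : W `<=` edom U), W (sval u) /\ plot (p \o incl W_open WU)) ->
    plot p }.
Arguments plot _ {U} _.

Record dmap (X Y : dflg) := DMap {
  dmap_fun :> X -> Y;
  dmap_plot : forall (U : eucl) (p : U -> X), plot X p -> plot Y (dmap_fun \o p) }.

Lemma dmap_eq (X Y : dflg) (f g : dmap X Y) : (forall x, f x = g x) -> f = g.
Proof.
case: f g => [f pf] [g pg] /= /funext E; rewrite E in pf *.
by congr DMap; exact: Prop_irrelevance.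
Qed.

Definition dmap_id (X : dflg) : dmap X X := @DMap X X id (fun _ _ H => H).
Definition dmap_comp (X Y Z : dflg) (g : dmap Y Z) (f : dmap X Y) : dmap X Z :=
  @DMap X Z (g \o f) (fun U p Hp => dmap_plot g (dmap_plot f Hp)).

Lemma dmap_idl (X Y : dflg) (f : dmap X Y) : dmap_comp (dmap_id Y) f = f.
Proof. exact: dmap_eq. Qed.
Lemma dmap_idr (X Y : dflg) (f : dmap X Y) : dmap_comp f (dmap_id X) = f.
Proof. exact: dmap_eq. Qed.
Lemma dmap_assoc (X Y Z W : dflg) (h : dmap Z W) (g : dmap Y Z) (f : dmap X Y) :
  dmap_comp h (dmap_comp g f) = dmap_comp (dmap_comp h g) f.
Proof. exact: dmap_eq. Qed.

Definition DFLG : category := Category dmap_idl dmap_idr dmap_assoc.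

Lemma dcompE (X Y Z : DFLG) (g : hom Y Z) (f : hom X Y) (x : (X : dflg)) :
  (g \oc f : dmap X Z) x = (g : dmap Y Z) ((f : dmap X Y) x).
Proof. by []. Qed.

Definition induction_map (X Y : dflg) (f : dmap X Y) : Prop :=
  injective f /\ forall (U : eucl) (p : U -> X), plot Y (f \o p) -> plot X p.

Section Yoneda.
Variable V : eucl.

Definition yon_plot (U : eucl) (p : U -> V) : Prop := smooth_on (edom U) (ext p).

Lemma yon_plot_cst (U : eucl) (x : V) : yon_plot (fun _ : U => x).
Proof.
apply: (@smooth_on_eq _ _ _ _ (fun=> sval x)); [exact: edom_open| |exact: smooth_on_cst].
by move=> u /set_mem Uu; rewrite (ext_val (fun _ : U => x) (exist _ u Uu)).
Qed.

Lemma yon_plot_comp (U W : eucl) (f : smap U W) (p : W -> V) :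
  yon_plot p -> yon_plot (p \o f).
Proof. by move=> sp; exact: ext_comp_smooth sp (smap_smooth f). Qed.

Lemma ext_incl (U : eucl) (p : U -> V) (W : set 'rV[R]_(edim U)) (oW : open W)
    (WU : W `<=` edom U) x : W x -> ext (p \o incl oW WU) x = ext p x.
Proof.
move=> Wx; rewrite (ext_val (p \o incl oW WU) (exist _ x Wx)) /=.
by rewrite -ext_val.
Qed.

Lemma yon_plot_local (U : eucl) (p : U -> V) :
  (forall u : U, exists (W : set 'rV[R]_(edim U)) (W_open : open W)
        (WU : W `<=` edom U), W (sval u) /\ yon_plot (p \o incl W_open WU)) ->
  yon_plot p.
Proof.
move=> H vs x Ux; have [W [oW [WU [Wx sp]]]] := H (exist _ x Ux).
have sW : smooth_on W (ext p).
  by apply: (smooth_on_eq oW _ sp) => y /set_mem Wy; exact: ext_incl.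
exact: sW.
Qed.

Definition yon : dflg := Dflg yon_plot_cst yon_plot_comp yon_plot_local.
End Yoneda.

Definition dpoint : dflg := @Dflg unit (fun _ _ => True)
  (fun _ _ => I) (fun _ _ _ _ _ => I) (fun _ _ _ => I).

Section Product.
Variables X Y : dflg.

Definition dprod_plot (U : eucl) (p : U -> X * Y) : Prop :=
  plot X (fst \o p) /\ plot Y (snd \o p).

Lemma dprod_plot_cst (U : eucl) (x : X * Y) : dprod_plot (fun _ : U => x).
Proof. by split; exact: plot_cst. Qed.

Lemma dprod_plot_comp (U V : eucl) (f : smap U V) (p : V -> X * Y) :
  dprod_plot p -> dprod_plot (p \o f).
Proof. by move=> [p1 p2]; split; [exact: plot_comp p1|exact: plot_comp p2]. Qed.

Lemma dprod_plot_local (U : eucl) (p : U -> X * Y) :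
  (forall u : U, exists (W : set 'rV[R]_(edim U)) (W_open : open W)
        (WU : W `<=` edom U), W (sval u) /\ dprod_plot (p \o incl W_open WU)) ->
  dprod_plot p.
Proof.
move=> H; split; apply: plot_local => u; have [W [oW [WU [Wu []]]]] := H u;
  by exists W, oW, WU.
Qed.

Definition dprod : dflg := Dflg dprod_plot_cst dprod_plot_comp dprod_plot_local.
Definition dfst : dmap dprod X := @DMap dprod X fst (fun _ _ Hp => Hp.1).
Definition dsnd : dmap dprod Y := @DMap dprod Y snd (fun _ _ Hp => Hp.2).

Lemma dpair_plot (Z : dflg) (f : dmap Z X) (g : dmap Z Y) (U : eucl) (p : U -> Z) :
  plot Z p -> plot dprod ((fun z => (f z, g z)) \o p).
Proof. by move=> Hp; split; [exact: dmap_plot f _ _ Hp|exact: dmap_plot g _ _ Hp]. Qed.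
Definition dpair (Z : dflg) (f : dmap Z X) (g : dmap Z Y) : dmap Z dprod :=
  DMap (@dpair_plot Z f g).
End Product.

(* k-fold fiber product of f : A -> B. The component in B is the projection to
   the base; it is determined by the other ones when k > 0. *)
Section FiberProduct.
Variables (A B : dflg) (f : dmap A B) (k : nat).

Definition fprod_carrier : Type := {x : B * ('I_k -> A) | forall i, f (x.2 i) = x.1}.

Definition fprod_plot (U : eucl) (p : U -> fprod_carrier) : Prop :=
  plot B (fun u => (sval (p u)).1) /\ forall i, plot A (fun u => (sval (p u)).2 i).

Lemma fprod_plot_cst (U : eucl) (x : fprod_carrier) : fprod_plot (fun _ : U => x).
Proof. by split=> [|i]; exact: plot_cst. Qed.

Lemma fprod_plot_comp (U V : eucl) (g : smap U V) (p : V -> fprod_carrier) :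
  fprod_plot p -> fprod_plot (p \o g).
Proof.
move=> [p1 p2]; split=> [|i]; first exact: plot_comp g _ p1.
exact: plot_comp g _ (p2 i).
Qed.

Lemma fprod_plot_local (U : eucl) (p : U -> fprod_carrier) :
  (forall u : U, exists (W : set 'rV[R]_(edim U)) (W_open : open W)
        (WU : W `<=` edom U), W (sval u) /\ fprod_plot (p \o incl W_open WU)) ->
  fprod_plot p.
Proof.
move=> H; split=> [|i]; apply: plot_local => u; have [W [oW [WU [Wu [p1 p2]]]]] := H u;
  exists W, oW, WU; split=> //; exact: p2.
Qed.

Definition fprod : dflg := Dflg fprod_plot_cst fprod_plot_comp fprod_plot_local.

Definition fprod_base : dmap fprod B :=
  @DMap fprod B (fun x => (sval x).1) (fun _ _ Hp => Hp.1).
Definition fprod_pr (i : 'I_k) : dmap fprod A :=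
  @DMap fprod A (fun x => (sval x).2 i) (fun _ _ Hp => Hp.2 i).

Lemma fprod_eq (x y : fprod) :
  fprod_base x = fprod_base y -> (forall i, fprod_pr i x = fprod_pr i y) -> x = y.
Proof.
case: x y => [[b a] H] [[b' a'] H'] /= E /funext E'.
by rewrite {}E {}E' in H *; congr exist; exact: Prop_irrelevance.
Qed.

Section Lift.
Variables (Z : dflg) (b : dmap Z B) (a : 'I_k -> dmap Z A).
Hypothesis ab : forall i z, f (a i z) = b z.

Definition fprod_lift_fun (z : Z) : fprod :=
  exist (fun x : B * ('I_k -> A) => forall i, f (x.2 i) = x.1)
    (b z, fun i => a i z) (fun i => ab i z).

Lemma fprod_lift_plot (U : eucl) (p : U -> Z) :
  plot Z p -> plot fprod (fprod_lift_fun \o p).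
Proof.
by move=> Hp; split=> [|i]; [exact: dmap_plot b _ _ Hp|exact: dmap_plot (a i) _ _ Hp].
Qed.

Definition fprod_lift : dmap Z fprod := DMap fprod_lift_plot.
End Lift.
End FiberProduct.

(* Left Kan extension of y F along y: colimit of y F U over the plots p : U -> X,
   i.e. the quotient of the set of pairs (p, a in F U) by the relations
   (p o f, a) ~ (p, F f a), with the finest diffeology for which all the maps
   a |-> [p, a] are morphisms. *)
Section Kan.
Variable F : functor EUCL EUCL.

Section KanOb.
Variable X : dflg.

Record lan_pre := LanPre {
  lp_dom : eucl;
  lp_map : lp_dom -> X;
  lp_isplot : plot X lp_map;
  lp_pt : epoint (F lp_dom) }.

Arguments lp_map : clear implicits.

Definition lan_step (a b : lan_pre) : Prop :=
  exists f : smap (lp_dom a) (lp_dom b),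
    (forall u, lp_map a u = lp_map b (f u)) /\
    lp_pt b = (fmap F (f : hom (lp_dom a : EUCL) (lp_dom b)) : smap _ _) (lp_pt a).

Definition lan_carrier : Type := quot lan_step.

Definition lan_in (U : eucl) (p : U -> X) (Hp : plot X p) (a : epoint (F U)) : lan_carrier :=
  quot_in lan_step (LanPre Hp a).

Definition lan_plot (W : eucl) (q : W -> lan_carrier) : Prop :=
  forall w : W, exists (A : set 'rV[R]_(edim W)) (A_open : open A) (AW : A `<=` edom W),
    A (sval w) /\
    exists (U : eucl) (p : U -> X) (Hp : plot X p) (g : smap (restr A_open) (F U)),
      forall v, q (incl A_open AW v) = lan_in Hp (g v).
Lemma lan_plot_cst (W : eucl) (x : lan_carrier) : lan_plot (fun _ : W => x).
Proof.
move=> w; exists (edom W), (edom_open W), (@subset_refl _ _); split; first exact: svalP w.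
elim/quot_ind: x => -[U p Hp a].
by exists U, p, Hp, (SMap (yon_plot_cst a)).
Qed.

Lemma lan_plot_comp (V W : eucl) (f : smap V W) (q : W -> lan_carrier) :
  lan_plot q -> lan_plot (q \o f).
Proof.
move=> Hq v; have [A [oA [AW [Aw [U [p [Hp [g E]]]]]]]] := Hq (f v).
exists (edom V `&` ext f @^-1` A), (smap_preimage_open f oA), (@subIsetl _ _ _); split.
  by split; [exact: svalP v|rewrite /= ext_val].
exists U, p, Hp, (smap_comp g (smap_restr f oA)) => u /=; rewrite -E; congr q.
by apply: epoint_eq; rewrite /= -ext_val.
Qed.

Lemma lan_plot_local (W : eucl) (q : W -> lan_carrier) :
  (forall w : W, exists (A : set 'rV[R]_(edim W)) (A_open : open A)
        (AW : A `<=` edom W), A (sval w) /\ lan_plot (q \o incl A_open AW)) ->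
  lan_plot q.
Proof.
move=> H w; have [A [oA [AW [Aw Hq]]]] := H w.
have [B [oB [BA [Bw [U [p [Hp [g E]]]]]]]] := Hq (exist _ (sval w) Aw).
exists B, oB, (subset_trans BA AW); split=> //.
exists U, p, Hp, g => v; rewrite -E /=; congr q.
exact: epoint_eq.
Qed.

Definition lan_ob : dflg := Dflg lan_plot_cst lan_plot_comp lan_plot_local.

Lemma lan_in_plot (U : eucl) (p : U -> X) (Hp : plot X p) :
  @plot lan_ob (F U : eucl) (lan_in Hp).
Proof.
move=> a; exists (edom (F U)), (edom_open (F U)), (@subset_refl _ _); split.
  exact: svalP a.
by exists U, p, Hp, (incl (edom_open (F U)) (@subset_refl _ _)).
Qed.

Lemma lan_in_eq (U V : eucl) (p : U -> X) (Hp : plot X p) (q : V -> X) (Hq : plot X q)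
    (f : smap U V) (a : epoint (F U)) : (forall u, p u = q (f u)) ->
  lan_in Hp a = lan_in Hq ((fmap F (f : hom (U : EUCL) V) : smap _ _) a).
Proof. by move=> pq; apply: quot_in_eq; apply: Relation_Operators.rst_step; exists f. Qed.

Lemma lan_in_ext (U : eucl) (p q : U -> X) (Hp : plot X p) (Hq : plot X q)
    (a : epoint (F U)) : (forall u, p u = q u) -> lan_in Hp a = lan_in Hq a.
Proof.
move=> /funext pq; case: _ / pq in Hq *; congr (lan_in _ _); exact: Prop_irrelevance.
Qed.

Lemma lan_ind (P : lan_ob -> Prop) :
  (forall (U : eucl) (p : U -> X) (Hp : plot X p) a, P (lan_in Hp a)) -> forall x, P x.
Proof. by move=> H; apply: quot_ind => -[U p Hp a]; exact: H. Qed.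

Section Desc.
Variables (Y : dflg) (c : forall (U : eucl) (p : U -> X), plot X p -> epoint (F U) -> Y).
Hypothesis c_plot : forall (U : eucl) (p : U -> X) (Hp : plot X p), plot Y (c Hp).
Hypothesis c_compat : forall (U V : eucl) (p : U -> X) (Hp : plot X p) (q : V -> X)
    (Hq : plot X q) (f : smap U V) (a : epoint (F U)), (forall u, p u = q (f u)) ->
  c Hp a = c Hq ((fmap F (f : hom (U : EUCL) V) : smap _ _) a).

Definition lan_desc_fun : lan_ob -> Y :=
  quot_lift (r := lan_step) (fun a => c (lp_isplot a) (lp_pt a)).

Lemma lan_desc_funE (U : eucl) (p : U -> X) (Hp : plot X p) a :
  lan_desc_fun (lan_in Hp a) = c Hp a.
Proof.
apply: quot_liftE => -[U1 p1 H1 a1] [U2 p2 H2 a2] [f [/= E ->]].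
exact: c_compat.
Qed.

Lemma lan_desc_plot (W : eucl) (q : W -> lan_ob) :
  plot lan_ob q -> plot Y (lan_desc_fun \o q).
Proof.
move=> Hq; apply: plot_local => w.
have [A [oA [AW [Aw [U [p [Hp [g E]]]]]]]] := Hq w.
exists A, oA, AW; split=> //.
rewrite (_ : _ \o _ = c Hp \o g); first exact: plot_comp.
by apply/funext => v; rewrite /= E lan_desc_funE.
Qed.

Definition lan_desc : dmap lan_ob Y := DMap lan_desc_plot.
End Desc.

Lemma lan_desc_uniq (Y : dflg) (f g : dmap lan_ob Y) :
  (forall (U : eucl) (p : U -> X) (Hp : plot X p) a, f (lan_in Hp a) = g (lan_in Hp a)) ->
  f = g.
Proof. by move=> E; apply: dmap_eq; exact: lan_ind. Qed.
End KanOb.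

Section KanMap.
Variables (X Y : dflg) (f : dmap X Y).

Definition lan_map_cocone (U : eucl) (p : U -> X) (Hp : plot X p) (a : epoint (F U)) :
  lan_ob Y := lan_in (dmap_plot f Hp) a.

Lemma lan_map_compat (U V : eucl) (p : U -> X) (Hp : plot X p) (q : V -> X)
    (Hq : plot X q) (g : smap U V) (a : epoint (F U)) : (forall u, p u = q (g u)) ->
  lan_map_cocone Hp a =
  lan_map_cocone Hq ((fmap F (g : hom (U : EUCL) V) : smap _ _) a).
Proof. by move=> E; apply: lan_in_eq => u /=; rewrite E. Qed.

(* [p, a] |-> [f o p, a] *)
Definition lan_map : dmap (lan_ob X) (lan_ob Y) :=
  lan_desc (fun U p Hp => lan_in_plot (dmap_plot f Hp)) lan_map_compat.

Lemma lan_mapE (U : eucl) (p : U -> X) (Hp : plot X p) a :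
  lan_map (lan_in Hp a) = lan_in (dmap_plot f Hp) a.
Proof. exact: (lan_desc_funE lan_map_compat). Qed.
End KanMap.

Lemma lan_map_id (X : dflg) : lan_map (dmap_id X) = dmap_id (lan_ob X).
Proof.
by apply: lan_desc_uniq => U p Hp a; rewrite lan_mapE; exact: lan_in_ext.
Qed.

Lemma lan_map_comp (X Y Z : dflg) (g : dmap Y Z) (f : dmap X Y) :
  lan_map (dmap_comp g f) = dmap_comp (lan_map g) (lan_map f).
Proof.
apply: lan_desc_uniq => U p Hp a.
rewrite -[RHS]/(lan_map g (lan_map f _)) (lan_mapE f) (lan_mapE g) lan_mapE.
exact: lan_in_ext.
Qed.

Definition lan : functor DFLG DFLG :=
  @Functor DFLG DFLG lan_ob lan_map lan_map_id lan_map_comp.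
End Kan.

Section KanNat.
Variables (F G : functor EUCL EUCL) (alpha : nat_trans F G) (X : dflg).

Definition lan_nt_cocone (U : eucl) (p : U -> X) (Hp : plot X p) (a : epoint (F U)) :
  lan_ob G X := lan_in Hp ((alpha U : smap (F U) (G U)) a).

Lemma lan_nt_plot (U : eucl) (p : U -> X) (Hp : plot X p) :
  plot (lan_ob G X) (lan_nt_cocone Hp).
Proof. exact: (plot_comp (alpha U : smap (F U) (G U)) (lan_in_plot (F := G) Hp)). Qed.

Lemma lan_nt_compat (U V : eucl) (p : U -> X) (Hp : plot X p) (q : V -> X)
    (Hq : plot X q) (f : smap U V) (a : epoint (F U)) : (forall u, p u = q (f u)) ->
  lan_nt_cocone Hp a = lan_nt_cocone Hq ((fmap F (f : hom (U : EUCL) V) : smap _ _) a).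
Proof.
move=> E; rewrite /lan_nt_cocone.
have := congr1 (fun h : smap (F U) (G V) => h a) (nt_natural alpha (f : hom (U : EUCL) V)).
by move=> /= ->; exact: lan_in_eq.
Qed.

(* [p, a] |-> [p, alpha_U a] *)
Definition lan_nt : hom (lan F X) (lan G X) := lan_desc lan_nt_plot lan_nt_compat.

Lemma lan_ntE (U : eucl) (p : U -> X) (Hp : plot X p) a :
  (lan_nt : dmap _ _) (lan_in Hp a) = lan_in Hp ((alpha U : smap (F U) (G U)) a).
Proof. exact: (lan_desc_funE lan_nt_compat). Qed.
End KanNat.

Section KanId.
Variable X : dflg.

Lemma lan_id_compat (U V : eucl) (p : U -> X) (Hp : plot X p) (q : V -> X)
    (Hq : plot X q) (f : smap U V) (a : U) : (forall u, p u = q (f u)) -> p a = q (f a).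
Proof. exact. Qed.

(* [p, a] |-> p a *)
Definition lan_id : hom (lan (functor_id EUCL) X) X :=
  @lan_desc (functor_id EUCL) X X (fun U p _ => p) (fun U p Hp => Hp) lan_id_compat.

Lemma lan_idE (U : eucl) (p : U -> X) (Hp : plot X p) a :
  (lan_id : dmap _ _) (@lan_in (functor_id EUCL) X U p Hp a) = p a.
Proof. exact: (@lan_desc_funE (functor_id EUCL) X X _ lan_id_compat). Qed.

Lemma lan_id_iso : is_iso lan_id.
Proof.
pose pt0 : efull R 0 := exist _ 0 I.
pose h (x : X) : lan_ob (functor_id EUCL) X :=
  @lan_in (functor_id EUCL) X (efull R 0) (fun=> x) (plot_cst _ x) pt0.
have hE (U : eucl) (p : U -> X) (Hp : plot X p) (u : U) :
    h (p u) = @lan_in (functor_id EUCL) X U p Hp u.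
  apply: (@lan_in_eq (functor_id EUCL) X (efull R 0) U _ _ p Hp
    (SMap (yon_plot_cst (U := efull R 0) u)) pt0) => //.
have h_plot (U : eucl) (p : U -> X) : plot X p ->
    plot (lan_ob (functor_id EUCL) X) (h \o p).
  move=> Hp; rewrite (_ : _ \o _ = @lan_in (functor_id EUCL) X U p Hp).
    exact: (@lan_in_plot (functor_id EUCL)).
  by apply/funext => u; exact: hE.
exists (DMap h_plot : hom (X : DFLG) _); split.
  apply: lan_desc_uniq => U p Hp a /=.
  by rewrite [X in h X]lan_idE; exact: hE.
by apply: dmap_eq => x; exact: (lan_idE (plot_cst (efull R 0) x)).
Qed.
End KanId.

Section KanComp.
Variables (F G : functor EUCL EUCL) (X : dflg).

Definition lan_mu_cocone (U : eucl) (p : U -> X) (Hp : plot X p)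
    (a : epoint (functor_comp F G U)) : lan_ob F (lan_ob G X) :=
  @lan_in F (lan_ob G X) (G U) (lan_in Hp) (lan_in_plot (F := G) Hp) a.

Lemma lan_mu_compat (U V : eucl) (p : U -> X) (Hp : plot X p) (q : V -> X)
    (Hq : plot X q) (f : smap U V) (a : epoint (functor_comp F G U)) :
  (forall u, p u = q (f u)) ->
  lan_mu_cocone Hp a =
  lan_mu_cocone Hq ((fmap (functor_comp F G) (f : hom (U : EUCL) V) : smap _ _) a).
Proof.
move=> E; apply: (@lan_in_eq F (lan_ob G X) (G U) (G V) _ _ _ _ (fmap G (f : hom (U : EUCL) V))).
by move=> u; exact: lan_in_eq.
Qed.

(* mu : L(F G) X -> (L F)(L G) X, [p, a] |-> [[p, -], a], where [p, -] : G U -> (L G) X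
   is the plot of the colimit cocone *)
Definition lan_mu : hom (lan (functor_comp F G) X) (lan F (lan G X)) :=
  @lan_desc (functor_comp F G) X _ lan_mu_cocone
    (fun U p Hp => @lan_in_plot F (lan_ob G X) (G U) (lan_in Hp) (lan_in_plot (F := G) Hp))
    lan_mu_compat.
End KanComp.

Definition dT : functor DFLG DFLG := lan (That R).

Definition dpi (X : dflg) : hom (dT X) X := lan_id X \oc lan_nt (pihat R) X.

Definition dzero (X : dflg) : hom (X : DFLG) (dT X) :=
  lan_nt (zerohat R) X \oc iso_inv (lan_id_iso X).

Lemma dpiE (X : dflg) (U : eucl) (p : U -> X) (Hp : plot X p) a :
  (dpi X : dmap _ _) (@lan_in (That R) X U p Hp a) = p (pihat_map U a).
Proof.
exact: etrans (congr1 (lan_id X : dmap _ _) (lan_ntE (pihat R) Hp a)) (lan_idE Hp _).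
Qed.

Lemma dpi_natural : @natural DFLG DFLG dT (functor_id DFLG) dpi.
Proof.
move=> X Y f; apply: lan_desc_uniq => U p Hp a.
apply: etrans (congr1 (dpi Y : dmap _ _) (lan_mapE f Hp a)) _.
exact: etrans (dpiE (dmap_plot f Hp) a) (congr1 (f : dmap _ _) (esym (dpiE Hp a))).
Qed.

Section FiberPowers.
Variable k : nat.

Definition dTk_ob (X : dflg) : dflg := fprod (dpi X : dmap _ _) k.

Lemma dTk_map_subproof (X Y : dflg) (f : dmap X Y) (i : 'I_k) (x : dTk_ob X) :
  (dpi Y : dmap _ _) ((fmap dT (f : hom (X : DFLG) Y) \oc fprod_pr (dpi X : dmap _ _) i : dmap _ _) x) =
  (dmap_comp f (fprod_base (dpi X : dmap _ _) k)) x.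
Proof.
have E := congr1 (fun h : dmap _ _ => h (fprod_pr (dpi X : dmap _ _) i x))
  (dpi_natural (f : hom (X : DFLG) Y)).
by apply: etrans E _; rewrite dcompE; congr (f _); exact: (svalP x).
Qed.

Definition dTk_map (X Y : dflg) (f : dmap X Y) : dmap (dTk_ob X) (dTk_ob Y) :=
  fprod_lift (dTk_map_subproof f).

Lemma dTk_map_id (X : dflg) : dTk_map (dmap_id X) = dmap_id (dTk_ob X).
Proof.
apply: dmap_eq => x; apply: fprod_eq => // i.
exact: (congr1 (fun h : dmap _ _ => h (fprod_pr (dpi X : dmap _ _) i x)) (fmap_id dT X)).
Qed.

Lemma dTk_map_comp (X Y Z : dflg) (g : dmap Y Z) (f : dmap X Y) :
  dTk_map (dmap_comp g f) = dmap_comp (dTk_map g) (dTk_map f).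
Proof.
apply: dmap_eq => x; apply: fprod_eq => // i.
exact: (congr1 (fun h : dmap _ _ => h (fprod_pr (dpi X : dmap _ _) i x))
  (fmap_comp dT (g : hom (Y : DFLG) Z) (f : hom (X : DFLG) Y))).
Qed.

Definition dTk : functor DFLG DFLG :=
  @Functor DFLG DFLG dTk_ob dTk_map dTk_map_id dTk_map_comp.

Definition dTpr (i : 'I_k) (X : dflg) : hom (dTk X) (dT X) := fprod_pr (dpi X : dmap _ _) i.

Lemma dtheta_subproof (X : dflg) (i : 'I_k) (x : lan (That_k R k) X) :
  (dpi X : dmap _ _) ((lan_nt (prhat R i) X : dmap _ _) x) =
  (lan_id X \oc lan_nt (basehat R k) X : dmap _ _) x.
Proof.
elim/lan_ind: x => U p Hp a.
apply: etrans (congr1 (dpi X : dmap _ _) (lan_ntE (prhat R i) Hp a)) _.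
apply: etrans (dpiE Hp _) _.
apply: esym.
apply: etrans (congr1 (lan_id X : dmap _ _) (lan_ntE (basehat R k) Hp a)) _.
apply: etrans (lan_idE Hp _) _; congr p; apply: epoint_eq.
by rewrite /= row_mxKl.
Qed.

Definition dtheta (X : dflg) : hom (lan (That_k R k) X) (dTk X) :=
  fprod_lift (dtheta_subproof (X := X)).

Lemma dnu_subproof (X : dflg) (i : 'I_k) (x : dT (dTk X)) :
  (fmap dT (dpi X) : dmap _ _) ((fmap dT (dTpr i X) : dmap _ _) x) =
  (fmap dT (fprod_base (dpi X : dmap _ _) k : hom (dTk X) X) : dmap _ _) x.
Proof.
rewrite -dcompE -fmap_comp; congr ((fmap dT _ : dmap _ _) x).
by apply: dmap_eq => y; exact: (svalP y).
Qed.

Definition dnu (X : dflg) : hom (dT (dTk X)) (fprod (fmap dT (dpi X) : dmap _ _) k : DFLG) :=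
  fprod_lift (dnu_subproof (X := X)).
End FiberPowers.

Definition dtheta2 (X : dflg) : hom (lan (functor_comp (That R) (That R)) X) (dT (dT X)) :=
  lan_mu (That R) (That R) X.

Definition dlam (X : dflg) : hom (dT X) (dT (dT X)) := dtheta2 X \oc lan_nt (lamhat R) X.

Record elastic_axioms (X : dflg) : Prop := ElasticAxioms {
  elastic_E1 : forall k, (1 < k)%N -> is_iso (dtheta k X);
  elastic_E2 : exists tau : hom (dT (dT X)) (dT (dT X)),
    tau \oc dtheta2 X = dtheta2 X \oc lan_nt (tauhat R) X;
  elastic_E3 : induction_map (dlam X : dmap _ _);
  elastic_E4 : forall k, (1 < k)%N -> injective (dnu k X : dmap _ _) }.

Definition elastic (X : dflg) : Prop :=
  elastic_axioms X /\
  forall ks : seq nat, all (fun k => 0 < k)%N ks ->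
    elastic_axioms (foldr (fun k (Y : DFLG) => dTk k Y) (X : DFLG) ks).

Definition ELST : category := full_sub (C := DFLG) elastic.

Lemma elastic_Tk k (k0 : (0 < k)%N) (X : DFLG) : elastic X -> elastic (dTk k X).
Proof.
move=> [_ H]; split; first by apply: (H [:: k]); rewrite /= k0.
move=> ks ks0; have := H (rcons ks k); rewrite all_rcons k0 ks0 -cats1 foldr_cat.
exact.
Qed.

Section ElasticStructure.
Variables (X : dflg) (eX : elastic X).

Definition dplus : hom (dTk 2 X) (dT X) :=
  lan_nt (plushat R) X \oc iso_inv (elastic_E1 eX.1 (isT : (1 < 2)%N)).

(* The morphism is unique, as dtheta2 X is surjective. *)
Definition dtau : hom (dT (dT X)) (dT (dT X)) := sval (cid (elastic_E2 eX.1)).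
End ElasticStructure.

Definition line : dflg := yon (efull R 1).

Definition line_of (x : 'rV[R]_1) : line := exist _ x I.

Lemma line_op_plot (op : 'rV[R]_1 -> 'rV[R]_1 -> 'rV[R]_1) :
  (forall n (A : set 'rV[R]_n) (f g : 'rV[R]_n -> 'rV[R]_1), open A ->
     smooth_on A f -> smooth_on A g -> smooth_on A (fun x => op (f x) (g x))) ->
  forall (U : eucl) (p : U -> dprod line line), plot (dprod line line) p ->
  plot line ((fun x : dprod line line => line_of (op (sval x.1) (sval x.2))) \o p).
Proof.
move=> sop U p [p1 p2].
have := sop _ _ _ _ (edom_open U) p1 p2.
apply: smooth_on_eq; first exact: edom_open.
move=> x /set_mem Ux.
rewrite (ext_val (fst \o p) (exist _ x Ux)) (ext_val (snd \o p) (exist _ x Ux)).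
by rewrite (ext_val _ (exist _ x Ux)).
Qed.

Lemma line_mul_smooth n (A : set 'rV[R]_n) (f g : 'rV[R]_n -> 'rV[R]_1) : open A ->
  smooth_on A f -> smooth_on A g -> smooth_on A (fun x => f x 0 0 *: g x).
Proof. by move=> oA sf sg; apply: smooth_onZ => //; exact: ((smooth_on_row _ oA).1 sf). Qed.

Lemma line_opp_plot (U : eucl) (p : U -> line) : plot line p ->
  plot line ((fun x : line => line_of (- sval x)) \o p).
Proof.
move=> Hp.
have := smooth_onZ (edom_open U) (@smooth_on_cst R _ _ (edom U) (-1 : R)) Hp.
apply: smooth_on_eq; first exact: edom_open.
move=> x /set_mem Ux.
by rewrite (ext_val p (exist _ x Ux)) (ext_val _ (exist _ x Ux)) scaleN1r.
Qed.

Definition line_add : dmap (dprod line line) line :=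
  DMap (line_op_plot (op := fun x y => x + y) (fun n A f g oA => smooth_onD oA)).
Definition line_mul : dmap (dprod line line) line :=
  DMap (line_op_plot (op := fun x y => x 0 0 *: y) (fun n A f g oA => line_mul_smooth oA)).
Definition line_opp : dmap line line := DMap line_opp_plot.
Definition line_zero : dmap dpoint line :=
  @DMap dpoint line (fun=> line_of 0) (fun U p _ => plot_cst U (line_of 0)).
Definition line_one : dmap dpoint line :=
  @DMap dpoint line (fun=> line_of (const_mx 1))
    (fun U p _ => plot_cst U (line_of (const_mx 1))).

Section Rho.
Variable X : dflg.

Definition rho_fst_cocone (U : eucl) (p : U -> X) (Hp : plot X p)
  (a : epoint (RThat R U)) : line := line_of (lsubmx (sval a)).

Lemma rho_fst_plot (U : eucl) (p : U -> X) (Hp : plot X p) : plot line (rho_fst_cocone Hp).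
Proof.
apply: (smooth_on_eq (edom_open (RThat_ob U)) _ (smooth_on_linear (@lsubmx_linear _ _ _))).
by move=> w /set_mem Uw; rewrite (ext_val (rho_fst_cocone Hp) (exist _ w Uw : RThat_ob U)).
Qed.

Lemma rho_fst_compat (U V : eucl) (p : U -> X) (Hp : plot X p) (q : V -> X)
    (Hq : plot X q) (f : smap U V) (a : epoint (RThat R U)) : (forall u, p u = q (f u)) ->
  rho_fst_cocone Hp a =
  rho_fst_cocone Hq ((fmap (RThat R) (f : hom (U : EUCL) V) : smap _ _) a).
Proof. by move=> _; apply: epoint_eq; rewrite /= /RThat_fun row_mxKl. Qed.

Definition rho_fst : dmap (lan (RThat R) X) line := lan_desc rho_fst_plot rho_fst_compat.

(* [p, (r, v)] |-> (r, [p, v]) *)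
Definition rho : hom (lan (RThat R) X) (dprod line (dT X) : DFLG) :=
  dpair rho_fst (lan_nt (sndhat R) X : dmap _ _).

Lemma rhoE (U : eucl) (p : U -> X) (Hp : plot X p) a :
  (rho : dmap _ _) (lan_in Hp a) =
  (line_of (lsubmx (sval a)), lan_in (F := That R) Hp (sndhat_map U a)).
Proof.
exact: congr2 (lan_desc_funE rho_fst_compat Hp a) (lan_ntE (sndhat R) Hp a).
Qed.

Lemma rho_inv_mem (U : eucl) (r : line) (v : That_ob U) :
  edom (RThat_ob U) (row_mx (sval r) (sval v)).
Proof. by split=> //; rewrite row_mxKr; exact: (svalP v). Qed.

Definition rho_inv_pt (U : eucl) (r : line) (v : That_ob U) : epoint (RThat R U) :=
  exist _ _ (rho_inv_mem r v).

Definition rho_inv_fun (x : dprod line (lan_ob (That R) X)) : lan_ob (RThat R) X :=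
  quot_lift (r := @lan_step (That R) X)
    (fun a => lan_in (lp_isplot a) (rho_inv_pt x.1 (lp_pt a))) x.2.

Lemma rho_inv_funE (U : eucl) (p : U -> X) (Hp : plot X p) r (v : That_ob U) :
  rho_inv_fun (r, @lan_in (That R) X U p Hp v) = lan_in Hp (rho_inv_pt r v).
Proof.
apply: quot_liftE => -[U1 p1 H1 a1] [U2 p2 H2 a2] [f [/= E ->]].
apply: etrans (lan_in_eq H1 H2 _ E) _; congr (lan_in _ _); apply: epoint_eq.
by rewrite /= /RThat_fun row_mxKl row_mxKr.
Qed.

Lemma rho_inv_plot (W : eucl) (q : W -> dprod line (lan_ob (That R) X)) :
  plot (dprod line (lan_ob (That R) X)) q -> plot (lan_ob (RThat R) X) (rho_inv_fun \o q).
Proof.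
move=> [q1 q2] w; have [A [oA [AW [Aw [U [p [Hp [g E]]]]]]]] := q2 w.
exists A, oA, AW; split=> //; exists U, p, Hp.
pose h (v : restr oA) : epoint (RThat R U) := rho_inv_pt (q (incl oA AW v)).1 (g v).
have sh : smooth_on A (ext h).
  have s1 : smooth_on A (ext ((fst \o q) \o incl oA AW)).
    exact: (@plot_comp line _ _ (incl oA AW) _ q1).
  have := smooth_on_row_mx oA s1 (smap_smooth g).
  apply: smooth_on_eq => // x /set_mem Ax.
  rewrite (ext_val _ (exist _ x Ax : restr oA)) (ext_val g (exist _ x Ax : restr oA)).
  by rewrite (ext_val h (exist _ x Ax : restr oA)).
exists (SMap (U := restr oA) sh) => v.
rewrite /= -rho_inv_funE -E /=.
by case: (q _).
Qed.

Lemma rho_iso : is_iso rho.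
Proof.
exists (DMap rho_inv_plot : hom (dprod line (dT X) : DFLG) _); split.
  apply: lan_desc_uniq => U p Hp a.
  apply: etrans (congr1 rho_inv_fun (rhoE Hp a)) _.
  apply: etrans (rho_inv_funE Hp _ _) _.
  apply: (congr1 (lan_in Hp)); apply: epoint_eq; exact: hsubmxK.
apply: dmap_eq => -[r]; apply: lan_ind => U p Hp v.
apply: etrans (congr1 (rho : dmap _ _) (rho_inv_funE Hp r v)) _.
apply: etrans (rhoE Hp _) _; apply: congr2.
  by apply: epoint_eq; exact: row_mxKl.
by apply: (congr1 (lan_in (F := That R) Hp)); apply: epoint_eq; exact: row_mxKr.
Qed.

Definition dkappa : hom (dprod line (dT X) : DFLG) (dT X) :=
  lan_nt (kappahat R) X \oc iso_inv rho_iso.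
End Rho.

(* The spaces that occur in the structure are objects of ELST. Only a proof of this
   turns the data below into data on ELST; for T_k it follows from (E5). *)
Record elst_closed : Prop := ElstClosed {
  elst_T : forall X : DFLG, elastic X -> elastic (dT X);
  elst_point : elastic dpoint;
  elst_line : elastic line;
  elst_line2 : elastic (dprod line line);
  elst_lineT : forall X : DFLG, elastic X -> elastic (dprod line (dT X)) }.

Section ElstStructure.
Hypothesis closed : elst_closed.

Definition elst_ob (X : dflg) (eX : elastic X) : ELST := exist elastic X eX.

Definition elst_tangent : tangent_data ELST := {|
  tT := full_sub_functor (elst_T closed);
  tTk := fun k k0 => full_sub_functor (@elastic_Tk k k0);
  tpr := fun k k0 i X => dTpr i (sval X);
  tpi := fun X => dpi (sval X);
  tzero := fun X => dzero (sval X);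
  tplus := fun X => dplus (svalP X);
  tlam := fun X => dlam (sval X);
  ttau := fun X => dtau (svalP X) |}.

Definition elst_line_ring : ring_data ELST := {|
  r_ob := elst_ob (elst_line closed);
  r_pt := elst_ob (elst_point closed);
  r_sq := elst_ob (elst_line2 closed);
  r_p1 := dfst line line;
  r_p2 := dsnd line line;
  r_add := line_add;
  r_mul := line_mul;
  r_zero := line_zero;
  r_one := line_one;
  r_opp := line_opp |}.

Definition elst_lineT_ob (X : ELST) : ELST := elst_ob (elst_lineT closed (svalP X)).

Definition elst_lineT_fst (X : ELST) : hom (elst_lineT_ob X) (r_ob elst_line_ring) :=
  dfst line (dT (sval X)).
Definition elst_lineT_snd (X : ELST) : hom (elst_lineT_ob X) (tT elst_tangent X) :=
  dsnd line (dT (sval X)).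
Definition elst_kappa (X : ELST) : hom (elst_lineT_ob X) (tT elst_tangent X) :=
  dkappa (sval X).
End ElstStructure.

End Diffeology.

Arguments plot {R} _ {U} _.

(* Main.v *)
(** Every element of an iterated space T^n X is [[...[p, -], ...], a] for a plot p : U -> X and
    a point a of That^n U, and each structure map acts on it through its Euclidean counterpart
    on a; the equational axioms thus reduce to identities between block matrices.

    Three points need more. Elastic spaces are closed under the constructions involved because
    the axioms pass to retracts (TX is a retract of T_1 X) and to products (a Kan extension of a
    product-preserving functor preserves products), and hold for Euclidean spaces by the Yoneda
    lemma. The maps nu_k, injective by (E4), are isomorphisms since tau identifies their target
    with T_k(TX), whose plots lift by (E1) for TX. Finally, if pi_T w = T pi w = 0 for
    w = [[p, -], (u, u0, u1, u01)], then (E1) gives [p, (u, u0, u1)] = 0 in (L That_2) X, hence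
    a zigzag of smooth maps from (p, (u, u0, u1)) to (p, (u, 0, 0)). Being in the image of lambda
    for all u01 propagates along the zigzag: a second derivative only changes u01, and such a
    change amounts to adding an element of the image of lambda. *)
From mathcomp Require Import all_boot all_algebra.
From mathcomp Require Import all_classical all_reals topology normedtype derive.
Require Import Defs.
From mathcomp Require Import reals.
Set Implicit Arguments.
Unset Strict Implicit.
Unset Printing Implicit Defensive.
Import GRing.Theory.
Import numFieldNormedType.Exports.
Local Open Scope classical_set_scope.
Local Open Scope ring_scope.

Local Notation fm F f := (fmap F (f : hom (_ : EUCL _) _) : smap _ _).
Local Notation "f ∙ x" := ((f : dmap _ _) x) (at level 41, right associativity).
Local Notation tin Hp a := (lan_in (F := That _) Hp a).
Local Notation tkin k Hp a := (lan_in (F := That_k _ k) Hp a).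
Local Notation tplot Hp := (lan_in_plot (F := That _) Hp).

(** * Generators of Kan extensions *)

Section Euclid.
Variable R : realType.
Local Notation eucl := (eucl R).
Local Notation EUCL := (EUCL R).

(** Two classes [p, a] and [q, b] are equal only through a zigzag of smooth maps, so no component of
    a representative has a meaning of its own: [p, (u, v)] can be the zero vector although v is
    nonzero, and two vectors over the same point may come from unrelated plots. Each axiom therefore
    serves as a device for choosing representatives. (E1) for k = 2 and k = 3 puts two or three
    vectors on one plot, (E4) allows a component whose class vanishes to be replaced by 0, and (E3)
    makes a lift that was found pointwise smooth. A second obstacle is that a point of T(TX) is a
    priori [q, b] for an arbitrary plot q of TX, and q has the form [p, g(-)] only locally. Reducing
    to generators thus requires shrinking domains, which is harmless because the Euclidean functors
    are compatible with restriction to open subsets. *)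

Lemma ext_linear (U V : eucl) (f : U -> V) (F : 'rV[R]_(edim U) -> 'rV[R]_(edim V)) x v :
  linear F -> (forall u : U, sval (f u) = F (sval u)) -> edom U x ->
  ext f x = F x /\ 'D_v (ext f) x = F v.
Proof.
move=> lF fF Ux.
have E y : edom U y -> ext f y = F y by move=> Uy; rewrite (ext_val f (exist _ y Uy)) fF.
by split; [exact: E|rewrite (derive_ext_near v Ux E) derive_linear].
Qed.

Lemma That_linear (U V : eucl) (f : smap U V) (F : 'rV[R]_(edim U) -> 'rV[R]_(edim V))
    (w : That_ob U) : linear F -> (forall u : U, sval (f u) = F (sval u)) ->
  sval (fm (That R) f w) = row_mx (F (lsubmx (sval w))) (F (rsubmx (sval w))).
Proof.
move=> lF fF; have Uw := (svalP w).1.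
by have [E1 E2] := ext_linear (U := U) (f := f) (rsubmx (sval w)) lF fF Uw; exact: congr2 E1 E2.
Qed.

Lemma That_k_linear k (U V : eucl) (f : smap U V)
    (F : 'rV[R]_(edim U) -> 'rV[R]_(edim V)) (w : That_k_ob k U) :
  linear F -> (forall u : U, sval (f u) = F (sval u)) ->
  sval (fm (That_k R k) f w) =
  row_mx (F (lsubmx (sval w))) (mxvec (\matrix_i F (tvec (sval w) i))).
Proof.
move=> lF fF; have Uw := (svalP w).1.
rewrite /= /That_k_fun; congr row_mx; first by case: (ext_linear (U := U) (f := f) 0 lF fF Uw).
apply: (congr1 mxvec); apply/row_matrixP => i; rewrite !rowK.
by have [_ ->] := ext_linear (U := U) (f := f) (tvec (sval w) i) lF fF Uw.
Qed.

(* b U is the projection of F U to the base; F W is the part of F U above an open subset W. *)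
Definition local_functor (F : functor EUCL EUCL) (b : forall U : eucl, smap (F U) U) :=
  forall (U : eucl) (W : set 'rV[R]_(edim U)) (oW : open W) (WU : W `<=` edom U)
    (Z : eucl) (g : smap Z (F U)), (forall z, W (sval (b U (g z)))) ->
  exists g' : smap Z (F (restr oW)), forall z, g z = fm F (incl oW WU) (g' z).

(** [restr] keeps the ambient dimension, so the lift has the same coordinates as [g]; only
    membership of the base point in [W] is at stake. *)
Lemma That_local : local_functor (F := That R) (@pihat_map R).
Proof.
move=> U W oW WU Z g gW.
have H x : edom Z x -> edom (That_ob (restr oW)) (ext g x).
  move=> Zx; rewrite (ext_val g (exist _ x Zx)); split=> //; exact: gW.
exists (@mk_smap R Z (That_ob (restr oW)) (ext g) H (smap_smooth g)) => z.
apply: epoint_eq; rewrite (@That_linear (restr oW) U (incl oW WU) id)//=.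
by rewrite hsubmxK ext_val.
Qed.

Lemma That_k_local k : local_functor (F := That_k R k) (@basehat_map R k).
Proof.
move=> U W oW WU Z g gW.
have H x : edom Z x -> edom (That_k_ob k (restr oW)) (ext g x).
  move=> Zx; rewrite (ext_val g (exist _ x Zx)); split=> //; exact: gW.
exists (@mk_smap R Z (That_k_ob k (restr oW)) (ext g) H (smap_smooth g)) => z.
apply: epoint_eq; rewrite (@That_k_linear k (restr oW) U (incl oW WU) id)//=.
rewrite ext_val (_ : \matrix_i _ = vec_mx (rsubmx (sval (g z)))) ?vec_mxK ?hsubmxK//.
by apply/row_matrixP => i; rewrite rowK.
Qed.
End Euclid.

Section Generators.
Variable R : realType.
Local Notation eucl := (eucl R).
Local Notation EUCL := (EUCL R).
Local Notation dflg := (dflg R).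
Local Notation DFLG := (DFLG R).

(** When the [c i] are plots, this says that the map from the disjoint union of the [D i] to [Y] is
    a subduction, without forming that union. *)
Definition generates (Y : dflg) (J : Type) (D : J -> eucl) (c : forall i, D i -> Y) :=
  forall (Z : eucl) (q : Z -> Y), plot Y q -> forall z : Z,
  exists (A : set 'rV[R]_(edim Z)) (oA : open A) (AZ : A `<=` edom Z), A (sval z) /\
  exists (i : J) (g : smap (restr oA) (D i)), forall v, q (incl oA AZ v) = c i (g v).

Definition plot_index (X : dflg) := {U : eucl & {p : U -> X | plot X p}}.

(** A point of [Y] is a constant plot on the one-point space [efull R 0], so a family that generates
    the plots also covers the points. *)
Lemma generates_ind (Y : dflg) J (D : J -> eucl) (c : forall i, D i -> Y) (P : Y -> Prop) :
  generates c -> (forall i a, P (c i a)) -> forall y, P y.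
Proof.
move=> gc H y; pose z : efull R 0 := exist _ 0 I.
have [A [oA [AZ [Az [i [g E]]]]]] := gc _ _ (plot_cst (efull R 0) y) z.
by rewrite (E (exist _ (sval z) Az)).
Qed.

(** Near z a plot of LF(Y) is [p, g1(-)] with p a plot of Y, and near the base point of g1(z) the
    plot p factors through some [c i] by a map h on an open W. Shrinking the domain to the preimage
    of W lets g1 be lifted to F(W), and F(h) carries it to F(D i). *)
Lemma generates_lan (F : functor EUCL EUCL) (b : forall U : eucl, smap (F U) U) (Y : dflg)
    J (D : J -> eucl) (c : forall i, D i -> Y) (Hc : forall i, plot Y (c i)) :
  local_functor b -> generates c -> generates (Y := lan_ob F Y) (fun i => lan_in (F := F) (Hc i)).
Proof.
move=> locF gc Z q Hq z.
have [A1 [oA1 [A1Z [A1z [U [p [Hp [g1 E1]]]]]]]] := Hq z.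
pose bg := smap_comp (b U) g1.
pose z1 : restr oA1 := exist _ (sval z) A1z.
have [W [oW [WU [Wu [i [h Eh]]]]]] := gc _ _ Hp (bg z1).
pose oA := smap_preimage_open bg oW.
have AA1 : edom (restr oA1) `&` ext bg @^-1` W `<=` edom (restr oA1) by exact: subIsetl.
pose g1' := smap_comp g1 (@incl R (restr oA1) _ oA AA1).
have g1W v : W (sval (b U (g1' v))).
  have := (svalP v).2; rewrite /= (ext_val bg (exist _ (sval v) (svalP v).1)) /=.
  by congr (W (sval (b U (g1 _)))); exact: epoint_eq.
have [g2 Eg2] := locF _ _ oW WU _ _ g1W.
exists _, oA, (subset_trans AA1 A1Z); split; first by split=> //=; rewrite (ext_val bg z1).
exists i, (smap_comp (fm F h) g2) => v.
apply: (@etrans _ _ (lan_in Hp (g1' v))).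
  rewrite -[RHS]E1; congr q; exact: epoint_eq.
rewrite (Eg2 v).
rewrite -(lan_in_eq (F := F) (plot_comp (incl oW WU) Hp) Hp (f := incl oW WU))//.
exact: (lan_in_eq (F := F) (plot_comp (incl oW WU) Hp) (Hc i) (f := h)).
Qed.

Lemma generates_lan_plots (F : functor EUCL EUCL) (X : dflg) :
  generates (Y := lan_ob F X)
    (fun i : plot_index X => lan_in (F := F) (svalP (projT2 i))).
Proof.
move=> Z q Hq z; have [A [oA [AZ [Az [U [p [Hp [g E]]]]]]]] := Hq z.
exists A, oA, AZ; split=> //; exists (existT _ U (exist _ p Hp)), g => v.
by rewrite E; exact: lan_in_ext.
Qed.

End Generators.

(** * Values of the structure maps on generators *)

Section Calculus.
Variable R : realType.
Local Notation eucl := (eucl R).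
Local Notation EUCL := (EUCL R).
Local Notation dflg := (dflg R).
Local Notation DFLG := (DFLG R).
Local Notation T := (dT R).

Lemma hom_congr (X Y : DFLG) (f g : hom X Y) (x : (X : dflg)) : f = g -> f ∙ x = g ∙ x.
Proof. by move->. Qed.

Lemma iso_invK (X Y : DFLG) (f : hom X Y) (fi : is_iso f) x : iso_inv fi ∙ (f ∙ x) = x.
Proof. by rewrite /iso_inv; case: cid => g [gf fg] /=; exact: (hom_congr x gf). Qed.

Lemma iso_invKr (X Y : DFLG) (f : hom X Y) (fi : is_iso f) y : f ∙ (iso_inv fi ∙ y) = y.
Proof. by rewrite /iso_inv; case: cid => g [gf fg] /=; exact: (hom_congr y fg). Qed.

Lemma isoP (X Y : DFLG) (f : hom X Y) (g : hom Y X) :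
  (forall x, g ∙ (f ∙ x) = x) -> (forall y, f ∙ (g ∙ y) = y) -> is_iso f.
Proof. by move=> gf fg; exists g; split; apply: dmap_eq. Qed.

Lemma fprod_ext (A B : dflg) (f : dmap A B) k (k0 : (0 < k)%N) (x y : fprod f k) :
  (forall i, fprod_pr f i x = fprod_pr f i y) -> x = y.
Proof.
move=> E; apply: fprod_eq => //; pose i := Ordinal k0.
rewrite /= -(svalP x i) -(svalP y i); congr (f _); exact: (E i).
Qed.

(** The computing rule for T of a structure map: typically [q] and [q'] are canonical plots such as
    [p, -], and [phi] is the Euclidean counterpart of [f]. *)
Lemma lan_map_in (F : functor EUCL EUCL) (X Y : dflg) (f : dmap X Y) (U V : eucl)
    (q : U -> X) (Hq : plot X q) (q' : V -> Y) (Hq' : plot Y q') (phi : smap U V) a :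
  (forall u, f (q u) = q' (phi u)) ->
  fmap (lan F) (f : hom (X : DFLG) Y) ∙ lan_in Hq a = lan_in Hq' (fm F phi a).
Proof.
move=> E; apply: etrans (lan_mapE f Hq a) _; exact: lan_in_eq.
Qed.

Lemma lan_map_in0 (F : functor EUCL EUCL) (X Y : dflg) (f : dmap X Y) (U : eucl)
    (q : U -> X) (Hq : plot X q) (q' : U -> Y) (Hq' : plot Y q') a :
  (forall u, f (q u) = q' u) ->
  fmap (lan F) (f : hom (X : DFLG) Y) ∙ lan_in Hq a = lan_in Hq' a.
Proof.
move=> E; apply: etrans (lan_mapE f Hq a) _; exact: lan_in_ext.
Qed.

Lemma lan_nt_natural (F G : functor EUCL EUCL) (al : nat_trans F G) :
  natural (F := lan F) (G := lan G) (lan_nt al).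
Proof.
move=> X Y f; apply: lan_desc_uniq => U p Hp a.
apply: etrans (congr1 (fun x => lan_nt al Y ∙ x) (lan_mapE f Hp a)) _.
apply: etrans (lan_ntE al (dmap_plot f Hp) a) _.
apply: esym.
apply: etrans (congr1 (fun x => fmap (lan G) f ∙ x) (lan_ntE al Hp a)) _.
exact: lan_mapE.
Qed.

Lemma lan_nt_naturalE (F G : functor EUCL EUCL) (al : nat_trans F G) (X Y : DFLG) (f : hom X Y) x :
  lan_nt al Y ∙ (fmap (lan F) f ∙ x) = fmap (lan G) f ∙ (lan_nt al X ∙ x).
Proof. exact: (hom_congr x (lan_nt_natural al f)). Qed.

Lemma dzeroE (X : dflg) (U : eucl) (p : U -> X) (Hp : plot X p) u :
  dzero X ∙ p u = tin Hp (zerohat_map U u).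
Proof.
rewrite /dzero dcompE.
(* Once [p u] is written as the image of [p, u] under [lan_id], the chosen inverse cancels. *)
have <- := lan_idE Hp u; rewrite iso_invK.
exact: (lan_ntE (zerohat R) Hp u).
Qed.

Lemma dtheta_pr k (X : dflg) (U : eucl) (p : U -> X) (Hp : plot X p) a i :
  dTpr i X ∙ (dtheta k X ∙ tkin k Hp a) = tin Hp (prhat_map i U a).
Proof. exact: (lan_ntE (prhat R i) Hp a). Qed.

Lemma dtheta_uniq k (k0 : (0 < k)%N) (X : dflg) (w : dTk R k X) (U : eucl) (p : U -> X)
    (Hp : plot X p) a :
  (forall i, dTpr i X ∙ w = tin Hp (prhat_map i U a)) ->
  w = dtheta k X ∙ tkin k Hp a.
Proof.
move=> E; apply: (fprod_ext k0) => i; apply: etrans (E i) _; apply: esym; exact: dtheta_pr.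
Qed.

Lemma dlamE (X : dflg) (U : eucl) (p : U -> X) (Hp : plot X p) a :
  dlam X ∙ tin Hp a =
  tin (tplot Hp) (lamhat_map U a).
Proof.
rewrite /dlam dcompE.
apply: etrans (congr1 (fun x => dtheta2 X ∙ x) (lan_ntE (lamhat R) Hp a)) _.
exact: (lan_desc_funE (F := functor_comp (That R) (That R)) (@lan_mu_compat R (That R) (That R) X)).
Qed.

Lemma dtheta2E (X : dflg) (U : eucl) (p : U -> X) (Hp : plot X p) a :
  dtheta2 X ∙ lan_in (F := functor_comp (That R) (That R)) Hp a = tin (tplot Hp) a.
Proof. exact: (lan_desc_funE (F := functor_comp (That R) (That R)) (@lan_mu_compat R (That R)
  (That R) X)). Qed.

Lemma dtauE (X : dflg) (eX : elastic X) (U : eucl) (p : U -> X) (Hp : plot X p) a :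
  dtau eX ∙ tin (tplot Hp) a = tin (tplot Hp) (tauhat_map U a).
Proof.
have E : dtau eX \oc dtheta2 X = dtheta2 X \oc lan_nt (tauhat R) X.
  by rewrite /dtau; case: cid.
rewrite -!dtheta2E; apply: etrans (hom_congr _ E) _.
rewrite dcompE; congr (_ ∙ _); exact: (lan_ntE (tauhat R) Hp a).
Qed.

Lemma dkappaE (X : dflg) (r : line R) (U : eucl) (p : U -> X) (Hp : plot X p) a :
  dkappa X ∙ (r, tin Hp a) =
  tin Hp (kappahat_map U (rho_inv_pt r a)).
Proof.
rewrite /dkappa dcompE -[(r, _)](iso_invKr (rho_iso X)) iso_invK.
have -> : iso_inv (rho_iso X) ∙ (r, tin Hp a) =
          lan_in (F := RThat R) Hp (rho_inv_pt r a).
  rewrite -[RHS](iso_invK (rho_iso X)); congr (_ ∙ _); apply: esym.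
  apply: etrans (rhoE Hp _) _; congr pair.
    by apply: epoint_eq; rewrite /= row_mxKl.
  by congr (lan_in _ _); apply: epoint_eq; rewrite /= row_mxKr.
exact: (lan_ntE (kappahat R) Hp).
Qed.

Lemma dplusE (X : dflg) (eX : elastic X) (U : eucl) (p : U -> X) (Hp : plot X p) a :
  dplus eX ∙ (dtheta 2 X ∙ tkin 2 Hp a) = tin Hp (plushat_map U a).
Proof. by rewrite /dplus dcompE iso_invK; exact: (lan_ntE (plushat R) Hp a). Qed.

Lemma dtheta_surj k (X : dflg) : is_iso (dtheta k X) -> forall w : dTk R k X,
  exists (U : eucl) (p : U -> X) (Hp : plot X p) (a : That_k_ob k U),
    w = dtheta k X ∙ tkin k Hp a.
Proof.
move=> ti w; rewrite -(iso_invKr ti w); elim/lan_ind: (_ ∙ w) => U p Hp a.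
by exists U, p, Hp, a.
Qed.

Lemma generates_T2 (X : dflg) :
  generates (Y := T (T X)) (fun i : plot_index X => lan_in (tplot (svalP (projT2 i)))).
Proof.
exact: (generates_lan (fun i : plot_index X => tplot (svalP (projT2 i))) (@That_local R)
  (@generates_lan_plots R (That R) X)).
Qed.

(** In view of [dtheta2E], this is the surjectivity of [dtheta2 X]. *)
Lemma T2_ind (X : dflg) (P : T (T X) -> Prop) :
  (forall (U : eucl) (p : U -> X) (Hp : plot X p) a, P (tin (tplot Hp) a)) -> forall x, P x.
Proof.
by move=> H; apply: (generates_ind (@generates_T2 X)) => -[U [p Hp]] a; exact: H.
Qed.

Lemma T3_ind (X : dflg) (P : T (T (T X)) -> Prop) :
  (forall (U : eucl) (p : U -> X) (Hp : plot X p) a, P (tin (tplot (tplot Hp)) a)) ->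
  forall x, P x.
Proof.
move=> H; apply: (generates_ind (generates_lan (fun i : plot_index X =>
  tplot (tplot (svalP (projT2 i)))) (@That_local R) (@generates_T2 X))).
by move=> [U [p Hp]] a; exact: H.
Qed.

End Calculus.

(** * Stability of elasticity under retracts *)

Definition retract (C : category) (Y X : C) := exists (i : hom Y X) (r : hom X Y), r \oc i = idm Y.

Lemma retract_refl (C : category) (X : C) : retract X X.
Proof. by exists (idm X), (idm X); rewrite comp_idl. Qed.

Lemma retract_trans (C : category) (Y X Z : C) : retract X Y -> retract Y Z -> retract X Z.
Proof.
move=> [i [r ri]] [j [s sj]]; exists (j \oc i), (r \oc s).
by rewrite comp_assoc -(comp_assoc r) sj comp_idr.
Qed.

Lemma retract_fmap (C D : category) (F : functor C D) (X Y : C) :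
  retract X Y -> retract (F X) (F Y).
Proof. by move=> [i [r ri]]; exists (fmap F i), (fmap F r); rewrite -fmap_comp ri fmap_id. Qed.

Section Retracts.
Variable R : realType.
Local Notation eucl := (eucl R).
Local Notation EUCL := (EUCL R).
Local Notation dflg := (dflg R).
Local Notation DFLG := (DFLG R).

Lemma fmap_compE (F : functor DFLG DFLG) (X Y Z : DFLG) (g : hom Y Z) (f : hom X Y) x :
  fmap F g ∙ (fmap F f ∙ x) = fmap F (g \oc f) ∙ x.
Proof. by rewrite fmap_comp. Qed.

Lemma fmap_retractK (F : functor DFLG DFLG) (X Y : DFLG) (r : hom X Y) (i : hom Y X) :
  r \oc i = idm Y -> forall x, fmap F r ∙ (fmap F i ∙ x) = x.
Proof. by move=> ri x; rewrite fmap_compE ri fmap_id. Qed.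

Lemma dtheta_natural k (k0 : (0 < k)%N) (X Y : DFLG) (f : hom X Y) x :
  dtheta k Y ∙ (fmap (lan (That_k R k)) f ∙ x) = fmap (dTk R k) f ∙ (dtheta k X ∙ x).
Proof.
elim/lan_ind: x => U p Hp a; apply: esym.
apply: etrans (dtheta_uniq k0 (Hp := dmap_plot (f : dmap _ _) Hp) (a := a) _) _.
  move=> i; apply: etrans (congr1 (fun x => fmap (dT R) f ∙ x) (dtheta_pr Hp a i)) _.
  exact: (lan_mapE f Hp).
congr (_ ∙ _); apply: esym; exact: (lan_mapE f Hp).
Qed.

Lemma dtheta2_natural (X Y : DFLG) (f : hom X Y) x :
  dtheta2 Y ∙ (fmap (lan (functor_comp (That R) (That R))) f ∙ x) =
  fmap (dT R) (fmap (dT R) f) ∙ (dtheta2 X ∙ x).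
Proof.
elim/lan_ind: x => U p Hp a; apply: esym.
apply: etrans (congr1 (fun x => fmap (dT R) (fmap (dT R) f) ∙ x) (dtheta2E Hp a)) _.
apply: etrans (lan_map_in0 _ (tplot (dmap_plot (f : dmap _ _) Hp)) _ _) _.
  by move=> u; exact: (lan_mapE f Hp).
apply: esym; apply: etrans (dtheta2E (dmap_plot (f : dmap _ _) Hp) a).
by congr (_ ∙ _); exact: (lan_mapE f Hp).
Qed.

Lemma dlam_natural (X Y : DFLG) (f : hom X Y) x :
  dlam Y ∙ (fmap (dT R) f ∙ x) = fmap (dT R) (fmap (dT R) f) ∙ (dlam X ∙ x).
Proof.
apply: etrans (congr1 (fun x => dtheta2 Y ∙ x) (hom_congr x (lan_nt_natural (lamhat R) f))) _.
exact: dtheta2_natural.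
Qed.

Lemma dnu_injP k (k0 : (0 < k)%N) (X : dflg) : injective (dnu k X : dmap _ _) <->
  forall x y : dT R (dTk R k X),
    (forall i : 'I_k, fmap (dT R) (dTpr i X) ∙ x = fmap (dT R) (dTpr i X) ∙ y) -> x = y.
Proof.
split=> [inj x y E|inj x y E].
  by apply: inj; apply: (fprod_ext k0) => i; exact: E.
by apply: inj => i; exact: (congr1 (fprod_pr (fmap (dT R) (dpi X) : dmap _ _) i) E).
Qed.

(** The maps theta, theta2 and lambda are natural in all diffeological maps. Conjugating with [i]
    and [r] thus transports the inverse of theta and the map tau from X to Y, while injectivity and
    the induction property are inherited along the split monomorphisms induced by [i]. *)
Lemma elastic_axioms_retract (X Y : DFLG) :
  retract Y X -> elastic_axioms X -> elastic_axioms Y.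
Proof.
move=> [i [r ri]] [E1 [tau Etau] [lam_inj lam_plot] E4].
have ltn_pred k : (1 < k)%N -> (0 < k)%N by case: k.
split.
- move=> k k1; have k0 := ltn_pred _ k1; have ti := E1 _ k1.
  apply: (isoP (g := fmap (lan (That_k R k)) r \oc iso_inv ti \oc fmap (dTk R k) i)) => x;
    rewrite !dcompE.
    rewrite -(dtheta_natural k0) iso_invK; exact: fmap_retractK.
  rewrite (dtheta_natural k0) iso_invKr; exact: fmap_retractK.
- exists (fmap (dT R) (fmap (dT R) r) \oc tau \oc fmap (dT R) (fmap (dT R) i)).
  apply: dmap_eq => x; rewrite !dcompE -dtheta2_natural.
  set y := fmap (lan _) i ∙ x.
  have := hom_congr y Etau; rewrite !dcompE => ->.
  rewrite -dtheta2_natural; congr (_ ∙ _).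
  apply: etrans (esym (hom_congr y (lan_nt_natural (tauhat R) r))) _.
  rewrite dcompE; congr (_ ∙ _); exact: (fmap_retractK (F := lan _)).
- split=> [x y E|U p Hp].
    rewrite -(fmap_retractK (F := dT R) ri x) -(fmap_retractK (F := dT R) ri y); congr (_ ∙ _).
    by apply: lam_inj; rewrite !dlam_natural E.
  (* Since [p] is T r after T i after [p], it suffices that T i after [p] is a plot of TX, which can
     be tested after lambda. *)
  rewrite (_ : p = (fmap (dT R) r : dmap _ _) \o ((fmap (dT R) i : dmap _ _) \o p)).
    apply: dmap_plot; apply: lam_plot.
    have := dmap_plot (fmap (dT R) (fmap (dT R) i) : dmap _ _) Hp.
    rewrite (_ : _ \o _ = (dlam X : dmap _ _) \o ((fmap (dT R) i : dmap _ _) \o p))//.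
    by apply/funext => u; exact: (esym (dlam_natural i (p u))).
  by apply/funext => u; exact: (esym (fmap_retractK (F := dT R) ri (p u))).
- move=> k k1; have k0 := ltn_pred _ k1; apply/(dnu_injP k0) => x y E.
  rewrite -(fmap_retractK (F := functor_comp (dT R) (dTk R k)) ri x).
  rewrite -(fmap_retractK (F := functor_comp (dT R) (dTk R k)) ri y); congr (_ ∙ _).
  apply: (dnu_injP k0 X).1 (E4 _ k1) _ _ _ => j.
  have N z : fmap (dT R) (dTpr j X) ∙ (fmap (functor_comp (dT R) (dTk R k)) i ∙ z) =
    fmap (dT R) (fmap (dT R) i) ∙ (fmap (dT R) (dTpr j Y) ∙ z).
    rewrite -[LHS]/(fmap (dT R) (dTpr j X) ∙ (fmap (dT R) (fmap (dTk R k) i) ∙ z)) !fmap_compE.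
    by congr (fmap (dT R) _ ∙ _); exact: dmap_eq.
  by rewrite !N E.
Qed.

Lemma elastic_retract (X Y : DFLG) : retract Y X -> elastic X -> elastic Y.
Proof.
move=> YX [aX aTX]; split; first exact: elastic_axioms_retract YX aX.
move=> ks ks0; apply: elastic_axioms_retract (aTX ks ks0).
by elim: ks {ks0} => //= k ks IH; exact: (retract_fmap (dTk R k) IH).
Qed.

(** (E5) speaks of [dTk R 1 X], which carries an additional base component and so is not literally
    [dT R X]. *)
Lemma elastic_T (X : DFLG) : elastic X -> elastic (dT R X).
Proof.
move=> eX; apply: elastic_retract (elastic_Tk (isT : (0 < 1)%N) eX).
have E (i : 'I_1) (z : dT R X) : dpi X ∙ z = dpi X ∙ z by [].
exists (fprod_lift (f := dpi X : dmap _ _) (k := 1) (a := fun=> idm (dT R X : DFLG)) (b := dpi X)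
  E : hom (_ : DFLG) (dTk R 1 X)).
by exists (dTpr ord0 X); exact: dmap_eq.
Qed.

End Retracts.

(** * Stability of elasticity under products *)

Section EuclideanProducts.
Variable R : realType.
Local Notation eucl := (eucl R).
Local Notation EUCL := (EUCL R).

Definition efst (U V : eucl) : smap (eprod U V) U :=
  @mk_smap R (eprod U V) U lsubmx (fun w Uw => Uw.1) (smooth_on_linear (@lsubmx_linear _ _ _)).

Definition esnd (U V : eucl) : smap (eprod U V) V :=
  @mk_smap R (eprod U V) V rsubmx (fun w Uw => Uw.2) (smooth_on_linear (@rsubmx_linear _ _ _)).

Section Pairing.
Variables (W U V : eucl).

Lemma epair_mem (u : U) (v : V) : edom (eprod U V) (row_mx (sval u) (sval v)).
Proof. by split; rewrite ?row_mxKl ?row_mxKr; exact: svalP. Qed.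

Definition epair_pt (u : U) (v : V) : eprod U V := exist _ _ (epair_mem u v).

Lemma efst_pair u v : efst U V (epair_pt u v) = u.
Proof. by apply: epoint_eq; rewrite /= row_mxKl. Qed.

Lemma esnd_pair u v : esnd U V (epair_pt u v) = v.
Proof. by apply: epoint_eq; rewrite /= row_mxKr. Qed.

Lemma epair_smooth (f : smap W U) (g : smap W V) :
  smooth_on (edom W) (ext (fun w => epair_pt (f w) (g w))).
Proof.
have := smooth_on_row_mx (edom_open W) (smap_smooth f) (smap_smooth g).
apply: smooth_on_eq; first exact: edom_open.
move=> x /set_mem Wx; rewrite (ext_val f (exist _ x Wx)) (ext_val g (exist _ x Wx)).
by rewrite (ext_val (fun w => epair_pt (f w) (g w)) (exist _ x Wx)).
Qed.

Definition epair (f : smap W U) (g : smap W V) : smap W (eprod U V) := SMap (epair_smooth f g).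
End Pairing.

Definition eprod_map (U V U' V' : eucl) (f : smap U U') (g : smap V V') :
    smap (eprod U V) (eprod U' V') :=
  epair (smap_comp f (efst U V)) (smap_comp g (esnd U V)).

Lemma fm_comp (F : functor EUCL EUCL) (U V W : eucl) (g : smap V W) (f : smap U V) a :
  fm F g (fm F f a) = fm F (smap_comp g f) a.
Proof. by have /= -> := fmap_comp F (g : hom (V : EUCL) W) (f : hom (U : EUCL) V). Qed.

Lemma fm_eq (F : functor EUCL EUCL) (U V : eucl) (f g : smap U V) a :
  (forall u, f u = g u) -> fm F f a = fm F g a.
Proof. by move=> E; have -> : f = g by apply: smap_eq => u; rewrite E. Qed.

Lemma fm_id (F : functor EUCL EUCL) (U : eucl) (f : smap U U) a :
  (forall u, f u = u) -> fm F f a = a.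
Proof.
move=> E; rewrite (fm_eq a (g := smap_id U))//.
by have /= -> := fmap_id F (U : EUCL).
Qed.

(** The canonical map from F(U x V) to FU x FV is an isomorphism with smooth inverse [pp_pair];
    [pp_inj] stands in for the second inverse law, in the form in which equalities of points are
    checked. *)
Record preserves_products (F : functor EUCL EUCL) := PreservesProducts {
  pp_pair : forall U V : eucl, smap (eprod (F U : eucl) (F V : eucl)) (F (eprod U V));
  pp_fst : forall U V c, fm F (efst U V) (pp_pair U V c) = efst _ _ c;
  pp_snd : forall U V c, fm F (esnd U V) (pp_pair U V c) = esnd _ _ c;
  pp_inj : forall (U V : eucl) (c c' : (F (eprod U V) : eucl)),
    fm F (efst U V) c = fm F (efst U V) c' -> fm F (esnd U V) c = fm F (esnd U V) c' -> c = c' }.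

Section ThatProducts.
Variables (U V : eucl).

Definition That_pair_fun (w : 'rV[R]_((edim U + edim U) + (edim V + edim V))) :
    'rV[R]_((edim U + edim V) + (edim U + edim V)) :=
  row_mx (row_mx (lsubmx (lsubmx w)) (lsubmx (rsubmx w)))
         (row_mx (rsubmx (lsubmx w)) (rsubmx (rsubmx w))).

Lemma That_pair_mem w : edom (eprod (That_ob U) (That_ob V)) w ->
  edom (That_ob (eprod U V)) (That_pair_fun w).
Proof.
by move=> [[Uw _] [Vw _]]; split=> //=; rewrite row_mxKl; split; rewrite ?row_mxKl ?row_mxKr.
Qed.

Lemma That_pair_linear : linear That_pair_fun.
Proof. by move=> a x y; rewrite /That_pair_fun !linearP !scale_row_mx !add_row_mx. Qed.

Definition That_pair : smap (eprod (That_ob U) (That_ob V)) (That_ob (eprod U V)) :=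
  mk_smap That_pair_mem (smooth_on_linear That_pair_linear).

Variable k : nat.

Definition That_k_pair_fun (w : 'rV[R]_((edim U + k * edim U) + (edim V + k * edim V))) :
    'rV[R]_((edim U + edim V) + k * (edim U + edim V)) :=
  row_mx (row_mx (lsubmx (lsubmx w)) (lsubmx (rsubmx w)))
         (mxvec (row_mx (vec_mx (rsubmx (lsubmx w))) (vec_mx (rsubmx (rsubmx w))))).

Lemma That_k_pair_mem w : edom (eprod (That_k_ob k U) (That_k_ob k V)) w ->
  edom (That_k_ob k (eprod U V)) (That_k_pair_fun w).
Proof.
by move=> [[Uw _] [Vw _]]; split=> //=; rewrite row_mxKl; split; rewrite ?row_mxKl ?row_mxKr.
Qed.

Lemma That_k_pair_linear : linear That_k_pair_fun.
Proof.
apply: row_mx_linear => a x y; first by rewrite !linearP scale_row_mx add_row_mx.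
rewrite -[RHS](linearP mxvec) scale_row_mx add_row_mx; congr (mxvec (row_mx _ _)).
  by rewrite !linearP.
by rewrite !linearP.
Qed.

Definition That_k_pair : smap (eprod (That_k_ob k U) (That_k_ob k V)) (That_k_ob k (eprod U V)) :=
  mk_smap That_k_pair_mem (smooth_on_linear That_k_pair_linear).
End ThatProducts.

Lemma That_fstE (U V : eucl) (w : That_ob (eprod U V)) :
  sval (fm (That R) (efst U V) w) = row_mx (lsubmx (lsubmx (sval w))) (lsubmx (rsubmx (sval w))).
Proof. by rewrite (@That_linear R (eprod U V) U (efst U V) _ w (@lsubmx_linear _ _ _)). Qed.

Lemma That_sndE (U V : eucl) (w : That_ob (eprod U V)) :
  sval (fm (That R) (esnd U V) w) = row_mx (rsubmx (lsubmx (sval w))) (rsubmx (rsubmx (sval w))).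
Proof. by rewrite (@That_linear R (eprod U V) V (esnd U V) _ w (@rsubmx_linear _ _ _)). Qed.

Lemma That_products : preserves_products (That R).
Proof.
apply: (@PreservesProducts (That R) (@That_pair)) => U V c.
- apply: epoint_eq; rewrite That_fstE /= /That_pair_fun !row_mxKl row_mxKr row_mxKl; exact: hsubmxK.
- apply: epoint_eq; rewrite That_sndE /= /That_pair_fun row_mxKl !row_mxKr; exact: hsubmxK.
move=> c' /(congr1 sval); rewrite !That_fstE => /eq_row_mx[E1 E2].
move=> /(congr1 sval); rewrite !That_sndE => /eq_row_mx[E3 E4]; apply: epoint_eq.
rewrite -[LHS]hsubmxK -[RHS]hsubmxK -[lsubmx (sval c)]hsubmxK -[rsubmx (sval c)]hsubmxK.
by rewrite E1 E2 E3 E4 !hsubmxK.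
Qed.

Lemma That_k_fstE k (U V : eucl) (w : That_k_ob k (eprod U V)) :
  sval (fm (That_k R k) (efst U V) w) =
  row_mx (lsubmx (lsubmx (sval w))) (mxvec (lsubmx (vec_mx (rsubmx (sval w)) : 'M_(k, edim U +
    edim V)))).
Proof.
rewrite (@That_k_linear R k (eprod U V) U (efst U V) _ w (@lsubmx_linear _ _ _))//.
congr row_mx; apply: (congr1 mxvec); apply/row_matrixP => i; rewrite rowK; apply/rowP => j.
by rewrite !mxE.
Qed.

Lemma That_k_sndE k (U V : eucl) (w : That_k_ob k (eprod U V)) :
  sval (fm (That_k R k) (esnd U V) w) =
  row_mx (rsubmx (lsubmx (sval w))) (mxvec (rsubmx (vec_mx (rsubmx (sval w)) : 'M_(k, edim U +
    edim V)))).
Proof.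
rewrite (@That_k_linear R k (eprod U V) V (esnd U V) _ w (@rsubmx_linear _ _ _))//.
congr row_mx; apply: (congr1 mxvec); apply/row_matrixP => i; rewrite rowK; apply/rowP => j.
by rewrite !mxE.
Qed.

Lemma That_k_products k : preserves_products (That_k R k).
Proof.
apply: (@PreservesProducts (That_k R k) (fun U V => That_k_pair U V k)) => U V c.
- apply: epoint_eq; rewrite That_k_fstE /= /That_k_pair_fun !row_mxKl row_mxKr mxvecK row_mxKl.
  by rewrite vec_mxK; exact: hsubmxK.
- apply: epoint_eq; rewrite That_k_sndE /= /That_k_pair_fun row_mxKl !row_mxKr mxvecK row_mxKr.
  by rewrite vec_mxK; exact: hsubmxK.
move=> c' /(congr1 sval); rewrite !That_k_fstE => /eq_row_mx[E1 /(can_inj mxvecK) E2].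
move=> /(congr1 sval); rewrite !That_k_sndE => /eq_row_mx[E3 /(can_inj mxvecK) E4].
apply: epoint_eq; rewrite -[LHS]hsubmxK -[RHS]hsubmxK; congr row_mx.
  by rewrite -[LHS]hsubmxK -[RHS]hsubmxK E1 E3.
by apply: (can_inj vec_mxK); rewrite -[LHS]hsubmxK -[RHS]hsubmxK E2 E4.
Qed.
End EuclideanProducts.

(** * Kan extensions of product-preserving functors *)

Section KanProducts.
Variable R : realType.
Local Notation eucl := (eucl R).
Local Notation EUCL := (EUCL R).
Local Notation dflg := (dflg R).
Local Notation DFLG := (DFLG R).
Variables (F : functor EUCL EUCL) (PF : preserves_products F) (X Y : dflg).

Definition lan_split : hom (lan F (dprod X Y)) (dprod (lan_ob F X) (lan_ob F Y) : DFLG) :=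
  dpair (fmap (lan F) (dfst X Y : hom (dprod X Y : DFLG) X) : dmap _ _)
        (fmap (lan F) (dsnd X Y : hom (dprod X Y : DFLG) Y) : dmap _ _).

Lemma prod_plot (U V : eucl) (p : U -> X) (q : V -> Y) : plot X p -> plot Y q ->
  plot (dprod X Y) (fun w : eprod U V => (p (efst U V w), q (esnd U V w))).
Proof. by move=> Hp Hq; split;
  [exact: (plot_comp (efst U V) Hp)|exact: (plot_comp (esnd U V) Hq)]. Qed.

Definition lan_pair_pre (a : lan_pre F X) (b : lan_pre F Y) : lan_ob F (dprod X Y) :=
  lan_in (F := F) (prod_plot (lp_isplot a) (lp_isplot b)) (pp_pair PF _ _ (epair_pt (lp_pt a)
    (lp_pt b))).

(** A step f in the first variable induces the step f x id between the product plots; that it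
    matches the paired points is checked on the two projections. *)
Lemma lan_pair_prel a a' b : lan_step a a' -> lan_pair_pre a b = lan_pair_pre a' b.
Proof.
case: a a' b => [U p Hp u] [U' p' Hp' u'] [V q Hq v] [f [/= E ->]].
rewrite /lan_pair_pre /=.
apply: etrans (lan_in_eq (F := F) _ (prod_plot Hp' Hq) (f := eprod_map f (smap_id V)) _ _) _.
  by move=> w; rewrite E efst_pair esnd_pair.
congr (lan_in _ _); apply: (pp_inj PF).
  rewrite fm_comp pp_fst efst_pair (fm_eq _ (g := smap_comp f (efst U V))) => [|w].
    by rewrite -fm_comp pp_fst efst_pair.
  exact: efst_pair.
rewrite fm_comp pp_snd esnd_pair (fm_eq _ (g := esnd U V)) ?pp_snd ?esnd_pair// => w.
exact: esnd_pair.
Qed.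

Lemma lan_pair_prer a b b' : lan_step b b' -> lan_pair_pre a b = lan_pair_pre a b'.
Proof.
case: b b' a => [U p Hp u] [U' p' Hp' u'] [V q Hq v] [f [/= E ->]].
rewrite /lan_pair_pre /=.
apply: etrans (lan_in_eq (F := F) _ (prod_plot Hq Hp') (f := eprod_map (smap_id V) f) _ _) _.
  by move=> w; rewrite E efst_pair esnd_pair.
congr (lan_in _ _); apply: (pp_inj PF).
  rewrite fm_comp pp_fst efst_pair (fm_eq _ (g := efst V U)) ?pp_fst ?efst_pair// => w.
  exact: efst_pair.
rewrite fm_comp pp_snd esnd_pair (fm_eq _ (g := smap_comp f (esnd V U))) => [|w].
  by rewrite -fm_comp pp_snd esnd_pair.
exact: esnd_pair.
Qed.

(** The two variables descend to the quotients one after the other, so that compatibility is only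
    ever checked with the other representative fixed. *)
Definition lan_pair_fun (z : dprod (lan_ob F X) (lan_ob F Y)) : lan_ob F (dprod X Y) :=
  quot_lift (r := @lan_step R F X)
    (fun a => quot_lift (r := @lan_step R F Y) (lan_pair_pre a) z.2) z.1.

Lemma lan_pair_funE (U V : eucl) (p : U -> X) (Hp : plot X p) (q : V -> Y) (Hq : plot Y q) a b :
  lan_pair_fun (lan_in (F := F) Hp a, lan_in (F := F) Hq b) =
  lan_in (F := F) (prod_plot Hp Hq) (pp_pair PF _ _ (epair_pt a b)).
Proof.
rewrite /lan_pair_fun quot_liftE => [|c c' cc'] /=.
  by rewrite quot_liftE// => c c'; exact: lan_pair_prer.
by congr (quot_lift _ _); apply/funext => d; exact: lan_pair_prel.
Qed.

Lemma lan_pair_plot (Z : eucl) (q : Z -> dprod (lan_ob F X) (lan_ob F Y)) :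
  plot (dprod (lan_ob F X) (lan_ob F Y)) q -> plot (lan_ob F (dprod X Y)) (lan_pair_fun \o q).
Proof.
move=> [q1 q2]; apply: plot_local => z.
have [A [oA [AZ [Az [U [p [Hp [g E]]]]]]]] := q1 z.
have [B [oB [BZ [Bz [V [r [Hr [h E']]]]]]]] := q2 z.
have ABZ : A `&` B `<=` edom Z by move=> x [/AZ].
exists (A `&` B), (openI oA oB), ABZ; split=> //.
pose g' := smap_comp g (@incl R (restr oA) _ (openI oA oB) (@subIsetl _ A B)).
pose h' := smap_comp h (@incl R (restr oB) _ (openI oA oB) (@subIsetr _ A B)).
have := plot_comp (smap_comp (pp_pair PF U V) (epair g' h')) (lan_in_plot (F := F) (prod_plot Hp
  Hr)).
congr (plot _ _); apply/funext => v /=.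
rewrite -lan_pair_funE; congr lan_pair_fun.
rewrite [RHS]surjective_pairing; congr pair.
  by rewrite -E; congr (q _).1; exact: epoint_eq.
by rewrite -E'; congr (q _).2; exact: epoint_eq.
Qed.

Definition lan_pair : hom (dprod (lan_ob F X) (lan_ob F Y) : DFLG) (lan F (dprod X Y)) :=
  DMap lan_pair_plot.

Lemma lan_splitK z : lan_pair ∙ (lan_split ∙ z) = z.
Proof.
elim/lan_ind: z => U p Hp a.
have -> : lan_split ∙ lan_in (F := F) Hp a =
    (lan_in (F := F) (dmap_plot (dfst X Y) Hp) a, lan_in (F := F) (dmap_plot (dsnd X Y) Hp) a).
  by rewrite /lan_split; congr pair; exact: lan_mapE.
apply: etrans (lan_pair_funE _ _ _ _) _; apply: esym.
(* Splitting and pairing [p, a] leads to a plot on U x U; the diagonal of U is the step back to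
   [p]. *)
apply: etrans (lan_in_eq (F := F) Hp (prod_plot (dmap_plot (dfst X Y) Hp) (dmap_plot (dsnd X Y) Hp))
  (f := epair (smap_id U) (smap_id U)) a _) _.
  by move=> u; rewrite efst_pair esnd_pair /=; case: (p u).
congr (lan_in _ _); apply: (pp_inj PF); rewrite fm_comp.
  by rewrite pp_fst efst_pair fm_id// => u; exact: efst_pair.
by rewrite pp_snd esnd_pair fm_id// => u; exact: esnd_pair.
Qed.

Lemma lan_pairK z : lan_split ∙ (lan_pair ∙ z) = z.
Proof.
case: z => z; elim/lan_ind: z => U p Hp a z; elim/lan_ind: z => V q Hq b.
have -> : lan_pair ∙ (lan_in (F := F) Hp a, lan_in (F := F) Hq b) =
  lan_in (F := F) (prod_plot Hp Hq) (pp_pair PF _ _ (epair_pt a b)) by exact: lan_pair_funE.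
apply: (@congr2 _ _ _ pair).
  apply: etrans (lan_map_in (F := F) _ Hp (phi := efst U V) _ _) _ => //.
  by rewrite pp_fst efst_pair.
apply: etrans (lan_map_in (F := F) _ Hq (phi := esnd U V) _ _) _ => //.
by rewrite pp_snd esnd_pair.
Qed.

Lemma lan_split_inj (z z' : lan F (dprod X Y)) :
  fmap (lan F) (dfst X Y : hom (dprod X Y : DFLG) X) ∙ z =
  fmap (lan F) (dfst X Y : hom (dprod X Y : DFLG) X) ∙ z' ->
  fmap (lan F) (dsnd X Y : hom (dprod X Y : DFLG) Y) ∙ z =
  fmap (lan F) (dsnd X Y : hom (dprod X Y : DFLG) Y) ∙ z' -> z = z'.
Proof. by move=> E1 E2; rewrite -(lan_splitK z) -(lan_splitK z'); congr (_ ∙ _); congr pair. Qed.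

End KanProducts.

Section ElasticProducts.
Variable R : realType.
Local Notation eucl := (eucl R).
Local Notation EUCL := (EUCL R).
Local Notation dflg := (dflg R).
Local Notation DFLG := (DFLG R).
Local Notation T := (dT R).
Local Notation That2 := (functor_comp (That R) (That R)).

Section Pair.
Variables X Y : dflg.
Local Notation XY := (dprod X Y : DFLG).
Local Notation fstm := (dfst X Y : hom XY X).
Local Notation sndm := (dsnd X Y : hom XY Y).

Lemma lan_pair_fst (F : functor EUCL EUCL) (PF : preserves_products F) z :
  fmap (lan F) fstm ∙ (lan_pair PF X Y ∙ z) = z.1.
Proof. exact: (congr1 fst (lan_pairK PF z)). Qed.

Lemma lan_pair_snd (F : functor EUCL EUCL) (PF : preserves_products F) z :
  fmap (lan F) sndm ∙ (lan_pair PF X Y ∙ z) = z.2.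
Proof. exact: (congr1 snd (lan_pairK PF z)). Qed.

(** By the hypothesis, Z is a retract of the product by means of (f, g), and T preserves both
    retracts and products. The lemma serves for Z = T(X x Y) and Z = T_k(X x Y), which are products
    only up to the pairing maps. *)
Lemma T_jointly_injective (Z : DFLG) (f : hom Z X) (g : hom Z Y) (h : hom XY Z) :
  (forall z, h ∙ (f ∙ z, g ∙ z) = z) -> forall z z' : T Z,
  fmap T f ∙ z = fmap T f ∙ z' -> fmap T g ∙ z = fmap T g ∙ z' -> z = z'.
Proof.
move=> hK z z' Ef Eg; pose fg : hom Z XY := dpair (f : dmap _ _) (g : dmap _ _).
have hfg : h \oc fg = idm Z by exact: dmap_eq.
rewrite -(fmap_retractK (F := T) hfg z) -(fmap_retractK (F := T) hfg z'); congr (_ ∙ _).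
have E1 : fstm \oc fg = f by exact: dmap_eq.
have E2 : sndm \oc fg = g by exact: dmap_eq.
by apply: (lan_split_inj (That_products R)); rewrite !fmap_compE ?E1 ?E2.
Qed.

Lemma T_split_inj (z z' : T XY) :
  fmap T fstm ∙ z = fmap T fstm ∙ z' -> fmap T sndm ∙ z = fmap T sndm ∙ z' -> z = z'.
Proof. exact: (lan_split_inj (That_products R)). Qed.

Lemma dpi_pair z : dpi XY ∙ (lan_pair (That_products R) X Y ∙ z) = (dpi X ∙ z.1, dpi Y ∙ z.2).
Proof.
set w := lan_pair _ _ _ ∙ z; rewrite [LHS]surjective_pairing.
have Ef := hom_congr w (dpi_natural fstm); have Eg := hom_congr w (dpi_natural sndm).
have Wf : fmap T fstm ∙ w = z.1 := lan_pair_fst (That_products R) z.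
have Wg : fmap T sndm ∙ w = z.2 := lan_pair_snd (That_products R) z.
by rewrite dcompE Wf in Ef; rewrite dcompE Wg in Eg; congr pair; rewrite ?Ef ?Eg.
Qed.
End Pair.

Section PairT.
Variables X Y : dflg.
Local Notation XY := (dprod X Y : DFLG).
Local Notation fstm := (dfst X Y : hom XY X).
Local Notation sndm := (dsnd X Y : hom XY Y).

Lemma T2_split_inj (z z' : T (T XY)) :
  fmap T (fmap T fstm) ∙ z = fmap T (fmap T fstm) ∙ z' ->
  fmap T (fmap T sndm) ∙ z = fmap T (fmap T sndm) ∙ z' -> z = z'.
Proof.
apply: (T_jointly_injective (h := lan_pair (That_products R) X Y)).
exact: (lan_splitK (That_products R)).
Qed.

Definition T2_pair : hom (dprod (T (T X)) (T (T Y)) : DFLG) (T (T XY)) :=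
  fmap T (lan_pair (That_products R) X Y) \oc lan_pair (That_products R) (T X) (T Y).

Lemma T2_pair_fst z : fmap T (fmap T fstm) ∙ (T2_pair ∙ z) = z.1.
Proof.
rewrite dcompE fmap_compE.
have -> : fmap T fstm \oc lan_pair (That_products R) X Y = (dfst (T X) (T Y) : hom (dprod (T X)
  (T Y) : DFLG) (T X)).
  by apply: dmap_eq => y; exact: lan_pair_fst.
exact: lan_pair_fst.
Qed.

Lemma T2_pair_snd z : fmap T (fmap T sndm) ∙ (T2_pair ∙ z) = z.2.
Proof.
rewrite dcompE fmap_compE.
have -> : fmap T sndm \oc lan_pair (That_products R) X Y = (dsnd (T X) (T Y) : hom (dprod (T X)
  (T Y) : DFLG) (T Y)).
  by apply: dmap_eq => y; exact: lan_pair_snd.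
exact: lan_pair_snd.
Qed.

Section Power.
Variables (k : nat) (k0 : (0 < k)%N).

Lemma dTk_split_inj (z z' : dTk R k XY) :
  fmap (dTk R k) fstm ∙ z = fmap (dTk R k) fstm ∙ z' ->
  fmap (dTk R k) sndm ∙ z = fmap (dTk R k) sndm ∙ z' -> z = z'.
Proof.
move=> E1 E2; apply: (fprod_ext k0) => i; apply: T_split_inj.
  exact: (congr1 (fun w => dTpr i X ∙ w) E1).
exact: (congr1 (fun w => dTpr i Y ∙ w) E2).
Qed.

Lemma dTk_pair_subproof (i : 'I_k) (z : dprod (dTk R k X) (dTk R k Y)) :
  dpi XY ∙ (lan_pair (That_products R) X Y ∙ (dTpr i X ∙ z.1, dTpr i Y ∙ z.2)) =
  (fprod_base (dpi X : dmap _ _) k z.1, fprod_base (dpi Y : dmap _ _) k z.2).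
Proof. by rewrite dpi_pair; congr pair; [exact: (svalP z.1)|exact: (svalP z.2)]. Qed.

Definition dTk_pair : hom (dprod (dTk R k X) (dTk R k Y) : DFLG) (dTk R k XY) :=
  fprod_lift (f := dpi XY : dmap _ _)
    (b := dpair (dmap_comp (fprod_base (dpi X : dmap _ _) k) (dfst _ _))
                (dmap_comp (fprod_base (dpi Y : dmap _ _) k) (dsnd _ _)))
    (a := fun i => dmap_comp (lan_pair (That_products R) X Y : dmap _ _)
       (dpair (dmap_comp (dTpr i X : dmap _ _) (dfst _ _)) (dmap_comp (dTpr i Y : dmap _ _) (dsnd
         _ _))))
    dTk_pair_subproof.

Lemma dTk_pairK z : dTk_pair ∙ (fmap (dTk R k) fstm ∙ z, fmap (dTk R k) sndm ∙ z) = z.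
Proof.
apply: (fprod_ext k0) => i; exact: (lan_splitK (That_products R) (dTpr i XY ∙ z)).
Qed.
End Power.
End PairT.

(** By naturality, the structure maps of X x Y are governed by their images under the two
    projections: inverses and tau are obtained by pairing those of X and Y, and each equality or
    injectivity is tested in the two factors. *)
Lemma elastic_axioms_prod (X Y : DFLG) :
  elastic_axioms X -> elastic_axioms Y -> elastic_axioms (dprod X Y).
Proof.
pose XY : DFLG := dprod X Y; pose f : hom XY X := dfst X Y; pose g : hom XY Y := dsnd X Y.
move=> [E1X [tauX EtauX] [lamX plamX] E4X] [E1Y [tauY EtauY] [lamY plamY] E4Y].
have ltn_pred k : (1 < k)%N -> (0 < k)%N by case: k.
split.
- move=> k k1; have k0 := ltn_pred _ k1; have tX := E1X _ k1; have tY := E1Y _ k1.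
  pose h : hom (dTk R k XY) (dprod (lan (That_k R k) X) (lan (That_k R k) Y)) :=
    dpair (iso_inv tX \oc fmap (dTk R k) f : dmap _ _) (iso_inv tY \oc fmap (dTk R k) g : dmap _ _).
  apply: (isoP (g := lan_pair (That_k_products R k) X Y \oc h)) => z; rewrite dcompE.
    rewrite -[RHS](lan_splitK (That_k_products R k)); congr (_ ∙ _); congr pair.
      by rewrite dcompE -(dtheta_natural k0) iso_invK.
    by rewrite dcompE -(dtheta_natural k0) iso_invK.
  apply: (dTk_split_inj k0); rewrite -(dtheta_natural k0).
    apply: etrans (congr1 (fun w => dtheta k X ∙ w) (lan_pair_fst _ (h ∙ z))) _.
    exact: iso_invKr.
  apply: etrans (congr1 (fun w => dtheta k Y ∙ w) (lan_pair_snd _ (h ∙ z))) _.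
  exact: iso_invKr.
- pose h : hom (T (T XY)) (dprod (T (T X)) (T (T Y))) :=
    dpair (tauX \oc fmap T (fmap T f) : dmap _ _) (tauY \oc fmap T (fmap T g) : dmap _ _).
  have tauXE y : tauX ∙ (dtheta2 X ∙ y) = dtheta2 X ∙ (lan_nt (tauhat R) X ∙ y).
    exact: (hom_congr y EtauX).
  have tauYE y : tauY ∙ (dtheta2 Y ∙ y) = dtheta2 Y ∙ (lan_nt (tauhat R) Y ∙ y).
    exact: (hom_congr y EtauY).
  exists (T2_pair X Y \oc h); apply: dmap_eq => x; rewrite !dcompE.
  apply: T2_split_inj; rewrite ?T2_pair_fst ?T2_pair_snd -!dtheta2_natural.
    by rewrite -lan_nt_naturalE -tauXE dtheta2_natural.
  by rewrite -lan_nt_naturalE -tauYE dtheta2_natural.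
- split=> [x y E|U p Hp].
    apply: T_split_inj; [apply: lamX|apply: lamY].
      by have := congr1 (fun w => fmap T (fmap T f) ∙ w) E; rewrite -!dlam_natural.
    by have := congr1 (fun w => fmap T (fmap T g) ∙ w) E; rewrite -!dlam_natural.
  have Hf : plot (T X) ((fmap T f : dmap _ _) \o p).
    apply: plamX; have := dmap_plot (fmap T (fmap T f) : dmap _ _) Hp.
    by congr (plot _ _); apply/funext => u; exact: (esym (dlam_natural f (p u))).
  have Hg : plot (T Y) ((fmap T g : dmap _ _) \o p).
    apply: plamY; have := dmap_plot (fmap T (fmap T g) : dmap _ _) Hp.
    by congr (plot _ _); apply/funext => u; exact: (esym (dlam_natural g (p u))).
  have Hfg : plot (dprod (T X) (T Y)) (fun u => (fmap T f ∙ p u, fmap T g ∙ p u)) by split.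
  have := dmap_plot (lan_pair (That_products R) X Y : dmap _ _) Hfg.
  congr (plot _ _); apply/funext => u; exact: (lan_splitK (That_products R) (p u)).
- move=> k k1; have k0 := ltn_pred _ k1; apply/(dnu_injP k0) => x y E.
  have N Z (q : hom XY Z) j z : fmap T (dTpr j Z) ∙ (fmap T (fmap (dTk R k) q) ∙ z) =
      fmap T (fmap T q) ∙ (fmap T (dTpr j XY) ∙ z).
    by rewrite !fmap_compE; congr (fmap T _ ∙ _); exact: dmap_eq.
  apply: (T_jointly_injective (f := fmap (dTk R k) f) (g := fmap (dTk R k) g) (h := dTk_pair X Y
    k)).
  + exact: (dTk_pairK k0).
  + by apply: (dnu_injP k0 X).1 (E4X _ k1) _ _ _ => j; rewrite !N E.
  + by apply: (dnu_injP k0 Y).1 (E4Y _ k1) _ _ _ => j; rewrite !N E.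
Qed.

Lemma dTk_prod_retract k (k0 : (0 < k)%N) (X Y : DFLG) :
  retract (dTk R k (dprod X Y)) (dprod (dTk R k X) (dTk R k Y) : DFLG).
Proof.
pose XY : DFLG := dprod X Y; pose f : hom XY X := dfst X Y; pose g : hom XY Y := dsnd X Y.
exists (dpair (fmap (dTk R k) f : dmap _ _) (fmap (dTk R k) g : dmap _ _)), (dTk_pair X Y k).
by apply: dmap_eq => z; exact: dTk_pairK.
Qed.

(** Iterated fiber powers of X x Y are retracts of products of those of X and Y, so (E5) follows
    from the two stability results. *)
Lemma elastic_prod (X Y : DFLG) : elastic X -> elastic Y -> elastic (dprod X Y).
Proof.
move=> [aX hX] [aY hY]; split; first exact: elastic_axioms_prod.
move=> ks ks0.
apply: elastic_axioms_retract (elastic_axioms_prod (hX _ ks0) (hY _ ks0)).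
elim: ks ks0 {hX hY} => [_|k ks IH /andP[k0 /IH H]]; first exact: retract_refl.
exact: retract_trans (retract_fmap (dTk R k) H) (dTk_prod_retract k0 _ _).
Qed.

End ElasticProducts.

(** * Euclidean spaces are elastic *)

Section Representables.
Variable R : realType.
Local Notation eucl := (eucl R).
Local Notation EUCL := (EUCL R).
Local Notation dflg := (dflg R).
Local Notation DFLG := (DFLG R).
Local Notation T := (dT R).
Local Notation That2 := (functor_comp (That R) (That R)).

Definition yon_map (U V : eucl) (f : smap U V) : dmap (yon U) (yon V) :=
  @DMap R (yon U) (yon V) f (fun W p Hp => ext_comp_smooth (smap_smooth f) Hp).

Section KanYoneda.
Variables (F : functor EUCL EUCL) (U : eucl).

Definition yon_ev_cocone (W : eucl) (p : W -> yon U) (Hp : plot (yon U) p)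
  (a : epoint (F W)) : yon (F U) := fm F (SMap (V := U) Hp) a.

Lemma yon_ev_plot (W : eucl) (p : W -> yon U) (Hp : plot (yon U) p) :
  plot (yon (F U)) (yon_ev_cocone Hp).
Proof. exact: (smap_smooth (fm F (SMap (V := U) Hp))). Qed.

Lemma yon_ev_compat (W W' : eucl) (p : W -> yon U) (Hp : plot (yon U) p) (q : W' -> yon U)
    (Hq : plot (yon U) q) (f : smap W W') (a : epoint (F W)) : (forall u, p u = q (f u)) ->
  yon_ev_cocone Hp a = yon_ev_cocone Hq (fm F f a).
Proof. by move=> E; rewrite /yon_ev_cocone fm_comp; exact: fm_eq. Qed.

(** Co-Yoneda: the identity is terminal among the plots of [yon U], so [p, a] has a unique
    representative over it, namely F(p)(a). *)
Definition yon_ev : hom (lan F (yon U)) (yon (F U)) := lan_desc yon_ev_plot yon_ev_compat.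

Lemma yon_evE (W : eucl) (p : smap W U) (Hp : plot (yon U) p) a :
  yon_ev ∙ lan_in (F := F) (X := yon U) Hp a = fm F p a.
Proof.
apply: etrans (lan_desc_funE (F := F) (X := yon U) yon_ev_compat Hp a) _; exact: fm_eq.
Qed.

Definition yon_id_plot : plot (yon U) (@id U) := @smap_id_smooth R U.

Definition yon_eta : hom (yon (F U) : DFLG) (lan F (yon U)) :=
  @DMap R (yon (F U)) (lan_ob F (yon U)) (lan_in (F := F) (X := yon U) yon_id_plot)
    (fun W q Hq => plot_comp (SMap (V := F U) Hq) (lan_in_plot (F := F) (X := yon U) yon_id_plot)).

Lemma yon_etaK a : yon_ev ∙ (yon_eta ∙ a) = a.
Proof. by apply: etrans (yon_evE (p := smap_id U) yon_id_plot a) _; exact: fm_id. Qed.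

Lemma yon_evK z : yon_eta ∙ (yon_ev ∙ z) = z.
Proof.
elim/lan_ind: z => W p Hp a.
rewrite (yon_evE (p := SMap (V := U) Hp)); apply: esym.
exact: (@lan_in_eq R F (yon U) W U p Hp id yon_id_plot (SMap (V := U) Hp) a).
Qed.

Lemma yon_eta_ind (P : lan F (yon U) -> Prop) : (forall a, P (yon_eta ∙ a)) -> forall z, P z.
Proof. by move=> H z; rewrite -(yon_evK z). Qed.
End KanYoneda.
Arguments yon_id_plot : clear implicits.

Section ElasticYoneda.
Variable U : eucl.
Local Notation X := (yon U : DFLG).

(** Reads the coordinates of a second-order element: a left inverse of the plot that sends a to
    [[id, -], a]. *)
Definition yon_ev2 : hom (T (T X)) (yon (That_ob (That_ob U))) :=
  yon_ev (That R) (That_ob U) \oc fmap T (yon_ev (That R) U).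

Lemma yon_ev2E (a : That_ob (That_ob U)) :
  yon_ev2 ∙ tin (tplot (yon_id_plot U)) a = a.
Proof.
rewrite dcompE -[RHS](yon_etaK (F := That R) (U := That_ob U) a); congr (_ ∙ _).
apply: (lan_map_in0 (F := That R) (tplot (yon_id_plot U)) (yon_id_plot (That_ob U)) a).
exact: yon_etaK.
Qed.

Section Powers.
Variables (k : nat) (k0 : (0 < k)%N).

Definition yon_tuple_fun (w : dTk R k X) : 'rV[R]_(edim U + k * edim U) :=
  row_mx (sval (fprod_base (dpi X : dmap _ _) k w : U))
    (mxvec (\matrix_i rsubmx (sval (yon_ev (That R) U ∙ (dTpr i X ∙ w))))).

Lemma yon_tuple_mem w : edom (That_k_ob k U) (yon_tuple_fun w).
Proof. by split=> //=; rewrite row_mxKl; exact: svalP. Qed.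

Definition yon_tuple_pt (w : dTk R k X) : yon (That_k_ob k U) := exist _ _ (yon_tuple_mem w).

Lemma yon_tuple_plot (W : eucl) (q : W -> dTk R k X) :
  plot (dTk R k X) q -> plot (yon (That_k_ob k U)) (yon_tuple_pt \o q).
Proof.
move=> Hq; have oW := edom_open W.
have Hb : smooth_on (edom W) (ext (fun w => fprod_base (dpi X : dmap _ _) k (q w) : U)).
  exact: (dmap_plot (fprod_base (dpi X : dmap _ _) k) Hq).
have Hi i : smooth_on (edom W) (ext (fun w => yon_ev (That R) U ∙ (dTpr i X ∙ q w) : That_ob U)).
  exact: (dmap_plot (dmap_comp (yon_ev (That R) U : dmap _ _) (dTpr i X : dmap _ _)) Hq).
have sM : smooth_on (edom W) (fun x => mxvec (\matrix_i rsubmx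
   (ext (fun w => yon_ev (That R) U ∙ (dTpr i X ∙ q w) : That_ob U) x))).
  apply/smooth_on_row => // c; case/mxvec_indexP: c => i j.
  have := (smooth_on_row _ oW).1 (Hi i) (rshift (edim U) j).
  by apply: smooth_on_eq => // x _; rewrite mxvecE mxE [RHS]mxE.
have := smooth_on_row_mx oW Hb sM.
apply: smooth_on_eq => // x /set_mem Wx.
rewrite (ext_val (yon_tuple_pt \o q) (exist _ x Wx)) /= /yon_tuple_fun.
rewrite (ext_val (fun w => fprod_base (dpi X : dmap _ _) k (q w) : U) (exist _ x Wx)).
congr row_mx; apply: (congr1 mxvec); apply/row_matrixP => i; rewrite !rowK.
by rewrite (ext_val (fun w => yon_ev (That R) U ∙ (dTpr i X ∙ q w) : That_ob U) (exist _ x Wx)).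
Qed.

Definition yon_tuple : hom (dTk R k X) (yon (That_k_ob k U)) := DMap yon_tuple_plot.

Lemma yon_theta_iso : is_iso (dtheta k X).
Proof.
have tE a : dtheta k X ∙ (yon_eta (That_k R k) U ∙ a) = dtheta k X ∙ tkin k (yon_id_plot U) a by [].
apply: (isoP (g := yon_eta (That_k R k) U \oc yon_tuple)) => z; rewrite dcompE.
  elim/yon_eta_ind: z => a; congr (_ ∙ _); rewrite tE; apply: epoint_eq.
  rewrite /= /yon_tuple_fun -[RHS]hsubmxK; congr row_mx.
    apply: (congr1 sval _ : sval (_ : U) = sval (basehat_map k U a)).
    exact: etrans (congr1 (lan_id X : dmap _ _) (lan_ntE (basehat R k) (yon_id_plot U) a))
      (lan_idE _ _).
  rewrite -[RHS]vec_mxK; congr mxvec; apply/row_matrixP => i; rewrite rowK.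
  rewrite (dtheta_pr (yon_id_plot U) a i) (yon_etaK (F := That R) (U := U) (prhat_map i U a)) /=.
  by rewrite row_mxKr.
apply: (fprod_ext k0) => i; apply: etrans (dtheta_pr (yon_id_plot U) _ i) _.
rewrite -[RHS]yon_evK; apply: (congr1 (fun a => tin (yon_id_plot U) a)); apply: epoint_eq.
have B : fprod_base (dpi X : dmap _ _) k z = dpi X ∙ (dTpr i X ∙ z) := esym (svalP z i).
have C y : dpi X ∙ y = pihat_map U (yon_ev (That R) U ∙ y).
  by elim/yon_eta_ind: y => a; rewrite yon_etaK; exact: (dpiE (X := yon U) (yon_id_plot U) a).
rewrite -[RHS]hsubmxK; apply: (congr2 row_mx).
  rewrite [LHS]row_mxKl; apply: (congr1 sval (_ : _ = pihat_map U _)).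
  exact: etrans B (C _).
by rewrite [LHS]tvec_row_mx rowK.
Qed.
End Powers.

(** The map (u, u0, u1, u01) |-> (u, u01) is a smooth left inverse of the Euclidean vertical lift; a
    map with a smooth left inverse is an induction, which gives (E3). *)
Definition lamhat_ret : smap (That_ob (That_ob U)) (That_ob U).
Proof.
apply: (@mk_smap R (That_ob (That_ob U)) (That_ob U)
  (fun w => row_mx (lsubmx (lsubmx w)) (rsubmx (rsubmx w)))).
  by move=> w [[Uw _] _]; split; rewrite ?row_mxKl.
by apply: smooth_on_linear => a x y; rewrite !linearP scale_row_mx add_row_mx.
Defined.

Lemma prhat_inj k (k0 : (0 < k)%N) n (w w' : 'rV[R]_(n + k * n)) :
  (forall i : 'I_k, prhat_fun i w = prhat_fun i w') -> w = w'.
Proof.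
move=> E; rewrite -[w]hsubmxK -[w']hsubmxK; have [-> _] := eq_row_mx (E (Ordinal k0)).
congr row_mx; apply: (can_inj vec_mxK); apply/row_matrixP => i.
by have [_] := eq_row_mx (E i).
Qed.

Lemma elastic_axioms_yon : elastic_axioms X.
Proof.
have ltn_pred k : (1 < k)%N -> (0 < k)%N by case: k.
split.
- by move=> k /ltn_pred k0; exact: yon_theta_iso.
(* [yon_eta That2 U \oc yon_ev2] is a left inverse of [dtheta2 X], so this composite has the
   required restriction along [dtheta2 X]. *)
- exists (dtheta2 X \oc lan_nt (tauhat R) X \oc yon_eta That2 U \oc yon_ev2).
  apply: dmap_eq; apply: yon_eta_ind => a.
  have E : yon_ev2 ∙ (dtheta2 X ∙ (yon_eta That2 U ∙ a)) = a.
    by apply: etrans (yon_ev2E a); congr (_ ∙ _); exact: dtheta2E.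
  exact: (congr1 (fun b => (dtheta2 X \oc lan_nt (tauhat R) X \oc yon_eta That2 U) ∙ b) E).
- pose r : hom (T (T X)) (T X) := yon_eta (That R) U \oc yon_map lamhat_ret \oc yon_ev2.
  have rE w : r ∙ w = yon_eta (That R) U ∙ (yon_map lamhat_ret ∙ (yon_ev2 ∙ w)) by [].
  have rK z : r ∙ (dlam X ∙ z) = z.
    elim/yon_eta_ind: z => a.
    have E : yon_ev2 ∙ (dlam X ∙ (yon_eta (That R) U ∙ a)) = lamhat_map U a.
      by apply: etrans (yon_ev2E _); congr (_ ∙ _); exact: dlamE.
    rewrite rE E; congr (_ ∙ _); apply: epoint_eq.
    by rewrite /= /lamhat_fun row_mxKl !row_mxKr row_mxKl; exact: hsubmxK.
  split=> [x y E|W p Hp]; first by rewrite -(rK x) -(rK y) E.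
  have := dmap_plot (r : dmap _ _) Hp.
  by congr (plot _ _); apply/funext => w; exact: rK.
- move=> k /ltn_pred k0; apply/(dnu_injP k0) => x y E.
  (* The split epimorphism [te] presents T_kX by a Euclidean space, so (E4) becomes a statement
     about T of the linear projections [prhat_map]. These act on the base block and on the vector
     block by the same linear maps, and [prhat_inj] applies to each block. *)
  pose te : hom (yon (That_k_ob k U) : DFLG) (dTk R k X) := dtheta k X \oc yon_eta (That_k R k) U.
  have [h hK] : exists h, te \oc h = idm (dTk R k X).
    exists (yon_ev (That_k R k) U \oc iso_inv (yon_theta_iso k0)).
    by apply: dmap_eq => z; rewrite !dcompE yon_evK iso_invKr.
  move: E; rewrite -(fmap_retractK (F := T) hK x) -(fmap_retractK (F := T) hK y).
  elim/yon_eta_ind: (fmap T h ∙ x) => a; elim/yon_eta_ind: (fmap T h ∙ y) => b E.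
  congr (_ ∙ (_ ∙ _)).
  have N i c : yon_ev2 ∙ (fmap T (dTpr i X) ∙ (fmap T te ∙ (yon_eta (That R) (That_k_ob k U) ∙
    c))) =
      fm (That R) (prhat_map i U) c.
    rewrite fmap_compE -[RHS]yon_ev2E; congr (_ ∙ _).
    apply: (lan_map_in (F := That R) (yon_id_plot (That_k_ob k U)) (tplot (yon_id_plot U))).
    by move=> u; exact: dtheta_pr.
  have {}E i : fm (That R) (prhat_map i U) a = fm (That R) (prhat_map i U) b.
    by rewrite -!N E.
  have {}E i := congr1 sval (E i).
  apply: epoint_eq; rewrite -[LHS]hsubmxK -[RHS]hsubmxK.
  congr row_mx; apply: (prhat_inj k0) => i; have := E i;
    by rewrite !(@That_linear R (That_k_ob k U) (That_ob U) _ _ _ (@prhat_linear R k i _))// =>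
      /eq_row_mx[].
Qed.
End ElasticYoneda.

(** By (E1) and the Yoneda lemma, T_k of a Euclidean space V is Euclidean again, namely
    [That_k_ob k V]. Retracts are all that (E5) requires. *)
Lemma foldr_yon_retract (U : eucl) ks : all (fun k => 0 < k)%N ks ->
  exists V : eucl, retract (foldr (fun k (Y : DFLG) => dTk R k Y) (yon U : DFLG) ks) (yon V : DFLG).
Proof.
elim: ks => [_|k ks IH /andP[k0 /IH [V HV]]]; first by exists U; exact: retract_refl.
exists (That_k_ob k V); apply: retract_trans (retract_fmap (dTk R k) HV) _.
exists (yon_ev (That_k R k) V \oc iso_inv (yon_theta_iso V k0)), (dtheta k (yon V) \oc yon_eta
  (That_k R k) V).
by apply: dmap_eq => z; rewrite !dcompE yon_evK iso_invKr.
Qed.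

Lemma elastic_yon (U : eucl) : elastic (yon U).
Proof.
split; first exact: elastic_axioms_yon.
move=> ks /(foldr_yon_retract U)[V HV]; apply: elastic_axioms_retract HV _.
exact: elastic_axioms_yon.
Qed.

Lemma elastic_point : elastic (dpoint R).
Proof.
apply: elastic_retract (elastic_yon (efull R 1)).
exists (line_zero R), (@DMap R (line R) (dpoint R) (fun=> tt) (fun _ _ _ => I)).
by apply: dmap_eq => -[].
Qed.

Lemma elst_closed_proof : elst_closed R.
Proof.
have eL : elastic (line R) by exact: elastic_yon.
split=> [X eX|||| X eX]; [exact: elastic_T|exact: elastic_point|exact: eL| |].
- exact: elastic_prod.
- by apply: elastic_prod => //; exact: elastic_T.
Qed.

End Representables.

(** * Fiberwise addition *)

Section Pointwise.
Variable R : realType.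
Local Notation eucl := (eucl R).
Local Notation EUCL := (EUCL R).
Local Notation dflg := (dflg R).
Local Notation DFLG := (DFLG R).
Local Notation T := (dT R).

Definition tpt (U : eucl) (u : U) (v : 'rV[R]_(edim U)) : That_ob U :=
  epair_pt (V := efull R (edim U)) u (exist _ v I).

Definition tkpt k (U : eucl) (u : U) (v : 'I_k -> 'rV[R]_(edim U)) : That_k_ob k U :=
  epair_pt (V := efull R (k * edim U)) u (exist _ (mxvec (\matrix_i v i)) I).

Lemma tpt_eta (U : eucl) (a : That_ob U) : a = tpt (pihat_map U a) (rsubmx (sval a)).
Proof. by apply: epoint_eq; rewrite /= hsubmxK. Qed.

Lemma tkpt_eta k (U : eucl) (a : That_k_ob k U) : a = tkpt (basehat_map k U a) (tvec (sval a)).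
Proof.
apply: epoint_eq; rewrite /= -[LHS]hsubmxK; congr row_mx; rewrite -[LHS]vec_mxK; congr mxvec.
by apply/row_matrixP => i; rewrite rowK.
Qed.

Lemma prhat_tkpt k (U : eucl) (u : U) (v : 'I_k -> 'rV[R]_(edim U)) i :
  prhat_map i U (tkpt u v) = tpt u (v i).
Proof. by apply: epoint_eq; rewrite /= /prhat_fun row_mxKl tvec_row_mx rowK. Qed.

Lemma plushat_tkpt (U : eucl) (u : U) (v : 'I_2 -> 'rV[R]_(edim U)) :
  plushat_map U (tkpt u v) = tpt u (v ord0 + v ord_max).
Proof. by apply: epoint_eq; rewrite /= /plushat_fun row_mxKl !tvec_row_mx !rowK. Qed.

Lemma zerohat_tpt (U : eucl) (u : U) : zerohat_map U u = tpt u 0.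
Proof. exact: epoint_eq. Qed.

Lemma pihat_tpt (U : eucl) (u : U) v : pihat_map U (tpt u v) = u.
Proof. by apply: epoint_eq; rewrite /= row_mxKl. Qed.

Section Sums.
Variable X : dflg.

Lemma dpi_tin (U : eucl) (p : U -> X) (Hp : plot X p) u v : dpi X ∙ tin Hp (tpt u v) = p u.
Proof. by apply: etrans (dpiE Hp _) _; rewrite pihat_tpt. Qed.

Lemma T_ind (P : T X -> Prop) :
  (forall (U : eucl) (p : U -> X) (Hp : plot X p) u v, P (tin Hp (tpt u v))) -> forall x, P x.
Proof. by move=> H; apply: lan_ind => U p Hp a; rewrite (tpt_eta a). Qed.

Lemma dzero_tin (U : eucl) (p : U -> X) (Hp : plot X p) u : dzero X ∙ p u = tin Hp (tpt u 0).
Proof. by rewrite (dzeroE Hp) zerohat_tpt. Qed.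

Lemma dpi_dzero x : dpi X ∙ (dzero X ∙ x) = x.
Proof.
have Hp : plot X (fun _ : efull R 0 => x) by exact: plot_cst.
pose u : efull R 0 := exist _ 0 I.
by rewrite -[x]/((fun _ : efull R 0 => x) u) (dzero_tin Hp) dpi_tin.
Qed.

Lemma dkappa_tin (r : line R) (U : eucl) (p : U -> X) (Hp : plot X p) u v :
  dkappa X ∙ (r, tin Hp (tpt u v)) = tin Hp (tpt u (sval r 0 0 *: v)).
Proof.
rewrite dkappaE; apply: (congr1 (fun a => tin Hp a)); apply: epoint_eq.
by rewrite /= /kappahat_fun !row_mxKr !row_mxKl.
Qed.

(** The main use of (E1): vectors over the same point form an element of T_kX, and surjectivity of
    theta_k places all of them on one plot, over one point u of its domain. *)
Lemma common_representation k (k1 : (1 < k)%N) (x : 'I_k -> T X) : is_iso (dtheta k X) ->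
  (forall i j, dpi X ∙ x i = dpi X ∙ x j) ->
  exists (U : eucl) (p : U -> X) (Hp : plot X p) (u : U) (v : 'I_k -> 'rV[R]_(edim U)),
    forall i, x i = tin Hp (tpt u (v i)).
Proof.
move=> ti E; pose b := dpi X ∙ x (Ordinal (ltnW k1)).
pose w : dTk R k X := exist (fun y : X * ('I_k -> T X) => forall i, dpi X ∙ y.2 i = y.1)
  (b, x) (fun i => E i _).
have [U [p [Hp [a Ew]]]] := dtheta_surj ti w.
exists U, p, Hp, (basehat_map k U a), (tvec (sval a)) => i.
apply: etrans (congr1 (fun y => dTpr i X ∙ y) Ew) _; rewrite dtheta_pr.
by rewrite -(prhat_tkpt (basehat_map k U a)) -tkpt_eta.
Qed.

Variable eX : elastic X.
Local Notation iso2 := (elastic_E1 eX.1 (isT : (1 < 2)%N)).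

(** Relational, since addition is defined only for vectors over the same point; it is the pointwise
    version of [is_sum]. *)
Definition psum (x y z : T X) := exists w : dTk R 2 X,
  [/\ dTpr ord0 X ∙ w = x, dTpr ord_max X ∙ w = y & dplus eX ∙ w = z].

Lemma ord2_ind (P : 'I_2 -> Prop) : P ord0 -> P ord_max -> forall i, P i.
Proof.
move=> P0 P1 [[|[|//]] i2]; first by rewrite (_ : Ordinal i2 = ord0) //; exact: val_inj.
by rewrite (_ : Ordinal i2 = ord_max) //; exact: val_inj.
Qed.

Lemma psum_fun x y z z' : psum x y z -> psum x y z' -> z = z'.
Proof.
move=> [w [x0 y0 <-]] [w' [x1 y1 <-]]; congr (_ ∙ _); apply: fprod_ext => //.
by apply: ord2_ind; [exact: etrans x0 (esym x1)|exact: etrans y0 (esym y1)].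
Qed.

Lemma psum_tpt (U : eucl) (p : U -> X) (Hp : plot X p) u v w :
  psum (tin Hp (tpt u v)) (tin Hp (tpt u w)) (tin Hp (tpt u (v + w))).
Proof.
pose vw (i : 'I_2) := if i == ord0 then v else w.
exists (dtheta 2 X ∙ tkin 2 Hp (tkpt u vw)).
by split; rewrite ?dplusE ?plushat_tkpt// dtheta_pr prhat_tkpt.
Qed.

Lemma psum_tin (U : eucl) (p : U -> X) (Hp : plot X p) (a b c : That_ob U) :
  lsubmx (sval a) = lsubmx (sval b) -> lsubmx (sval a) = lsubmx (sval c) ->
  rsubmx (sval c) = rsubmx (sval a) + rsubmx (sval b) ->
  psum (tin Hp a) (tin Hp b) (tin Hp c).
Proof.
move=> ab ac E; rewrite (tpt_eta a) (tpt_eta b) (tpt_eta c) E.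
have -> : pihat_map U b = pihat_map U a by exact: epoint_eq.
have -> : pihat_map U c = pihat_map U a by exact: epoint_eq.
exact: psum_tpt.
Qed.

Lemma psum_elim x y z : psum x y z ->
  exists (U : eucl) (p : U -> X) (Hp : plot X p) (u : U) v w,
    [/\ x = tin Hp (tpt u v), y = tin Hp (tpt u w) & z = tin Hp (tpt u (v + w))].
Proof.
move=> [w [x0 y0 <-]]; have [U [p [Hp [a Ew]]]] := dtheta_surj iso2 w.
exists U, p, Hp, (basehat_map 2 U a), (tvec (sval a) ord0), (tvec (sval a) ord_max).
rewrite -x0 -y0 Ew !dtheta_pr dplusE -plushat_tkpt.
by rewrite -!(prhat_tkpt (basehat_map 2 U a)) -tkpt_eta.
Qed.

Lemma psum_base x y z : psum x y z -> dpi X ∙ x = dpi X ∙ y /\ dpi X ∙ x = dpi X ∙ z.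
Proof. by move=> /psum_elim [U [p [Hp [u [v [w [-> -> ->]]]]]]]; rewrite !dpi_tin. Qed.

Lemma psum_exists x y : dpi X ∙ x = dpi X ∙ y -> exists z, psum x y z.
Proof.
move=> E; pose xy (i : 'I_2) := if i == ord0 then x else y.
have Exy i j : dpi X ∙ xy i = dpi X ∙ xy j by elim/ord2_ind: i; elim/ord2_ind: j.
have [U [p [Hp [u [v Ev]]]]] := common_representation (isT : (1 < 2)%N) iso2 Exy.
rewrite [x](Ev ord0) [y](Ev ord_max); eexists; exact: psum_tpt.
Qed.

Lemma psum_comm x y z : psum x y z -> psum y x z.
Proof.
by move=> /psum_elim [U [p [Hp [u [v [w [-> -> ->]]]]]]]; rewrite addrC; exact: psum_tpt.
Qed.

(** The plots that represent a + b and b + c need not be related. (E1) for k = 3 represents a, b and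
    c on one plot, where associativity is that of vectors. *)
Lemma psum_assoc a b c ab bc s :
  psum a b ab -> psum b c bc -> psum ab c s -> psum a bc s.
Proof.
move=> H1 H2 H3; have [E1 _] := psum_base H1; have [E2 _] := psum_base H2.
pose x (i : 'I_3) := nth a [:: a; b; c] i.
have Ex i j : dpi X ∙ x i = dpi X ∙ x j.
  have H (l : 'I_3) : dpi X ∙ x l = dpi X ∙ a.
    case: l => [[|[|[|//]]] l3]; [by []|exact: esym E1|exact: esym (etrans E1 E2)].
  by rewrite !H.
have [U [p [Hp [u [v Ev]]]]] :=
  common_representation (isT : (1 < 3)%N) (elastic_E1 eX.1 (isT : (1 < 3)%N)) Ex.
have Ea := Ev (Ordinal (isT : (0 < 3)%N)); rewrite /x /= in Ea.
have Eb := Ev (Ordinal (isT : (1 < 3)%N)); rewrite /x /= in Eb.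
have Ec := Ev (Ordinal (isT : (2 < 3)%N)); rewrite /x /= in Ec.
move: H1 H2 H3; rewrite Ea Eb Ec => /psum_fun/(_ (psum_tpt _ _ _ _)) ->.
move=> /psum_fun/(_ (psum_tpt _ _ _ _)) -> /psum_fun/(_ (psum_tpt _ _ _ _)) ->.
by rewrite -addrA; exact: psum_tpt.
Qed.

Lemma psum_zero x : psum (dzero X ∙ (dpi X ∙ x)) x x.
Proof.
elim/T_ind: x => U p Hp u v; rewrite dpi_tin (dzero_tin Hp) -[in X in psum _ _ X](add0r v).
exact: psum_tpt.
Qed.

Lemma psum_opp x : psum (dkappa X ∙ (line_of (const_mx (-1)), x)) x (dzero X ∙ (dpi X ∙ x)).
Proof.
elim/T_ind: x => U p Hp u v; rewrite dpi_tin (dzero_tin Hp) dkappa_tin /= mxE scaleN1r.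
by rewrite -[0](addNr v); exact: psum_tpt.
Qed.

End Sums.

Lemma dkappa_natural (X Y : DFLG) (f : hom X Y) r x :
  dkappa Y ∙ (r, fmap T f ∙ x) = fmap T f ∙ (dkappa X ∙ (r, x)).
Proof.
elim/T_ind: x => U p Hp u v; rewrite dkappa_tin.
have E a : fmap T f ∙ tin Hp a = tin (dmap_plot (f : dmap _ _) Hp) a by exact: lan_mapE.
by rewrite !E dkappa_tin.
Qed.

Lemma dzero_natural (X Y : DFLG) (f : hom X Y) x :
  dzero Y ∙ (f ∙ x) = fmap T f ∙ (dzero X ∙ x).
Proof.
have Hp : plot X (fun _ : efull R 0 => x) by exact: plot_cst.
pose u : efull R 0 := exist _ 0 I.
rewrite -[x]/((fun _ : efull R 0 => x) u) (dzero_tin Hp).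
have E a : fmap T f ∙ tin Hp a = tin (dmap_plot (f : dmap _ _) Hp) a by exact: lan_mapE.
rewrite E; exact: (dzero_tin (dmap_plot (f : dmap _ _) Hp)).
Qed.

Lemma psum_natural (X Y : DFLG) (eX : elastic X) (eY : elastic Y) (f : hom X Y) x y z :
  psum eX x y z -> psum eY (fmap T f ∙ x) (fmap T f ∙ y) (fmap T f ∙ z).
Proof.
move=> /psum_elim [U [p [Hp [u [v [w [-> -> ->]]]]]]].
have E a : fmap T f ∙ tin Hp a = tin (dmap_plot (f : dmap _ _) Hp) a by exact: lan_mapE.
by rewrite !E; exact: psum_tpt.
Qed.

End Pointwise.

(** * The vertical lift *)

Section SecondOrder.
Variable R : realType.
Local Notation eucl := (eucl R).
Local Notation EUCL := (EUCL R).
Local Notation dflg := (dflg R).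
Local Notation DFLG := (DFLG R).
Local Notation T := (dT R).
Local Notation TT U := (That_ob (That_ob U)).

Definition qpt (U : eucl) (u : U) (u0 u1 u01 : 'rV[R]_(edim U)) : TT U :=
  tpt (tpt u u0) (row_mx u1 u01).

Lemma qpt_eta (U : eucl) (a : TT U) :
  a = qpt (pihat_map U (pihat_map _ a)) (rsubmx (lsubmx (sval a)))
          (lsubmx (rsubmx (sval a))) (rsubmx (rsubmx (sval a))).
Proof. by apply: epoint_eq; rewrite /= !hsubmxK. Qed.

Lemma qpt_exists (U : eucl) (a : TT U) :
  exists (u : U) (u0 u1 u01 : 'rV[R]_(edim U)), a = qpt u u0 u1 u01.
Proof. by do 4!eexists; exact: qpt_eta. Qed.

Lemma tpt_inj (U : eucl) (u u' : U) v v' : tpt u v = tpt u' v' -> u = u' /\ v = v'.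
Proof. by move=> /(congr1 sval) /= /eq_row_mx[/epoint_eq -> ->]. Qed.

Lemma lamhat_tpt (U : eucl) (u : U) v : lamhat_map U (tpt u v) = qpt u 0 0 v.
Proof. by apply: epoint_eq; rewrite /= /lamhat_fun row_mxKl row_mxKr. Qed.

Lemma tauhat_qpt (U : eucl) (u : U) u0 u1 u01 :
  tauhat_map U (qpt u u0 u1 u01) = qpt u u1 u0 u01.
Proof. by apply: epoint_eq; rewrite /= /tauhat_fun row_mxKl row_mxKr !row_mxKl !row_mxKr. Qed.

Lemma That_tpt (U V : eucl) (f : smap U V) (F : 'rV[R]_(edim U) -> 'rV[R]_(edim V))
  (u : U) v : linear F -> (forall u : U, sval (f u) = F (sval u)) ->
  fm (That R) f (tpt u v) = tpt (f u) (F v).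
Proof.
move=> lF fF; apply: epoint_eq; rewrite (@That_linear R U V f F _ lF fF) /= fF.
by rewrite row_mxKl row_mxKr.
Qed.

Lemma That_pihat_qpt (U : eucl) (u : U) u0 u1 u01 :
  fm (That R) (pihat_map U) (qpt u u0 u1 u01) = tpt u u1.
Proof.
rewrite (@That_tpt (That_ob U) U (pihat_map U) _ _ _ (@lsubmx_linear R _ _))//.
by rewrite pihat_tpt row_mxKl.
Qed.

Lemma pihat_fm (U V : eucl) (f : smap U V) a : pihat_map V (fm (That R) f a) = f (pihat_map U a).
Proof. exact: (congr1 (fun h : smap _ _ => h a) (pihat_natural f)). Qed.

Lemma prhat_fm k (i : 'I_k) (U V : eucl) (f : smap U V) a :
  prhat_map i V (fm (That_k R k) f a) = fm (That R) f (prhat_map i U a).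
Proof. exact: (congr1 (fun h : smap _ _ => h a) (prhat_natural i f)). Qed.

Lemma That_pihat_fm (U V : eucl) (f : smap U V) (c : TT U) :
  fm (That R) (pihat_map V) (fm (That R) (That_map f) c) =
  fm (That R) f (fm (That R) (pihat_map U) c).
Proof. by rewrite !fm_comp; apply: fm_eq => w; exact: pihat_fm. Qed.

Lemma That_prhat_tpt k (i : 'I_k) (U : eucl) (u : U) (v w : 'I_k -> 'rV[R]_(edim U)) u1 :
  fm (That R) (prhat_map i U) (tpt (tkpt u v) (row_mx u1 (mxvec (\matrix_i w i)))) =
  qpt u (v i) u1 (w i).
Proof.
rewrite (@That_tpt (That_k_ob k U) (That_ob U) (prhat_map i U) _ _ _ (@prhat_linear R k i _))//.
by rewrite prhat_tkpt /prhat_fun row_mxKl tvec_row_mx rowK.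
Qed.

Lemma That_plushat_tpt (U : eucl) (u : U) (v w : 'I_2 -> 'rV[R]_(edim U)) u1 :
  fm (That R) (plushat_map U) (tpt (tkpt u v) (row_mx u1 (mxvec (\matrix_i w i)))) =
  qpt u (v ord0 + v ord_max) u1 (w ord0 + w ord_max).
Proof.
rewrite (@That_tpt (That_k_ob 2 U) (That_ob U) (plushat_map U) _ _ _ (@plushat_linear R _))//.
by rewrite plushat_tkpt /plushat_fun row_mxKl !tvec_row_mx !rowK.
Qed.

Lemma TTk_eta k (U : eucl) (a : That_ob (That_k_ob k U)) :
  exists (u : U) (v : 'I_k -> 'rV[R]_(edim U)) u1 (w : 'I_k -> 'rV[R]_(edim U)),
    a = tpt (tkpt u v) (row_mx u1 (mxvec (\matrix_i w i))).
Proof.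
pose M : 'M_(k, edim U) := vec_mx (rsubmx (rsubmx (sval a))).
exists (basehat_map k U (pihat_map _ a)), (tvec (sval (pihat_map _ a))), (lsubmx (rsubmx (sval a))).
exists (fun i => row i M); rewrite -tkpt_eta [LHS]tpt_eta; congr tpt.
rewrite -[LHS]hsubmxK; congr row_mx; rewrite -[LHS]vec_mxK; congr mxvec.
by apply/row_matrixP => i; rewrite rowK.
Qed.

Definition theta_plot k (X : dflg) (U : eucl) (p : U -> X) (Hp : plot X p) :
  plot (dTk R k X) ((dtheta k X : dmap _ _) \o lan_in (F := That_k R k) Hp) :=
  dmap_plot (dtheta k X : dmap _ _) (lan_in_plot (F := That_k R k) Hp).

(** If theta_k is an isomorphism, then T_kX is generated by the plots theta_k [p, -], just as LF(X)
    is generated by the plots [p, -]. *)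
Lemma TTk_ind k (X : dflg) (P : T (dTk R k X) -> Prop) : is_iso (dtheta k X) ->
  (forall (U : eucl) (p : U -> X) (Hp : plot X p) a, P (tin (theta_plot k Hp) a)) ->
  forall x, P x.
Proof.
move=> ti H x; have tK : dtheta k X \oc iso_inv ti = idm (dTk R k X).
  by apply: dmap_eq => y; exact: iso_invKr.
rewrite -(fmap_retractK (F := T) tK x).
apply: (generates_ind (P := fun y => P (fmap T (dtheta k X) ∙ y))
  (generates_lan (fun i : plot_index X => lan_in_plot (F := That_k R k) (svalP (projT2 i)))
    (@That_local R) (@generates_lan_plots R (That_k R k) X))).
move=> [U [p Hp]] a.
have E (Hp' : plot X p) : fmap T (dtheta k X) ∙ tin (lan_in_plot (F := That_k R k) Hp') a =
    tin (theta_plot k Hp') a by exact: lan_mapE.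
exact: (eq_ind_r P (H U p _ a) (E _)).
Qed.

Section Elastic.
Variables (X : dflg) (eX : elastic X).
Local Notation iso2 := (elastic_E1 eX.1 (isT : (1 < 2)%N)).

Lemma dlam_tin (U : eucl) (p : U -> X) (Hp : plot X p) u v :
  dlam X ∙ tin Hp (tpt u v) = tin (tplot Hp) (qpt u 0 0 v).
Proof. by rewrite dlamE lamhat_tpt. Qed.

Lemma dtau_tin (U : eucl) (p : U -> X) (Hp : plot X p) u u0 u1 u01 :
  dtau eX ∙ tin (tplot Hp) (qpt u u0 u1 u01) = tin (tplot Hp) (qpt u u1 u0 u01).
Proof. by rewrite dtauE tauhat_qpt. Qed.

Lemma T2_qind (P : T (T X) -> Prop) :
  (forall (U : eucl) (p : U -> X) (Hp : plot X p) u u0 u1 u01,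
    P (tin (tplot Hp) (qpt u u0 u1 u01))) -> forall x, P x.
Proof. by move=> H; apply: T2_ind => U p Hp a; rewrite (qpt_eta a). Qed.

Lemma dpiT_tin (U : eucl) (p : U -> X) (Hp : plot X p) u u0 u1 u01 :
  dpi (T X) ∙ tin (tplot Hp) (qpt u u0 u1 u01) = tin Hp (tpt u u0).
Proof. exact: (dpi_tin (X := T X) (tplot Hp)). Qed.

Lemma Tdpi_tin (U : eucl) (p : U -> X) (Hp : plot X p) u u0 u1 u01 :
  fmap T (dpi X) ∙ tin (tplot Hp) (qpt u u0 u1 u01) = tin Hp (tpt u u1).
Proof.
rewrite (lan_map_in (tplot Hp) Hp (phi := pihat_map U)) ?That_pihat_qpt// => a.
exact: dpiE.
Qed.

Lemma dtau_dtau x : dtau eX ∙ (dtau eX ∙ x) = x.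
Proof. by elim/T2_qind: x => U p Hp u u0 u1 u01; rewrite !dtau_tin. Qed.

Lemma dpi_dtau x : dpi (T X) ∙ (dtau eX ∙ x) = fmap T (dpi X) ∙ x.
Proof. by elim/T2_qind: x => U p Hp u u0 u1 u01; rewrite dtau_tin dpiT_tin Tdpi_tin. Qed.

Lemma dtau_dlam x : dtau eX ∙ (dlam X ∙ x) = dlam X ∙ x.
Proof. by elim/T_ind: x => U p Hp u v; rewrite dlam_tin dtau_tin. Qed.

Lemma dpi_dlam x : dpi (T X) ∙ (dlam X ∙ x) = dzero X ∙ (dpi X ∙ x).
Proof. by elim/T_ind: x => U p Hp u v; rewrite dlam_tin dpiT_tin dpi_tin (dzero_tin Hp). Qed.

Lemma Tdpi_dlam x : fmap T (dpi X) ∙ (dlam X ∙ x) = dzero X ∙ (dpi X ∙ x).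
Proof. by elim/T_ind: x => U p Hp u v; rewrite dlam_tin Tdpi_tin dpi_tin (dzero_tin Hp). Qed.

Variable eTX : elastic (T X).

Lemma psum_dlam x y z :
  psum eX x y z -> psum eTX (dlam X ∙ x) (dlam X ∙ y) (dlam X ∙ z).
Proof.
move=> /psum_elim [U [p [Hp [u [v [w [-> -> ->]]]]]]]; rewrite !dlam_tin.
by apply: psum_tin; rewrite /= ?row_mxKl ?row_mxKr// add_row_mx addr0.
Qed.

Lemma psum_dtau (x : T (dTk R 2 X)) :
  psum eTX (dtau eX ∙ (fmap T (dTpr ord0 X) ∙ x)) (dtau eX ∙ (fmap T (dTpr ord_max X) ∙ x))
    (dtau eX ∙ (fmap T (dplus eX) ∙ x)).
Proof.
move: x; apply: (TTk_ind iso2) => U p Hp a.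
have prE i : fmap T (dTpr i X) ∙ tin (theta_plot 2 Hp) a =
    tin (tplot Hp) (fm (That R) (prhat_map i U) a).
  by apply: lan_map_in => b; exact: dtheta_pr.
have plE : fmap T (dplus eX) ∙ tin (theta_plot 2 Hp) a =
    tin (tplot Hp) (fm (That R) (plushat_map U) a).
  by apply: lan_map_in => b; exact: dplusE.
rewrite !prE plE; have [u [v [w [m ->]]]] := TTk_eta a.
rewrite (That_prhat_tpt ord0) (That_prhat_tpt ord_max) That_plushat_tpt !dtau_tin.
by apply: psum_tin; rewrite /= ?row_mxKl ?row_mxKr// add_row_mx.
Qed.

(* If [q, (u, u0)] vanishes, then (E4) lets us replace u0 by 0 before applying T+. *)
Lemma vertical_tin (U : eucl) (q : U -> X) (Hq : plot X q) u u0 e :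
  tin Hq (tpt u u0) = dzero X ∙ q u ->
  tin (tplot Hq) (qpt u u0 0 e) = dlam X ∙ tin Hq (tpt u e).
Proof.
rewrite (dzero_tin Hq) => Z.
(* The element [y w] of T(T_2X) has the projections (u, w, 0, 0) and (u, 0, 0, e), and T+ sends it
   to their sum (u, w, 0, e). The claim compares w = u0 with w = 0. *)
pose v0 v (i : 'I_2) : 'rV[R]_(edim U) := if i == ord0 then v else 0.
pose v1 v (i : 'I_2) : 'rV[R]_(edim U) := if i == ord0 then 0 else v.
pose y w := tin (theta_plot 2 Hq) (tpt (tkpt u (v0 w)) (row_mx 0 (mxvec (\matrix_i v1 e i)))).
have prE w i : fmap T (dTpr i X) ∙ y w = tin (tplot Hq) (qpt u (v0 w i) 0 (v1 e i)).
  rewrite -That_prhat_tpt; apply: lan_map_in => b; exact: dtheta_pr.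
have plE w : fmap T (dplus eX) ∙ y w = tin (tplot Hq) (qpt u w 0 e).
  rewrite -[w in RHS]addr0 -[e in RHS]add0r -(That_plushat_tpt u (v0 w) (v1 e)).
  apply: lan_map_in => b; exact: dplusE.
have inj := (dnu_injP (isT : (0 < 2)%N) X).1 (elastic_E4 eX.1 (isT : (1 < 2)%N)).
rewrite dlam_tin -(plE u0) -(plE 0); suff -> : y u0 = y 0 by []; apply: inj => i.
rewrite !prE; elim/ord2_ind: i => //=; rewrite /v0 /v1 /=.
(* The first projection is the zero vector over [q, (u, w)]. It depends on that class only and not
   on w, and the class is the same for u0 and for 0 by hypothesis. *)
have zE w : tin (tplot Hq) (qpt u w 0 0) = dzero (T X) ∙ tin Hq (tpt u w).
  by rewrite (dzero_tin (tplot Hq) (tpt u w)) /qpt row_mx0.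
by rewrite !zE Z.
Qed.

(* The two equations say that c = (u, u0, u1, u01) for a = (u, u0, u1) and some u01. *)
Definition lifts_lam (U : eucl) (p : U -> X) (Hp : plot X p) (a : That_k_ob 2 U) : Prop :=
  forall c : TT U, pihat_map _ c = prhat_map ord0 U a ->
    fm (That R) (pihat_map U) c = prhat_map ord_max U a ->
  exists v : T X, dlam X ∙ v = tin (tplot Hp) c.

Section Step.
Variables (U V : eucl) (p : U -> X) (Hp : plot X p) (q : V -> X) (Hq : plot X q).
Variables (f : smap U V) (a : That_k_ob 2 U).
Hypothesis E : forall u, p u = q (f u).

Lemma push_tin (c : TT U) : tin (tplot Hp) c = tin (tplot Hq) (fm (That R) (That_map f) c).
Proof.
apply: (lan_in_eq (F := That R) (tplot Hp) (tplot Hq) (f := That_map f)) => w.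
exact: (lan_in_eq (F := That R) Hp Hq w E).
Qed.

Lemma push_pihat (c : TT U) : pihat_map _ c = prhat_map ord0 U a ->
  pihat_map _ (fm (That R) (That_map f) c) = prhat_map ord0 V (fm (That_k R 2) f a).
Proof. by rewrite pihat_fm prhat_fm => ->. Qed.

Lemma push_That_pihat (c : TT U) : fm (That R) (pihat_map U) c = prhat_map ord_max U a ->
  fm (That R) (pihat_map V) (fm (That R) (That_map f) c) =
  prhat_map ord_max V (fm (That_k R 2) f a).
Proof. by rewrite That_pihat_fm prhat_fm => ->. Qed.

(** The easy direction: pushing along [f] turns an admissible [c] for [a] into an admissible one for
    the image of [a], without changing its class in T(TX). *)
Lemma lifts_lam_pull : lifts_lam Hq (fm (That_k R 2) f a) -> lifts_lam Hp a.
Proof.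
move=> S c c0 c1; have [v Ev] := S _ (push_pihat c0) (push_That_pihat c1).
by exists v; rewrite Ev push_tin.
Qed.

(* The pushed-forward element and c differ only in u01, and their difference is vertical. *)
Lemma lifts_lam_push (x : X) : tin Hq (prhat_map ord0 V (fm (That_k R 2) f a)) = dzero X ∙ x ->
  lifts_lam Hp a -> lifts_lam Hq (fm (That_k R 2) f a).
Proof.
move=> Z S c c0 c1.
(* [d0] is one admissible element over [a], with last component 0. Its push-forward [d] agrees with
   [c] except for the last component, which a second derivative of [f] may have changed. *)
pose u := basehat_map 2 U a; pose v := tvec (sval a).
pose d0 := qpt u (v ord0) (v ord_max) 0.
have d00 : pihat_map (That_ob U) d0 = prhat_map ord0 U a.
  by rewrite pihat_tpt [in RHS](tkpt_eta a) prhat_tkpt.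
have d01 : fm (That R) (pihat_map U) d0 = prhat_map ord_max U a.
  by rewrite That_pihat_qpt [in RHS](tkpt_eta a) prhat_tkpt.
have [w Ew] := S _ d00 d01.
move: {S d00 d01} (push_pihat d00) (push_That_pihat d01); move: Ew; rewrite push_tin.
pose d := fm (That R) (That_map f) d0; rewrite -/d => Ew; move: d Ew => {u v d0} d Ew d0 d1.
have H0 := etrans c0 (esym d0); have H1 := etrans c1 (esym d1).
move: Z H0 H1; rewrite -{}c0 {c1 d0 d1}.
have [u [u0 [u1 [e {c}->]]]] := qpt_exists c; move: Ew.
have [u' [u0' [u1' [e' {d}->]]]] := qpt_exists d => Ew; rewrite !That_pihat_qpt !pihat_tpt => Z.
move=> /tpt_inj[Eu Eu0] /tpt_inj[_ Eu1]; move: Ew; rewrite -{}Eu -{}Eu0 -{}Eu1 => Ew.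
have xE : x = q u by rewrite -(dpi_dzero x) -Z dpi_tin.
rewrite xE in Z; have V1 := vertical_tin (U := V) (e - e') Z.
have wE : dpi X ∙ w = q u.
  by rewrite -(dpi_dzero (dpi X ∙ w)) -dpi_dlam Ew dpiT_tin dpi_tin.
(* The preimage of [c] is [w] plus [q, (u, e - e')]: both lie over q(u), lambda is additive, and
   adding (u, u0, 0, e - e') to [d] in the fiber over (u, u0) gives [c]. *)
have [y Hy] := psum_exists eX (etrans wE (esym (dpi_tin (U := V) Hq u (e - e')))).
exists y; apply: (psum_fun (psum_dlam Hy)); rewrite Ew -V1.
by apply: psum_tin; rewrite /= ?row_mxKl ?row_mxKr// add_row_mx addr0 subrKC.
Qed.
End Step.

Lemma lam_image (w : T (T X)) x : dpi (T X) ∙ w = dzero X ∙ x ->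
  fmap T (dpi X) ∙ w = dzero X ∙ x -> exists v, dlam X ∙ v = w.
Proof.
elim/T2_qind: w => U p Hp u u0 u1 e; rewrite dpiT_tin Tdpi_tin => Z0 Z1.
have xE : x = p u by rewrite -(dpi_dzero x) -Z0 dpi_tin.
rewrite {}xE in Z0 Z1; pose v (i : 'I_2) := if i == ord0 then u0 else u1.
have Zv i : tin Hp (tpt u (v i)) = dzero X ∙ p u by elim/ord2_ind: i.
pose b w := LanPre (F := That_k R 2) Hp (tkpt u w).
(* Injectivity of theta_2 lifts the equality of all projections to an equality in the quotient,
   which is what provides a zigzag. *)
have Eb : quot_in (@lan_step R _ X) (b v) = quot_in (@lan_step R _ X) (b (fun=> 0)).
  rewrite -[LHS](iso_invK iso2) -[RHS](iso_invK iso2); apply: (congr1 (fun y => iso_inv iso2 ∙ y)).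
  apply: fprod_ext => // i; apply: etrans (dtheta_pr Hp _ i) _.
  apply: etrans (esym (dtheta_pr Hp _ i)); rewrite !prhat_tkpt Zv; exact: dzero_tin.
pose S (b : lan_pre (That_k R 2) X) := lifts_lam (lp_isplot b) (lp_pt b).
have Zb0 i : dTpr i X ∙ (dtheta 2 X ∙ quot_in (@lan_step R _ X) (b (fun=> 0))) = dzero X ∙ p u.
  by apply: etrans (dtheta_pr Hp _ i) _; rewrite prhat_tkpt (dzero_tin Hp).
(* Every vertex of the zigzag stays in the class of (p, (u, 0, 0)). Its first vector therefore
   vanishes, as [lifts_lam_push] demands, and [S] can be carried in both directions. *)
have step b1 b2 : gen_eq (@lan_step R _ X) b1 b2 ->
    quot_in (@lan_step R _ X) b1 = quot_in (@lan_step R _ X) (b (fun=> 0)) -> S b1 <-> S b2.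
  elim=> {b1 b2} [b1 b2 H12|b1 //|b1 b2 H12 IH Hb|b1 b2 b3 H12 IH _ IH' Hb].
  - move=> Hb; have := Zb0 ord0; rewrite -{}Hb.
    have -> : quot_in (@lan_step R _ X) b1 = quot_in (@lan_step R _ X) b2.
      exact/quot_in_eq/Relation_Operators.rst_step.
    case: b1 b2 H12 => [U1 p1 H1 a1] [U2 p2 H2 a2] [f [E /= ->]] Z.
    split; last exact: lifts_lam_pull.
    by apply: (lifts_lam_push E (x := p u)); apply: etrans Z; apply: esym; exact: dtheta_pr.
  - by apply: iff_sym; apply: IH; rewrite (quot_in_eq H12).
  - by apply: iff_trans (IH Hb) (IH' _); rewrite -(quot_in_eq H12).
(* Over (u, 0, 0) the admissible elements are (u, 0, 0, c01), the Euclidean vertical lifts of (u,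
   c01). *)
have S0 : lifts_lam Hp (tkpt u (fun=> 0)).
  move=> c; have [u' [c0 [c1 [c01 ->]]]] := qpt_exists c.
  rewrite That_pihat_qpt pihat_tpt !prhat_tkpt => /tpt_inj[-> ->] /tpt_inj[_ ->].
  by exists (tin Hp (tpt u c01)); rewrite dlam_tin.
have Sv : lifts_lam Hp (tkpt u v) := (step _ _ (quot_in_inj Eb) Eb).2 S0.
apply: Sv.
  by rewrite pihat_tpt prhat_tkpt.
by rewrite That_pihat_qpt prhat_tkpt.
Qed.
End Elastic.
End SecondOrder.

(** * Braiding, scalars, and preservation of fiber powers *)

Section ThirdOrder.
Variable R : realType.
Local Notation eucl := (eucl R).
Local Notation EUCL := (EUCL R).
Local Notation dflg := (dflg R).
Local Notation DFLG := (DFLG R).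
Local Notation T := (dT R).
Local Notation TT U := (That_ob (That_ob U)).

Lemma That_tauhatE (U : eucl) (w : That_ob (TT U)) :
  sval (fm (That R) (tauhat_map U) w) =
  row_mx (tauhat_fun (lsubmx (sval w))) (tauhat_fun (rsubmx (sval w))).
Proof. exact: (@That_linear R (TT U) (TT U) _ _ _ (@tauhat_linear R _)). Qed.

Lemma That_lamhatE (U : eucl) (w : That_ob (That_ob U)) :
  sval (fm (That R) (lamhat_map U) w) =
  row_mx (lamhat_fun (lsubmx (sval w))) (lamhat_fun (rsubmx (sval w))).
Proof. exact: (@That_linear R (That_ob U) (TT U) _ _ _ (@lamhat_linear R _)). Qed.

Lemma tauhat_braid (U : eucl) (w : That_ob (TT U)) :
  tauhat_map (That_ob U) (fm (That R) (tauhat_map U) (tauhat_map (That_ob U) w)) =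
  fm (That R) (tauhat_map U) (tauhat_map (That_ob U) (fm (That R) (tauhat_map U) w)).
Proof.
apply: epoint_eq; rewrite That_tauhatE.
set a := sval (tauhat_map _ _); set b := sval (tauhat_map _ _).
have -> : a = tauhat_fun (sval (fm (That R) (tauhat_map U) (tauhat_map (That_ob U) w))) by [].
have -> : b = tauhat_fun (sval (fm (That R) (tauhat_map U) w)) by [].
rewrite !That_tauhatE.
have -> : sval (tauhat_map (That_ob U) w) = tauhat_fun (sval w) by [].
by rewrite /tauhat_fun !(row_mxKl, row_mxKr).
Qed.

Lemma tauhat_That_lamhat (U : eucl) (w : TT U) :
  fm (That R) (tauhat_map U) (tauhat_map (That_ob U) (fm (That R) (lamhat_map U) w)) =
  lamhat_map (That_ob U) (tauhat_map U w).
Proof.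
apply: epoint_eq; rewrite That_tauhatE.
set a := sval (tauhat_map _ _).
have -> : a = tauhat_fun (sval (fm (That R) (lamhat_map U) w)) by [].
rewrite That_lamhatE /= /lamhat_fun /tauhat_fun !(row_mxKl, row_mxKr).
by rewrite row_mx0.
Qed.

Lemma lamhat_lamhat (U : eucl) (w : That_ob U) :
  lamhat_map (That_ob U) (lamhat_map U w) = fm (That R) (lamhat_map U) (lamhat_map U w).
Proof.
apply: epoint_eq; rewrite That_lamhatE /= /lamhat_fun !(row_mxKl, row_mxKr).
by rewrite !row_mx0.
Qed.

(** A constant plot factors through the one-point space, whose tangent space has dimension 0 and so
    contains only the zero vector. *)
Lemma tin_cst (X : dflg) (U : eucl) (x : X) (Hp : plot X (fun _ : U => x)) a :
  tin Hp a = dzero X ∙ x.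
Proof.
pose pt : efull R 0 := exist _ 0 I; have Hx := plot_cst (efull R 0) x.
pose f : smap U (efull R 0) := SMap (yon_plot_cst (U := U) (pt : efull R 0)).
apply: etrans (lan_in_eq (F := That R) Hp Hx (f := f) a _) _ => //.
apply: esym; apply: etrans (dzero_tin Hx pt) _; apply: (congr1 (fun a => tin Hx a)).
by apply: epoint_eq; apply/rowP => -[].
Qed.

Lemma scalehat_linear n (c : R) :
  linear (fun w : 'rV[R]_(n + n) => row_mx (lsubmx w) (c *: rsubmx w)).
Proof.
apply: row_mx_linear => [|a x y]; first exact: lsubmx_linear.
by rewrite rsubmx_linear scalerDr !scalerA mulrC.
Qed.

(** [kappahat_map] is bilinear in the scalar and the vector; freezing the scalar makes it linear, so
    that T acts on it blockwise. *)
Definition scalehat (U : eucl) (c : R) : smap (That_ob U) (That_ob U) :=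
  @mk_smap R (That_ob U) (That_ob U) (fun w => row_mx (lsubmx w) (c *: rsubmx w))
    (fun w Uw => conj (eq_ind_r (edom U) Uw.1 (row_mxKl _ _)) I) (smooth_on_linear
      (scalehat_linear c)).

Section Elastic.
Variables (X : dflg) (eX : elastic X).

Lemma Tdlam_tin (U : eucl) (p : U -> X) (Hp : plot X p) a :
  fmap T (dlam X) ∙ tin (tplot Hp) a = tin (tplot (tplot Hp)) (fm (That R) (lamhat_map U) a).
Proof. by apply: lan_map_in => b; exact: dlamE. Qed.

Lemma Tdtau_tin (U : eucl) (p : U -> X) (Hp : plot X p) a :
  fmap T (dtau eX) ∙ tin (tplot (tplot Hp)) a =
  tin (tplot (tplot Hp)) (fm (That R) (tauhat_map U) a).
Proof. by apply: lan_map_in => b; exact: dtauE. Qed.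

Lemma dlam_dlam x : dlam (T X) ∙ (dlam X ∙ x) = fmap T (dlam X) ∙ (dlam X ∙ x).
Proof. by elim/lan_ind: x => U p Hp a; rewrite (dlamE Hp) Tdlam_tin dlamE lamhat_lamhat. Qed.

Variable eTX : elastic (T X).

Lemma dtau_braid x :
  dtau eTX ∙ (fmap T (dtau eX) ∙ (dtau eTX ∙ x)) =
  fmap T (dtau eX) ∙ (dtau eTX ∙ (fmap T (dtau eX) ∙ x)).
Proof.
elim/T3_ind: x => U p Hp a.
by rewrite !(dtauE eTX, Tdtau_tin) tauhat_braid.
Qed.

Lemma dtau_Tdlam x :
  fmap T (dtau eX) ∙ (dtau eTX ∙ (fmap T (dlam X) ∙ x)) = dlam (T X) ∙ (dtau eX ∙ x).
Proof.
elim/T2_ind: x => U p Hp a.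
by rewrite Tdlam_tin (dtauE eTX) Tdtau_tin dtauE dlamE tauhat_That_lamhat.
Qed.

Lemma dkappa_dlam r x : dlam X ∙ (dkappa X ∙ (r, x)) = dkappa (T X) ∙ (r, dlam X ∙ x).
Proof.
elim/T_ind: x => U p Hp u v; rewrite dkappa_tin !dlam_tin /qpt dkappa_tin.
by rewrite scale_row_mx scaler0.
Qed.

(* The hypotheses say that z is (0_r, tau w). *)
Lemma dtau_dkappa (r : line R) (w : T (T X)) (z : T (dprod (line R) (T X))) :
  fmap T (dfst (line R) (T X) : hom (dprod (line R) (T X) : DFLG) (line R)) ∙ z = dzero (line R)
    ∙ r ->
  fmap T (dsnd (line R) (T X) : hom (dprod (line R) (T X) : DFLG) (T X)) ∙ z = dtau eX ∙ w ->
  dtau eX ∙ (dkappa (T X) ∙ (r, w)) = fmap T (dkappa X) ∙ z.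
Proof.
elim/T2_qind: w => U p Hp u u0 u1 e; rewrite dtau_tin => z1 z2.
(* Since T preserves products, [z] is determined by its two projections. It is therefore represented
   on the plot (r, [p, -]), on which kappa acts by scaling with the constant r. *)
have Hq : plot (dprod (line R) (T X)) (fun a => (r, tin Hp a)).
  by split; [exact: plot_cst|exact: lan_in_plot].
have -> : z = tin Hq (qpt u u1 u0 e).
  apply: T_split_inj; rewrite ?z1 ?z2.
    apply: esym; apply: etrans (lan_map_in0 _ (plot_cst (That_ob U) r) _ _) _ => //.
    exact: tin_cst.
  by apply: esym; exact: lan_map_in0.
pose c := sval r 0 0.
rewrite (lan_map_in (F := That R) Hq (tplot Hp) (phi := scalehat U c)); last first.
  move=> a; rewrite [a]tpt_eta dkappa_tin; apply: (congr1 (fun a => tin Hp a)).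
  by apply: epoint_eq; rewrite /= row_mxKl row_mxKr.
rewrite {2}/qpt (@That_tpt R (That_ob U) (That_ob U) (scalehat U c) _ _ _ (scalehat_linear c))//.
rewrite row_mxKl row_mxKr /qpt dkappa_tin scale_row_mx dtau_tin.
apply: (congr1 (fun a => tin (tplot Hp) a)); congr tpt.
by apply: epoint_eq; rewrite /= row_mxKl row_mxKr.
Qed.

End Elastic.

Definition swaphat_fun k n (w : 'rV[R]_((n + n) + k * (n + n))) : 'rV[R]_((n + k * n) + (n + k *
  n)) :=
  let M : 'M_(k, n + n) := vec_mx (rsubmx w) in
  row_mx (row_mx (lsubmx (lsubmx w)) (mxvec (lsubmx M))) (row_mx (rsubmx (lsubmx w)) (mxvec
    (rsubmx M))).

Lemma swaphat_linear k n : linear (@swaphat_fun k n).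
Proof.
apply: row_mx_linear; apply: row_mx_linear => a x y.
- by rewrite !linearP.
- by rewrite !linearP.
- by rewrite !linearP.
- by rewrite !linearP.
Qed.

Lemma swaphat_mem k (U : eucl) w : edom (That_k_ob k (That_ob U)) w ->
  edom (That_ob (That_k_ob k U)) (swaphat_fun w).
Proof. by move=> [[Uw _] _]; split=> //=; rewrite row_mxKl; split=> //; rewrite row_mxKl. Qed.

(** Sends (u, u0) with vectors (u1_i, u01_i) to (u, u1_i) with direction (u0, u01_i): tau in each of
    the k components, with the common base shared. *)
Definition swaphat k (U : eucl) : smap (That_k_ob k (That_ob U)) (That_ob (That_k_ob k U)) :=
  @mk_smap R (That_k_ob k (That_ob U)) (That_ob (That_k_ob k U)) _ (@swaphat_mem k U)
    (smooth_on_linear (@swaphat_linear _ _)).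

Lemma That_prhat_swaphat k (i : 'I_k) (U : eucl) w :
  fm (That R) (prhat_map i U) (swaphat k U w) = tauhat_map U (prhat_map i (That_ob U) w).
Proof.
apply: epoint_eq.
rewrite (@That_linear R (That_k_ob k U) (That_ob U) _ _ _ (@prhat_linear R k i _))//=.
rewrite /swaphat_fun /prhat_fun /tauhat_fun !(row_mxKl, row_mxKr, tvec_row_mx).
by congr row_mx; congr row_mx; apply/rowP => j; rewrite /tvec !mxE.
Qed.

(** An injective subduction is an isomorphism: lifting constant plots gives surjectivity, and by
    injectivity the local lifts are restrictions of the set-theoretic inverse, which is therefore
    smooth. *)
Lemma iso_of_lifts (X Y : DFLG) (f : hom X Y) : injective (f : dmap _ _) ->
  (forall (Z : eucl) (q : Z -> (Y : dflg)), plot Y q -> forall z : Z,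
    exists (A : set 'rV[R]_(edim Z)) (oA : open A) (AZ : A `<=` edom Z), A (sval z) /\
    exists q' : restr oA -> (X : dflg), plot X q' /\ forall v, q (incl oA AZ v) = f ∙ q' v) ->
  is_iso f.
Proof.
move=> inj lifts.
have surj y : exists x, f ∙ x = y.
  pose z : efull R 0 := exist _ 0 I.
  have [A [oA [AZ [Az [q' [_ E]]]]]] := lifts _ _ (plot_cst (efull R 0) y) z.
  by exists (q' (exist _ (sval z) Az)); rewrite -E.
pose g y := sval (cid (surj y)).
have fg y : f ∙ g y = y := svalP (cid (surj y)).
have g_plot (Z : eucl) (q : Z -> (Y : dflg)) : plot Y q -> plot X (g \o q).
  move=> Hq; apply: plot_local => z; have [A [oA [AZ [Az [q' [Hq' E]]]]]] := lifts _ _ Hq z.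
  exists A, oA, AZ; split=> //; move: Hq'; congr (plot _ _).
  by apply/funext => v; apply: inj; rewrite -E /= fg.
by apply: (isoP (g := DMap g_plot : hom Y X)) => [x|y]; [apply: inj|]; exact: fg.
Qed.

Lemma dnu_iso k (k0 : (0 < k)%N) (X : dflg) (eX : elastic X) (eTX : elastic (T X)) :
  is_iso (dnu k X).
Proof.
(* (E1) and (E4) cover only k > 1. For k = 1 the projection from T_1X to TX is already an
   isomorphism. *)
case: (ltnP 1 k) => [k1|k1]; last first.
  have {k0 k1}-> : k = 1%N by case: k k0 k1 => [|[]].
  have E (i : 'I_1) (z : T X) : dpi X ∙ z = dpi X ∙ z by [].
  pose j : hom (T X) (dTk R 1 X) :=
    fprod_lift (f := dpi X : dmap _ _) (k := 1) (a := fun=> idm (T X : DFLG)) (b := dpi X) E.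
  have jK : j \oc dTpr ord0 X = idm (dTk R 1 X).
    by apply: dmap_eq => x; apply: fprod_ext => // i; rewrite [i]ord1.
  have Kj : dTpr ord0 X \oc j = idm (T X) by exact: dmap_eq.
  apply: (isoP (g := fmap T j \oc fprod_pr (fmap T (dpi X) : dmap _ _) ord0)) => x.
    exact: (fmap_retractK (F := T) jK x).
  apply: fprod_ext => // i; rewrite [i]ord1; exact: (fmap_retractK (F := T) Kj).
apply: iso_of_lifts; first exact: (elastic_E4 eX.1 k1).
have Hs (i : 'I_k) (w : fprod (fmap T (dpi X) : dmap _ _) k) :
    dpi (T X) ∙ (dtau eX ∙ (fprod_pr (fmap T (dpi X) : dmap _ _) i w)) =
    fprod_base (fmap T (dpi X) : dmap _ _) k w.
  by rewrite dpi_dtau; exact: (svalP w).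
(* Applying tau to each component exchanges T pi for the projection of T(TX), so the target of nu is
   mapped to T_k(TX), where (E1) for TX supplies generating plots. *)
pose s : hom (fprod (fmap T (dpi X) : dmap _ _) k : DFLG) (dTk R k (T X)) :=
  fprod_lift (f := dpi (T X) : dmap _ _)
    (a := fun i => dmap_comp (dtau eX : dmap _ _) (fprod_pr (fmap T (dpi X) : dmap _ _) i))
    (b := fprod_base (fmap T (dpi X) : dmap _ _) k) Hs.
have ti := elastic_E1 eTX.1 k1.
move=> Z q Hq z.
have G := generates_lan (fun i : plot_index X => tplot (svalP (projT2 i))) (@That_k_local R k)
  (@generates_lan_plots R (That R) X).
have [A [oA [AZ [Az [[U [p Hp']] [g E]]]]]] := G _ _ (dmap_plot (iso_inv ti \oc s : dmap _ _) Hq) z.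
exists A, oA, AZ; split=> //.
have Hp : plot X p by exact: Hp'.
exists (fun v => tin (theta_plot k Hp) (swaphat k U (g v))); split.
  exact: (plot_comp (smap_comp (swaphat k U) g) (lan_in_plot (F := That R) (theta_plot k Hp))).
move=> v; apply: (fprod_ext k0) => i.
have prE b : fmap T (dTpr i X) ∙ tin (theta_plot k Hp) b = tin (tplot Hp) (fm (That R) (prhat_map
  i U) b).
  by apply: lan_map_in => c; exact: dtheta_pr.
apply: etrans (esym (prE _)); rewrite That_prhat_swaphat -dtauE.
(* The map s has inserted one tau and [swaphat] another; as tau is an involution, comparing after
   one of them suffices. *)
rewrite -[LHS](dtau_dtau eX); congr (_ ∙ _).
apply: (etrans (_ : _ = dTpr i (T X) ∙ (s ∙ q (incl oA AZ v)))) => //.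
rewrite -[s ∙ _](iso_invKr ti).
apply: etrans (congr1 (fun y => dTpr i (T X) ∙ (dtheta k (T X) ∙ y)) (E v)) _.
apply: etrans (dtheta_pr _ (g v) i) _.
by apply: (lan_in_ext (F := That R) (tplot _) (tplot Hp)) => u; exact: (lan_in_ext (F := That R)).
Qed.
End ThirdOrder.

(** * The structure on elastic spaces *)

Section TangentCategory.
Variables (R : realType) (closed : elst_closed R).
Local Notation DFLG := (DFLG R).
Local Notation ELST := (ELST R).
Local Notation T := (dT R).
Local Notation D := (elst_tangent closed).
Local Notation Rg := (elst_line_ring closed).
Local Notation space X := (sval (X : ELST) : dflg R).

Lemma is_sumP (A X : ELST) (a b c : hom A (tT D X)) :
  @is_sum _ D A X a b c <->
  forall t : space A, psum (svalP X) ((a : dmap _ _) t) ((b : dmap _ _) t) ((c : dmap _ _) t).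
Proof.
split=> [[h [<- <- <-]] t|S]; first by exists ((h : dmap _ _) t).
have E (i : 'I_2) t : dpi (space X) ∙ ((if i == ord0 then a : dmap _ _ else b) t) =
    (dpi (space X) \oc (a : hom (space A : DFLG) (T (space X)))) ∙ t.
  rewrite dcompE; case: eqP => // _; exact: (esym (psum_base (S t)).1).
pose h : hom (space A : DFLG) (dTk R 2 (space X)) := fprod_lift E.
exists h; split; apply: dmap_eq => t //.
have [w [wa wb <-]] := S t; congr (dplus _ ∙ _).
by apply: fprod_ext => // i; elim/ord2_ind: i; [exact: esym wa|exact: esym wb].
Qed.

(** The universal property is proved against all diffeological Q, hence against elastic ones, since
    [ELST] is a full subcategory. In this way the comparison space [fprod] never has to be shown
    elastic. *)
Lemma fiber_power_of_iso (A B P : DFLG) (f : hom A B) k (k0 : (0 < k)%N) (p : 'I_k -> hom P A)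
    (nu : hom P (fprod (f : dmap _ _) k : DFLG)) :
  (forall i x, fprod_pr (f : dmap _ _) i (nu ∙ x) = p i ∙ x) -> is_iso nu ->
  forall (Q : DFLG) (q : 'I_k -> hom Q A), (forall i j, f \oc q i = f \oc q j) ->
  exists! h : hom Q P, forall i, p i \oc h = q i.
Proof.
move=> nuE nu_iso Q q E; pose i0 := Ordinal k0.
have Eq i x : f ∙ (q i ∙ x) = (f \oc q i0) ∙ x by exact: (hom_congr x (E i i0)).
pose g : hom Q (fprod (f : dmap _ _) k : DFLG) := fprod_lift Eq.
exists (iso_inv nu_iso \oc g); split=> [i|h Eh].
  by apply: dmap_eq => x; rewrite !dcompE -nuE iso_invKr.
apply: dmap_eq => x; rewrite dcompE -[RHS](iso_invK nu_iso); congr (_ ∙ _).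
apply: (fprod_ext k0) => i; rewrite nuE; exact: (esym (hom_congr x (Eh i))).
Qed.

Lemma elst_tangent_structure : is_tangent_structure D.
Proof.
have eT (X : ELST) : elastic (T (space X)) := elst_T closed (svalP X).
split.
- by move=> k k0 i X Y f; exact: dmap_eq.
- by move=> X Y f; exact: dpi_natural.
- by move=> X Y f; apply: dmap_eq => x; exact: dzero_natural.
- move=> X Y f; apply: dmap_eq => w.
  have S (Z : ELST) v : psum (svalP Z) (dTpr ord0 _ ∙ v) (dTpr ord_max _ ∙ v) (dplus (svalP Z) ∙ v).
    by exists v.
  exact: psum_fun (S Y (fmap (dTk R 2) f ∙ w)) (psum_natural _ f (S X w)).
- by move=> X Y f; apply: dmap_eq => x; exact: dlam_natural.
- move=> X Y f; apply: dmap_eq; apply: T2_ind => U p Hp a.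
  have E b : fmap T (fmap T f) ∙ tin (tplot Hp) b = tin (tplot (dmap_plot (f : dmap _ _) Hp)) b.
    by apply: lan_map_in0 => c; exact: lan_mapE.
  apply: etrans (congr1 (fun x => dtau (svalP Y) ∙ x) (E a)) _; rewrite dtauE.
  by apply: esym; apply: etrans (congr1 (fun x => fmap T (fmap T f) ∙ x) (dtauE _ Hp a)) (E _).
- move=> k k0 X; split=> [i j|Q q Eq].
    by apply: dmap_eq => w; exact: etrans (svalP w i) (esym (svalP w j)).
  apply: (@fiber_power_of_iso _ _ (dTk R k (space X)) (dpi (space X)) k k0 (fun i => dTpr i
    (space X)) (idm _)) => //.
  by exists (idm _); split; rewrite comp_idl.
- move=> k k0 X; split=> [i j|Q q Eq].
    apply: dmap_eq => w; exact: etrans (dnu_subproof i w) (esym (dnu_subproof j w)).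
  apply: (@fiber_power_of_iso _ _ (T (dTk R k (space X))) (fmap T (dpi (space X))) k k0
    (fun i => fmap T (dTpr i (space X))) (dnu k (space X))) => //.
  exact: (dnu_iso k0 (svalP X) (eT X)).
- move=> X; apply: dmap_eq => w.
  have S : psum (svalP X) (dTpr ord0 _ ∙ w) (dTpr ord_max _ ∙ w) (dplus (svalP X) ∙ w) by exists w.
  exact: (esym (psum_base S).2).
- by move=> X; apply: dmap_eq => x; exact: dpi_dzero.
- move=> A X a b c ab bc s /is_sumP H1 /is_sumP H2 /is_sumP H3; apply/is_sumP => t.
  exact: psum_assoc (H1 t) (H2 t) (H3 t).
- by move=> A X a b s /is_sumP H; apply/is_sumP => t; exact: psum_comm.
- by move=> A X a; apply/is_sumP => t; exact: psum_zero.
(* Additive inverses come from the scalar multiplication, as multiplication by -1. *)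
- pose r : line R := line_of (const_mx (-1)).
  pose opp (X : ELST) : hom (tT D X) (tT D X) :=
    dmap_comp (dkappa (space X) : dmap _ _)
      (dpair (@DMap R (T (space X)) (line R) (fun=> r) (fun U p _ => plot_cst U r)) (dmap_id _)).
  exists opp; split.
  + by move=> X Y f; apply: dmap_eq => x; exact: dkappa_natural.
  + move=> X; apply: dmap_eq => x; exact: (psum_base (psum_opp (svalP X) x)).1.
  + by move=> A X a; apply/is_sumP => t; exact: psum_opp.
- by move=> X; apply: dmap_eq => x; exact: dtau_dtau.
- by move=> X; apply: dmap_eq => x; exact: dtau_braid.
- by move=> X; apply: dmap_eq => x; exact: dpi_dtau.
- by move=> X; apply/is_sumP => t; exact: psum_dtau.
- by move=> X; apply: dmap_eq => x; exact: dpi_dlam.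
- by move=> X; apply: dmap_eq => x; exact: dlam_dlam.
- move=> X; apply/is_sumP => t; apply: (psum_dlam (eX := svalP X)).
  by exists t.
- by move=> X; apply: dmap_eq => x; exact: dtau_dlam.
- by move=> X; apply: dmap_eq => x; exact: dtau_Tdlam.
move=> X.
have Eu (i : 'I_2) w : dpi (space X) ∙ ((if i == ord0 then dpi (T (space X)) else fmap T (dpi
  (space X))) ∙ w) =
    (dpi (space X) \oc dpi (T (space X))) ∙ w.
  by case: eqP => // _; exact: (hom_congr w (dpi_natural (dpi (space X)))).
have Ez (i : 'I_2) x : dpi (space X) ∙ (dzero (space X) ∙ x) = idm (space X : DFLG) ∙ x.
  exact: dpi_dzero.
pose u : hom (T (T (space X))) (dTk R 2 (space X)) := fprod_lift Eu.
pose z : hom (space X : DFLG) (dTk R 2 (space X)) := fprod_lift Ez.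
exists u, z; split; try exact: dmap_eq.
have uE w y : u ∙ w = z ∙ y -> dpi _ ∙ w = dzero _ ∙ y /\ fmap T (dpi _) ∙ w = dzero _ ∙ y.
  by move=> E; split; [exact: (congr1 (fun v => dTpr ord0 (space X) ∙ v) E)
                      |exact: (congr1 (fun v => dTpr ord_max (space X) ∙ v) E)].
split.
  apply: dmap_eq => x; apply: fprod_ext => // i.
  by elim/ord2_ind: i; [exact: dpi_dlam|exact: Tdpi_dlam].
move=> Q q1 q2 E; have [lam_inj lam_plot] := elastic_E3 (svalP X).1.
(* The two components of [E] say that both projections of q1(t) are the zero vector over q2(t). The
   preimages exist pointwise by [lam_image], and the induction property (E3) then makes their choice
   smooth. *)
have lift t : exists v, dlam (space X) ∙ v = (q1 : dmap _ _) t.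
  by have [E1 E2] := uE _ _ (hom_congr t E); exact: (lam_image (svalP X) (eT X) E1 E2).
pose g t := sval (cid (lift t)).
have gE t : dlam (space X) ∙ g t = (q1 : dmap _ _) t := svalP (cid (lift t)).
have g_plot (U : eucl R) (p : U -> space Q) : plot (space Q) p -> plot (T (space X)) (g \o p).
  move=> Hp; apply: lam_plot; have := dmap_plot (q1 : dmap _ _) Hp.
  by congr (plot _ _); apply/funext => v; exact: (esym (gE (p v))).
exists (DMap g_plot); split=> [|h [h1 h2]].
  split; apply: dmap_eq => t; first exact: gE.
  (* The component in X is forced because the zero section is injective, being split by pi. *)
  have [E1 _] := uE _ _ (hom_congr t E); move: E1; rewrite -gE dpi_dlam => E1.
  by rewrite -[RHS]dpi_dzero -[LHS]dpi_dzero; congr (_ ∙ _); exact: E1.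
by apply: dmap_eq => t; apply: lam_inj; apply: etrans (gE t) (esym (hom_congr t h1)).
Qed.
End TangentCategory.

(** * The ring object of real numbers and its action on tangent vectors *)

Section ScalarMultiplication.
Variables (R : realType) (closed : elst_closed R).
Local Notation DFLG := (DFLG R).
Local Notation ELST := (ELST R).
Local Notation T := (dT R).
Local Notation D := (elst_tangent closed).
Local Notation Rg := (elst_line_ring closed).
Local Notation space X := (sval (X : ELST) : dflg R).

Lemma op_eq_dprod (A B1 B2 Z : DFLG) (m : hom (dprod B1 B2 : DFLG) Z) (a : hom A B1) (b : hom A B2)
    (c : hom A Z) :
  op_eq (dfst B1 B2 : hom (dprod B1 B2 : DFLG) B1) (dsnd B1 B2 : hom (dprod B1 B2 : DFLG) B2) m a
    b c <->
  forall t, m ∙ (a ∙ t, b ∙ t) = c ∙ t.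
Proof.
split=> [[h [<- <- <-]] t|E]; first by rewrite !dcompE -surjective_pairing.
by exists (dpair (a : dmap _ _) (b : dmap _ _)); split; apply: dmap_eq.
Qed.

Lemma dprod_is_product (A B Q : DFLG) (q1 : hom Q A) (q2 : hom Q B) :
  exists! h : hom Q (dprod A B : DFLG),
    (dfst A B : hom (dprod A B : DFLG) A) \oc h = q1 /\ (dsnd A B : hom (dprod A B : DFLG) B) \oc
      h = q2.
Proof.
exists (dpair (q1 : dmap _ _) (q2 : dmap _ _)); split; first by split; exact: dmap_eq.
by move=> h [<- <-]; apply: dmap_eq => t; exact: (esym (surjective_pairing (h ∙ t))).
Qed.

Lemma is_raddP (A : ELST) (a b c : hom A (r_ob Rg)) :
  @is_radd _ Rg A a b c <->
  forall t : space A, sval ((a : dmap _ _) t) + sval ((b : dmap _ _) t) = sval ((c : dmap _ _) t).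
Proof.
apply: iff_trans (@op_eq_dprod (space A) (line R) (line R) (line R) (line_add R) a b c) _.
by split=> H t; [rewrite -H|apply: epoint_eq; exact: H].
Qed.

Lemma is_rmulP (A : ELST) (a b c : hom A (r_ob Rg)) :
  @is_rmul _ Rg A a b c <->
  forall t : space A, sval ((a : dmap _ _) t) 0 0 *: sval ((b : dmap _ _) t) = sval ((c : dmap _
    _) t).
Proof.
apply: iff_trans (@op_eq_dprod (space A) (line R) (line R) (line R) (line_mul R) a b c) _.
by split=> H t; [rewrite -H|apply: epoint_eq; exact: H].
Qed.

Lemma scale_row1 (x y : 'rV[R]_1) : x 0 0 *: y = y 0 0 *: x.
Proof. by apply/rowP => i; rewrite !mxE [i]ord1 mulrC. Qed.

Lemma elst_ring_object : is_ring_object Rg.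
Proof.
split.
- move=> A; exists (@DMap R (space A) (dpoint R) (fun=> tt) (fun _ _ _ => I)) => g.
  by apply: dmap_eq => t; case: ((g : dmap _ _) t).
- by move=> Q q1 q2; exact: (@dprod_is_product (line R) (line R) (space Q)).
- move=> A a b c ab bc s /is_raddP H1 /is_raddP H2 /is_raddP H3; apply/is_raddP => t.
  by rewrite -H2 addrA H1 H3.
- by move=> A a b s /is_raddP H; apply/is_raddP => t; rewrite addrC H.
- by move=> A p a; apply/is_raddP => t; rewrite /= add0r.
- by move=> A p a; apply/is_raddP => t; rewrite /= addNr.
- move=> A a b c ab bc s /is_rmulP H1 /is_rmulP H2 /is_rmulP H3; apply/is_rmulP => t.
  by rewrite -H2 -H3 -H1 scalerA mxE.
- by move=> A p a; apply/is_rmulP => t; rewrite /= mxE scale1r.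
- by move=> A p a; apply/is_rmulP => t; rewrite scale_row1 /= mxE scale1r.
- move=> A a b c ab ac bc s /is_raddP H1 /is_rmulP H2 /is_rmulP H3 /is_rmulP H4;
  apply/is_raddP => t.
  by rewrite -H2 -H3 -H4 -H1 mxE scalerDl.
- move=> A a b c ab ac bc s /is_raddP H1 /is_rmulP H2 /is_rmulP H3 /is_rmulP H4;
  apply/is_raddP => t.
  by rewrite -H2 -H3 -H4 -H1 scalerDr.
Qed.

Local Notation p1 := (elst_lineT_fst closed).
Local Notation p2 := (elst_lineT_snd closed).
Local Notation kappa := (elst_kappa closed).

Lemma is_scaledP (A X : ELST) (r : hom A (r_ob Rg)) (v w : hom A (tT D X)) :
  @is_scaled _ D Rg _ p1 p2 kappa A X r v w <->
  forall t : space A, dkappa (space X) ∙ ((r : dmap _ _) t, (v : dmap _ _) t) = (w : dmap _ _) t.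
Proof. exact: (@op_eq_dprod (space A) (line R) (T (space X)) (T (space X)) (dkappa (space X)) r v
  w). Qed.

Lemma elst_scalar_mult : is_scalar_mult D Rg p1 p2 kappa.
Proof.
split.
- by move=> X Q q1 q2; exact: (@dprod_is_product (line R) (T (space X)) (space Q)).
- move=> X Q q1 q2; set Y := T (space X).
  (* The mediating map is first formed into T(line) x T(Y) and then carried to T(line x Y) by the
     isomorphism [lan_pair]. *)
  have [h [[h1 h2] h_uniq]] := @dprod_is_product (T (line R)) (T Y) (space Q) q1 q2.
  exists (lan_pair (That_products R) (line R) Y \oc h); split.
    split; apply: dmap_eq => t; [rewrite -h1|rewrite -h2].
      exact: (lan_pair_fst (X := line R) (Y := Y) (That_products R) (h ∙ t)).
    exact: (lan_pair_snd (X := line R) (Y := Y) (That_products R) (h ∙ t)).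
  move=> g [g1 g2]; have E : h = lan_split (That R) (line R) Y \oc g.
    by apply: h_uniq; rewrite -g1 -g2; split; exact: dmap_eq.
  by rewrite E; apply: dmap_eq => t; exact: (lan_splitK (That_products R)).
- by move=> X Y f; apply/is_scaledP => -[r v]; exact: dkappa_natural.
- move=> X; apply: dmap_eq => -[r]; apply: T_ind => U p Hp u v.
  apply: etrans (congr1 (fun x => dpi (space X) ∙ x) (dkappa_tin r Hp u v)) _.
  by rewrite dpi_tin; exact: (esym (dpi_tin Hp u v)).
- move=> A X r s rs v sv w /is_rmulP H1 /is_scaledP H2 /is_scaledP H3; apply/is_scaledP => t.
  rewrite -H3 -H2; move: (H1 t) => {H1}.
  elim/T_ind: ((v : dmap _ _) t) => U p Hp u x H1.
  by rewrite !dkappa_tin -H1 mxE scalerA.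
- move=> A X p v; apply/is_scaledP => t; elim/T_ind: ((v : dmap _ _) t) => U q Hq u x.
  by rewrite dkappa_tin /= mxE scale1r.
- move=> A X r s rs v rv sv w /is_raddP H1 /is_scaledP H2 /is_scaledP H3 /is_scaledP H4.
  apply/is_sumP => t; rewrite -H2 -H3 -H4; move: (H1 t) => {H1}.
  elim/T_ind: ((v : dmap _ _) t) => U p Hp u x H1.
  by rewrite !dkappa_tin -H1 mxE scalerDl; exact: psum_tpt.
- move=> A X r v w vw rv rw u /is_sumP H1 /is_scaledP H2 /is_scaledP H3 /is_scaledP H4.
  apply/is_sumP => t; rewrite -H2 -H3 -H4.
  have [U [p [Hp [x [a [b [-> -> ->]]]]]]] := psum_elim (H1 t).
  by rewrite !dkappa_tin scalerDr; exact: psum_tpt.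
- move=> X h h1 h2; pose P := dprod (line R) (T (T (space X))).
  apply: dmap_eq => -[r w].
  have E1 := congr1 (fun g : dmap P (T (line R)) => g (r, w)) h1.
  have E2 := congr1 (fun g : dmap P (T (T (space X))) => g (r, w)) h2.
  exact: (dtau_dkappa (z := (h : dmap P (T (dprod (line R) (T (space X))))) (r, w)) E1 E2).
- by move=> X; apply/is_scaledP => -[r v]; exact: (esym (dkappa_dlam r v)).
Qed.
End ScalarMultiplication.

Theorem theorem4p2 (R : realType) :
  exists closed : elst_closed R,
    is_tangent_structure (elst_tangent closed) /\
    is_ring_object (elst_line_ring closed) /\
    is_scalar_mult (elst_tangent closed) (elst_line_ring closed)
      (elst_lineT_fst closed) (elst_lineT_snd closed) (elst_kappa closed).
Proof.
exists (elst_closed_proof R); split; first exact: elst_tangent_structure.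
split; [exact: elst_ring_object|exact: elst_scalar_mult].
Qed.
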